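(* (Good action 2.) We get a faithful, good action ${}_\triangleleft$ of the face monoid $\widehat{\mathcal W}$ on the Coxeter complex $\mathcal C$ in the following way: Let $\sigma_1\varepsilon(R(\Theta))\sigma_2\in\widehat{\mathcal W}$ ($\sigma_1,\sigma_2\in\mathcal W$, $\Theta\subseteq I$ special) and $\tau\mathcal W_J\in\mathcal C$. Decompose $\sigma_2\tau$ in the form $$\sigma_2\tau=a_1a_2\,x\,c_1c_2$$ where $a_1\in\mathcal W_{\Theta^\bot}$, $a_2\in\mathcal W_\Theta$, $x\in{}^{\Theta\cup\Theta^\bot}\mathcal W^{J^\infty\cup(J^\infty)^\bot}$, $c_1\in(\mathcal W_{(J^\infty)^\bot})^{J^0}$ and $c_2\in\mathcal W_J$, such that in addition $xc_1\in{}^{\Theta\cup\Theta^\bot}\mathcal W^J$. Set $\Xi:=\Theta\cup J^\infty\cup red(x)$. Then $$\sigma_1\varepsilon(R(\Theta))\sigma_2\;{}_\triangleleft\;\tau\mathcal W_J=\sigma_1a_1\mathcal W_{\Xi\cup(\Xi^\bot\cap c_1J^0)} .$$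
   Context: $A=(a_{ij})_{i,j\in I}$ ($I$ finite) is a symmetrizable generalized Cartan matrix with a minimal realization over $\mathbb R$: a real vector space $\mathfrak h_{\mathbb R}$ of dimension $2|I|-\mathrm{rank}\,A$, linearly independent $(h_i)_{i\in I}$ in $\mathfrak h_{\mathbb R}$ and linearly independent $(\alpha_i)_{i\in I}$ in $\mathfrak h_{\mathbb R}^*$ with $\alpha_j(h_i)=a_{ij}$. The Weyl group $\mathcal W$ is the Coxeter group generated by the simple reflections $\sigma_i$ ($i\in I$), acting on $\mathfrak h_{\mathbb R}^*$ by $\sigma_i\lambda=\lambda-\lambda(h_i)\alpha_i$. For $J\subseteq I$: $\mathcal W_J=\langle\sigma_j\mid j\in J\rangle$; $\mathcal W^J$ (resp. ${}^J\mathcal W$) is the set of minimal length representatives of $\mathcal W/\mathcal W_J$ (resp. $\mathcal W_J\backslash\mathcal W$); ${}^K\mathcal W^J={}^K\mathcal W\cap\mathcal W^J$; for $L\subseteq K$, $(\mathcal W_K)^L=\mathcal W_K\cap\mathcal W^L$. $red(\sigma)\subseteq I$ is the set of indices of simple reflections occurring in a (any) reduced expression of $\sigma$. $I$ is identified with the set of simple roots, so $K\cap\sigma J=\{i\in K\mid\alpha_i=\sigma\alpha_j\text{ for some }j\in J\}$. $J^\bot=\{i\in I\mid a_{ij}=0\ \forall j\in J\}$. $J^0$ (resp. $J^\infty$) is the union of the connected components of $J$ for which the corresponding submatrix of $A$ is of finite (resp. non-finite) type ($\emptyset^0=\emptyset^\infty=\emptyset$); note $J^0\subseteq(J^\infty)^\bot$.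 $\Theta\subseteq I$ is special if $\Theta=\Theta^\infty$. The Tits cone is $X=\mathcal W\{\lambda\in\mathfrak h_{\mathbb R}^*\mid\lambda(h_i)\ge0\ \forall i\in I\}$; faces of $X$ are (nonempty) faces of the convex cone $X$ in the sense of convex geometry. For $\Theta$ special, $R(\Theta)=\{\lambda\in X\mid\lambda(h_i)=0\ \forall i\in\Theta\}$ is a face, and every face is $\sigma R(\Theta)$ with $\sigma\in\mathcal W$ and a unique special $\Theta$. **Face monoid $\widehat{\mathcal W}$.** On the set of pairs $(\sigma,R)$ ($\sigma\in\mathcal W$, $R$ a face of $X$) with product $(\sigma,R)(\tau,S)=(\sigma\tau,\tau^{-1}R\cap S)$ consider the congruence $(\sigma,R)\sim(\sigma',R')$ iff $R=R'$ and $\sigma^{-1}\sigma'$ fixes $R$ pointwise. $\widehat{\mathcal W}$ is the quotient monoid; $\sigma\varepsilon(R)$ is the class of $(\sigma,R)$, $\varepsilon(R)=1\varepsilon(R)$, and $\sigma\in\mathcal W$ is identified with $\sigma\varepsilon(X)$. Every element of $\widehat{\mathcal W}$ has the form $\sigma_1\varepsilon(R(\Theta))\sigma_2$. $\widehat{\mathcal W}_J=\{\sigma\varepsilon(\tau R(\Theta))\mid\sigma,\tau\in\mathcal W_J,\ \Theta\subseteq J\text{ special}\}$ is the standard parabolic submonoid of type $J$. **Coxeter complex and good actions.** $\mathcal C=\{\sigma\mathcal W_J\mid\sigma\in\mathcal W,J\subseteq I\}$, ordered by reverse inclusion; $\mathcal W$ acts by left multiplication. An action of $\widehat{\mathcal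 W}$ on $\mathcal C$ extending the action of $\mathcal W$ is called good if (1) $\mathrm{Stab}_{\widehat{\mathcal W}}(\mathcal W_J)=\widehat{\mathcal W}_J$ for all $J\subseteq I$, and (2) $\widehat{\mathcal W}$ acts order preservingly on $\mathcal C$. *)

(* Defs.v *)
From HB Require Import structures.
From mathcomp Require Import all_boot all_order all_algebra.
From mathcomp Require Import boolp classical_sets reals.

Set Implicit Arguments.
Unset Strict Implicit.
Unset Printing Implicit Defensive.

Import Order.TTheory GRing.Theory Num.Theory.
Local Open Scope classical_set_scope.
Local Open Scope ring_scope.
Local Open Scope quotient_scope.

Record gcm (I : finType) := GCM {
  gcm_fun :> I -> I -> int;
  gcm_diag : forall i, gcm_fun i i = 2;
  gcm_offdiag : forall i j, i != j -> gcm_fun i j <= 0;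
  gcm_zero : forall i j, gcm_fun i j = 0 -> gcm_fun j i = 0 }.

(* A = D B with D an invertible diagonal and B a symmetric matrix. *)
Definition symmetrizable (R : realType) (I : finType) (A : gcm I) : Prop :=
  exists (d : I -> R) (B : I -> I -> R),
    [/\ forall i, d i != 0, forall i j, B i j = B j i
      & forall i j, (A i j)%:~R = d i * B i j].

Definition gcm_submx (R : realType) (I : finType) (A : gcm I) (C : {set I}) :
    'M[R]_#|C| :=
  \matrix_(i, j) (A (enum_val i) (enum_val j))%:~R.

Record realization (R : realType) (I : finType) (A : gcm I) := Realization {
  cartan : vectType R;
  coroot : I -> cartan;
  sroot : I -> 'Hom(cartan, R^o);
  cartan_dim :
    \dim {: cartan} = (2 * #|I| - \rank (gcm_submx R A [set: I]%SET))%N;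
  coroot_free : free [seq coroot i | i : I];
  sroot_free : free [seq sroot i | i : I];
  sroot_coroot : forall i j, sroot j (coroot i) = (A i j)%:~R }.

Section Subdiagrams.
Variables (R : realType) (I : finType) (A : gcm I).
Implicit Types (J C Theta : {set I}).

Definition perp J : {set I} := [set i | [forall j in J, A i j == 0]]%SET.

Definition adj J : rel I := [rel i j | [&& i \in J, j \in J & A i j != 0]].

Definition component J i : {set I} := [set j in J | connect (adj J) i j]%SET.

(* The case (Fin) in Kac's trichotomy for indecomposable matrices. *)
Definition finite_type C : Prop :=
  let M := gcm_submx R A C in
  [/\ \det M != 0,
      exists u : 'cV[R]_#|C|,
        (forall i, 0 < u i 0) /\ (forall i, 0 < (M *m u) i 0)
    & forall v : 'cV[R]_#|C|, (forall i, 0 <= (M *m v) i 0) ->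
        (forall i, 0 < v i 0) \/ v = 0].

Definition finpart J : {set I} :=
  [set i in J | `[< finite_type (component J i) >]]%SET.

Definition infpart J : {set I} :=
  [set i in J | ~~ `[< finite_type (component J i) >]]%SET.

Definition special Theta : Prop := Theta = infpart Theta.

End Subdiagrams.

Section WeylGroup.
Variables (R : realType) (I : finType) (A : gcm I) (D : realization R A).

Definition dual : vectType R := 'Hom(cartan D, R^o).

Definition srefl_fun (i : I) (l : dual) : dual :=
  l - (l (coroot D i) : R) *: sroot D i.

Fact srefl_fun_is_linear i : linear (srefl_fun i).
Proof.
move=> a u v; rewrite /srefl_fun add_lfunE scale_lfunE scalerDl -scalerA.
by rewrite scalerBr opprD addrACA.
Qed.

HB.instance Definition _ i :=
  GRing.isLinear.Build R dual dual _ (srefl_fun i) (srefl_fun_is_linear i).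

Definition srefl_end (i : I) : 'End(dual) := linfun (srefl_fun i).

Definition word_end (s : seq I) : 'End(dual) :=
  foldr (fun i f => srefl_end i \o f)%VF \1%VF s.

(* The Weyl group, as the subgroup of GL(h^* ) generated by the simple
   reflections: these are involutions, so products of them suffice. *)
Record weyl := Weyl {
  weyl_val : 'End(dual);
  weyl_valP : `[< exists s, weyl_val = word_end s >] }.

HB.instance Definition _ := [isSub for weyl_val].
HB.instance Definition _ := [Choice of weyl by <:].

Definition weyl_act (w : weyl) (l : dual) : dual := weyl_val w l.

Lemma srefl_endK i : (srefl_end i \o srefl_end i)%VF = \1%VF.
Proof.
apply/lfunP => l; rewrite comp_lfunE id_lfunE !lfunE /= /srefl_fun.
set c := (l (coroot D i) : R); rewrite add_lfunE opp_lfunE scale_lfunE.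
rewrite sroot_coroot gcm_diag.
have -> : (l (coroot D i) - c *: (2%:~R : R^o) : R) = - c.
  by rewrite -/c /GRing.scale /= mulr_natr mulr2n opprD addNKr.
by rewrite scaleNr opprK subrK.
Qed.

Lemma word_end_cat s t : word_end (s ++ t) = (word_end s \o word_end t)%VF.
Proof.
elim: s => [|i s IHs] /=; first by rewrite comp_lfun1l.
by rewrite IHs comp_lfunA.
Qed.

Lemma word_end_revl s : (word_end (rev s) \o word_end s)%VF = \1%VF.
Proof.
elim: s => [|i s IHs]; first by rewrite /rev /= comp_lfun1l.
rewrite rev_cons -cats1 word_end_cat /= comp_lfun1r.
by rewrite -comp_lfunA [X in (_ \o X)%VF]comp_lfunA srefl_endK comp_lfun1l.
Qed.

Lemma word_end_revr s : (word_end s \o word_end (rev s))%VF = \1%VF.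
Proof. by rewrite -{1}[s]revK word_end_revl. Qed.

Definition weyl_of (s : seq I) : weyl :=
  Weyl (asboolT (ex_intro (fun t => word_end s = word_end t) s erefl)).

Fact weyl_mul_subproof (v w : weyl) :
  `[< exists s, (weyl_val v \o weyl_val w)%VF = word_end s >].
Proof.
have /asboolP[s ->] := weyl_valP v; have /asboolP[t ->] := weyl_valP w.
by apply/asboolP; exists (s ++ t); rewrite word_end_cat.
Qed.

Fact weyl_inv_subproof (w : weyl) : exists v : weyl,
  (weyl_val v \o weyl_val w)%VF = \1%VF /\
  (weyl_val w \o weyl_val v)%VF = \1%VF.
Proof.
have /asboolP[s ->] := weyl_valP w; exists (weyl_of (rev s)) => /=.
by rewrite word_end_revl word_end_revr.
Qed.

Definition weyl_one : weyl := weyl_of [::].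
Definition weyl_mul (v w : weyl) : weyl := Weyl (weyl_mul_subproof v w).
Definition weyl_inv (w : weyl) : weyl := sval (cid (weyl_inv_subproof w)).

Fact weyl_mulA : associative weyl_mul.
Proof. by move=> u v w; apply: val_inj; rewrite /= comp_lfunA. Qed.
Fact weyl_mul1 : left_id weyl_one weyl_mul.
Proof. by move=> w; apply: val_inj; rewrite /= comp_lfun1l. Qed.
Fact weyl_1mul : right_id weyl_one weyl_mul.
Proof. by move=> w; apply: val_inj; rewrite /= comp_lfun1r. Qed.
Fact weyl_mulV : left_inverse weyl_one weyl_inv weyl_mul.
Proof.
by move=> w; apply: val_inj; case: (svalP (cid (weyl_inv_subproof w))).
Qed.
Fact weyl_Vmul : right_inverse weyl_one weyl_inv weyl_mul.
Proof.
by move=> w; apply: val_inj; case: (svalP (cid (weyl_inv_subproof w))).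
Qed.

HB.instance Definition _ :=
  isGroup.Build weyl weyl_mulA weyl_mul1 weyl_1mul weyl_mulV weyl_Vmul.

Lemma weyl_actM (v w : weyl) l :
  weyl_act (v * w)%g l = weyl_act v (weyl_act w l).
Proof. by rewrite /weyl_act /= comp_lfunE. Qed.

Lemma weyl_act1 l : weyl_act 1%g l = l.
Proof. by rewrite /weyl_act /= id_lfunE. Qed.

Lemma weyl_actK (w : weyl) : cancel (weyl_act w) (weyl_act w^-1%g).
Proof. by move=> l; rewrite -weyl_actM mulVg weyl_act1. Qed.

Lemma weyl_actVK (w : weyl) : cancel (weyl_act w^-1%g) (weyl_act w).
Proof. by move=> l; rewrite -weyl_actM mulgV weyl_act1. Qed.

Lemma weyl_actD (w : weyl) l m :
  weyl_act w (l + m) = weyl_act w l + weyl_act w m.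
Proof. exact: linearD. Qed.

Lemma weyl_actZ (w : weyl) a l : weyl_act w (a *: l) = a *: weyl_act w l.
Proof. exact: linearZ. Qed.

Definition srefl (i : I) : weyl := weyl_of [:: i].

Definition word (s : seq I) : weyl := (\prod_(i <- s) srefl i)%g.

Lemma wordE s : word s = weyl_of s.
Proof.
rewrite /word; elim: s => [|i s IHs]; first by rewrite big_nil.
by rewrite big_cons IHs; apply: val_inj; rewrite /= comp_lfun1r.
Qed.

Fact len_subproof (w : weyl) :
  exists n, `[< exists s, w = word s /\ size s = n >].
Proof.
case: w => f fP; have /asboolP[s fE] := fP.
exists (size s); apply/asboolP; exists s; split=> //.
by rewrite wordE; apply: val_inj.
Qed.

Definition len (w : weyl) : nat := ex_minn (len_subproof w).

Definition red (w : weyl) : {set I} :=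
  [set i | `[< exists s, [/\ w = word s, size s = len w & i \in s] >]]%SET.

Definition parabolic (J : {set I}) : set weyl :=
  [set w | exists2 s, all (mem J) s & w = word s].

(* W^J *)
Definition minreps_r (J : {set I}) : set weyl :=
  [set w | forall v, parabolic J v -> (len w <= len (w * v)%g)%N].

(* ^J W *)
Definition minreps_l (J : {set I}) : set weyl :=
  [set w | forall v, parabolic J v -> (len w <= len (v * w)%g)%N].

(* I \cap w J, with I identified with the set of simple roots *)
Definition simple_image (w : weyl) (J : {set I}) : {set I} :=
  [set i | [exists j in J, (sroot D i : dual) == weyl_act w (sroot D j)]]%SET.

End WeylGroup.

Arguments parabolic {R I A} D J.
Arguments minreps_r {R I A} D J.
Arguments minreps_l {R I A} D J.

Section Faces.
Variables (R : realType) (I : finType) (A : gcm I) (D : realization R A).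
Implicit Types (F G : set (dual D)) (w : weyl D).

Definition dominant : set (dual D) :=
  [set l | forall i, 0 <= (l (coroot D i) : R)].

Definition tits_cone : set (dual D) :=
  [set weyl_act w l | w in setT & l in dominant].

(* The Tits cone X is convex, so that the hypothesis [tits_cone z] in the
   convexity clause holds automatically; stating it makes X a face of itself
   without appeal to that theorem. *)
Definition is_face F : Prop :=
  [/\ F `<=` tits_cone, F !=set0,
      forall x y (t : R), F x -> F y -> 0 <= t <= 1 ->
        let z := (1 - t) *: x + t *: y in tits_cone z -> F z
    & forall x y (t : R), tits_cone x -> tits_cone y -> 0 < t < 1 ->
        F ((1 - t) *: x + t *: y) -> F x /\ F y].

Record face := Face {
  face_set :> set (dual D);
  face_setP : `[< is_face face_set >] }.

HB.instance Definition _ := [isSub for face_set].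
HB.instance Definition _ := [Choice of face by <:].

Lemma face_is_face (F : face) : is_face F.
Proof. exact/asboolP/face_setP. Qed.

Lemma tits_cone0 : tits_cone 0.
Proof.
exists 1%g => //; exists 0; last by rewrite weyl_act1.
by move=> i; rewrite zero_lfunE.
Qed.

Lemma tits_coneZ a l : 0 <= a -> tits_cone l -> tits_cone (a *: l).
Proof.
move=> a0 [w _ [m dm <-]]; exists w => //; exists (a *: m).
  by move=> i; rewrite scale_lfunE; apply: mulr_ge0 (dm i).
by rewrite weyl_actZ.
Qed.

Lemma tits_cone_act w l : tits_cone l -> tits_cone (weyl_act w l).
Proof.
by move=> [v _ [m dm <-]]; exists (w * v)%g => //; exists m; rewrite ?weyl_actM.
Qed.

Lemma tits_cone_is_face : is_face tits_cone.
Proof. by split=> //; exists 0; exact: tits_cone0. Qed.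

Lemma is_face0 F : is_face F -> F 0.
Proof.
move=> [FX [x Fx] _ ext].
have h2 : 0 < (2^-1 : R) < 1 by rewrite invr_gt0 ltr0n invf_lt1 ?ltr1n ?ltr0n.
have X2x : tits_cone (2 *: x) by apply: tits_coneZ (FX _ Fx).
have [] // := ext 0 (2 *: x) 2^-1 tits_cone0 X2x h2.
by rewrite scaler0 add0r scalerA mulVf ?pnatr_eq0 // scale1r.
Qed.

Lemma is_faceI F G : is_face F -> is_face G -> is_face (F `&` G).
Proof.
move=> Ff Gf; have [F0 G0] := (is_face0 Ff, is_face0 Gf).
case: Ff Gf => [FX _ Fc Fe] [_ _ Gc Ge]; split.
- by move=> x [/FX].
- by exists 0.
- by move=> x y t [Fx Gx] [Fy Gy] t01 z Xz; split; [exact: Fc|exact: Gc].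
- move=> x y t Xx Xy t01 [Fz Gz].
  have [Fx Fy] := Fe _ _ _ Xx Xy t01 Fz.
  by have [Gx Gy] := Ge _ _ _ Xx Xy t01 Gz.
Qed.

Lemma act_imageE w F : weyl_act w @` F = weyl_act w^-1%g @^-1` F.
Proof.
apply/seteqP; split=> [_ [l Fl <-]|l Fl] /=; first by rewrite weyl_actK.
by exists (weyl_act w^-1%g l) => //; rewrite weyl_actVK.
Qed.

Lemma is_face_act w F : is_face F -> is_face (weyl_act w @` F).
Proof.
move=> Ff; rewrite act_imageE; case: (Ff) => [FX [p Fp] Fc Fe]; split.
- by move=> x /= /FX/(tits_cone_act w); rewrite weyl_actVK.
- by exists (weyl_act w p); rewrite /= weyl_actK.
- move=> x y t /= Fx Fy t01 Xz; rewrite weyl_actD !weyl_actZ.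
  apply: Fc => //; rewrite -!weyl_actZ -weyl_actD.
  exact: tits_cone_act.
- move=> x y t Xx Xy t01 /=; rewrite weyl_actD !weyl_actZ => Fz.
  exact: Fe (tits_cone_act _ Xx) (tits_cone_act _ Xy) t01 Fz.
Qed.

Definition full_face : face := Face (asboolT tits_cone_is_face).

Definition faceI (F G : face) : face :=
  Face (asboolT (is_faceI (face_is_face F) (face_is_face G))).

Definition face_act w (F : face) : face :=
  Face (asboolT (is_face_act w (face_is_face F))).

Definition std_face_set (Theta : {set I}) : set (dual D) :=
  [set l | tits_cone l /\ forall i, i \in Theta -> (l (coroot D i) : R) = 0].

(* R(Theta); the default value [full_face] is not used when Theta is special,
   as [std_face_set Theta] is a face in that case. *)
Definition std_face (Theta : {set I}) : face :=
  insubd full_face (std_face_set Theta).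

End Faces.

Arguments std_face {R I A} D Theta.

Section FaceMonoid.
Variables (R : realType) (I : finType) (A : gcm I) (D : realization R A).

Definition fpair : choiceType := (weyl D * face D)%type.

Implicit Types p q r : fpair.

Definition fpair_mul p q : fpair :=
  ((p.1 * q.1)%g, faceI (face_act q.1^-1%g p.2) q.2).

Definition fpair_one : fpair := (1%g, full_face D).

Definition fpair_equiv p q : bool :=
  (p.2 == q.2) &&
  `[< forall l, (p.2 : set (dual D)) l -> weyl_act (p.1^-1 * q.1)%g l = l >].

Lemma fpair_equivP p q : reflect
  (p.2 = q.2 /\
   forall l, (p.2 : set (dual D)) l -> weyl_act p.1 l = weyl_act q.1 l)
  (fpair_equiv p q).
Proof.
apply: (iffP andP) => [[/eqP-> /asboolP pq]|[-> pq]]; split=> //.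
- by move=> l /pq {1}<-; rewrite weyl_actM weyl_actVK.
- by apply/asboolP => l /pq lE; rewrite weyl_actM -lE weyl_actK.
Qed.

Fact fpair_equiv_refl : reflexive fpair_equiv.
Proof. by move=> p; apply/fpair_equivP. Qed.

Fact fpair_equiv_sym : symmetric fpair_equiv.
Proof.
move=> p q; apply/fpair_equivP/fpair_equivP => -[-> e]; split=> // l /e.
all: by move->.
Qed.

Fact fpair_equiv_trans : transitive fpair_equiv.
Proof.
move=> q p r /fpair_equivP[pq epq] /fpair_equivP[qr eqr]; apply/fpair_equivP.
by split=> [|l pl]; [rewrite pq|rewrite epq ?eqr -?pq].
Qed.

Canonical fpair_equiv_rel :=
  EquivRel fpair_equiv fpair_equiv_refl fpair_equiv_sym fpair_equiv_trans.

Definition face_monoid := {eq_quot fpair_equiv_rel}.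

HB.instance Definition _ := Choice.on face_monoid.
HB.instance Definition _ := Quotient.on face_monoid.
HB.instance Definition _ := EqQuotient.on face_monoid.

Definition fmonoid_mul : face_monoid -> face_monoid -> face_monoid :=
  lift_op2 face_monoid fpair_mul.

Definition fmonoid_one : face_monoid := \pi_face_monoid fpair_one.

Lemma fpair_eqP p q :
  reflect (\pi_face_monoid p = \pi_face_monoid q) (fpair_equiv p q).
Proof. exact: (iffP (eqmodP fpair_equiv_rel p q)). Qed.

Lemma face_eq (F G : face D) : (F : set (dual D)) = G -> F = G.
Proof. exact: val_inj. Qed.

Lemma fpair_mul_compat p p' q q' : fpair_equiv p p' -> fpair_equiv q q' ->
  fpair_equiv (fpair_mul p q) (fpair_mul p' q').
Proof.
case: p p' q q' => [w F] [w' F'] [v G] [v' G'].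
move=> /fpair_equivP[/= <- e] /fpair_equivP[/= <- e']; apply/fpair_equivP => /=.
split=> [|l].
  apply: face_eq; rewrite /= !act_imageE !invgK.
  by apply/seteqP; split=> l /= [Fl Gl]; split=> //; move: Fl; rewrite e'.
move=> [[m Fm ml] Gl]; rewrite !weyl_actM e -?e' //.
by rewrite -ml weyl_actVK.
Qed.

Lemma pi_fmonoid_mul :
  {morph \pi_face_monoid : p q / fpair_mul p q >-> fmonoid_mul p q}.
Proof.
move=> p q; unlock fmonoid_mul; apply/fpair_eqP.
by apply: fpair_mul_compat; apply/fpair_eqP; rewrite reprK.
Qed.

Fact fmonoid_mulA : associative fmonoid_mul.
Proof.
elim/quotW => p; elim/quotW => q; elim/quotW => r.
rewrite -!pi_fmonoid_mul; congr (\pi_face_monoid _).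
rewrite /fpair_mul /= mulgA; congr pair; apply: face_eq => /=.
rewrite !act_imageE !invgK preimage_setI setIA; congr (_ `&` _ `&` _).
by apply: funext => l; rewrite /preimage /= weyl_actM.
Qed.

Fact fmonoid_mul1 : left_id fmonoid_one fmonoid_mul.
Proof.
elim/quotW => p; rewrite /fmonoid_one -pi_fmonoid_mul.
congr (\pi_face_monoid _); rewrite /fpair_mul mul1g /=.
case: p => w F /=; congr pair; apply: face_eq => /=; apply: setIidr.
rewrite act_imageE invgK => l Fl; apply: tits_cone_act.
by have [+ _ _ _] := face_is_face F; apply.
Qed.

Fact fmonoid_1mul : right_id fmonoid_one fmonoid_mul.
Proof.
elim/quotW => p; rewrite /fmonoid_one -pi_fmonoid_mul.
congr (\pi_face_monoid _); rewrite /fpair_mul mulg1 /=.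
case: p => w F /=; congr pair; apply: face_eq => /=.
rewrite act_imageE invgK.
have -> : weyl_act (1%g : weyl D) @^-1` F = F.
  by apply: funext => l; rewrite /preimage /= weyl_act1.
by apply: setIidl; have [] := face_is_face F.
Qed.

HB.instance Definition _ :=
  isMonoid.Build face_monoid fmonoid_mulA fmonoid_mul1 fmonoid_1mul.

Definition eps (F : face D) : face_monoid := \pi_face_monoid (1%g, F).

Definition of_weyl (w : weyl D) : face_monoid :=
  \pi_face_monoid (w, full_face D).

Definition fparabolic (J : {set I}) : set face_monoid :=
  [set u | exists (v w : weyl D) (Theta : {set I}),
     [/\ parabolic D J v, parabolic D J w, Theta \subset J, special R A Theta
       & u = (of_weyl v * eps (face_act w (std_face D Theta)))%g]].

End FaceMonoid.

Arguments fparabolic {R I A} D J.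

Section CoxeterComplex.
Variables (R : realType) (I : finType) (A : gcm I) (D : realization R A).

Definition lcoset (w : weyl D) (J : {set I}) : set (weyl D) :=
  [set (w * v)%g | v in parabolic D J].

Record coxeter_complex := CoxeterSimplex {
  simplex_set :> set (weyl D);
  simplex_setP : exists w J, simplex_set = lcoset w J }.

Definition simplex (w : weyl D) (J : {set I}) : coxeter_complex :=
  CoxeterSimplex (ex_intro _ w (ex_intro _ J erefl)).

Definition simplex_le (c d : coxeter_complex) : Prop :=
  (d : set (weyl D)) `<=` c.

Definition is_monoid_action (act : face_monoid D -> coxeter_complex ->
    coxeter_complex) : Prop :=
  (forall c, act 1%g c = c) /\
  (forall u v c, act (u * v)%g c = act u (act v c)).

Definition extends_weyl_action (act : face_monoid D -> coxeter_complex ->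
    coxeter_complex) : Prop :=
  forall v w J, act (of_weyl v) (simplex w J) = simplex (v * w)%g J.

Definition good_action (act : face_monoid D -> coxeter_complex ->
    coxeter_complex) : Prop :=
  [/\ is_monoid_action act, extends_weyl_action act,
      forall J, [set u | act u (simplex 1%g J) = simplex 1%g J]
                = fparabolic D J
    & forall u c d, simplex_le c d -> simplex_le (act u c) (act u d)].

Definition faithful_action (act : face_monoid D -> coxeter_complex ->
    coxeter_complex) : Prop :=
  forall u v, (forall c, act u c = act v c) -> u = v.

Record decomposition (Theta J : {set I}) (w a1 a2 x c1 c2 : weyl D) : Prop := {
  dec_eq : w = (a1 * a2 * x * c1 * c2)%g;
  dec_a1 : parabolic D (perp A Theta) a1;
  dec_a2 : parabolic D Theta a2;
  dec_xl : minreps_l D (Theta :|: perp A Theta) x;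
  dec_xr : minreps_r D (infpart R A J :|: perp A (infpart R A J)) x;
  dec_c1 : parabolic D (perp A (infpart R A J)) c1;
  dec_c1r : minreps_r D (finpart R A J) c1;
  dec_c2 : parabolic D J c2;
  dec_xc1l : minreps_l D (Theta :|: perp A Theta) (x * c1)%g;
  dec_xc1r : minreps_r D J (x * c1)%g }.

Definition Xi (Theta J : {set I}) (x : weyl D) : {set I} :=
  (Theta :|: infpart R A J :|: red x)%SET.

End CoxeterComplex.

(* Main.v *)
Require Import Defs.
From mathcomp Require Import all_boot all_order all_algebra.
From mathcomp Require Import boolp classical_sets reals.
From mathcomp Require Import ring lra zify.
(* finite sets are meant where the names clash with those of classical sets *)
From mathcomp Require Import fintype finset.

(** The idea is to let the face monoid move points of the Tits cone [X].

    The simplices of the Coxeter complex are the translates of the facets of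
    the dominant chamber, so that every simplex is the [cell] of a point [l] of
    [X], and two points have the same cell if and only if every real coroot has
    the same sign on them. Let [span_face l] be the smallest face containing
    [l]. The idempotent of a face [R] sends the facet of [l] to the facet of a
    point [m] that spans the face [S = R `&` span_face l] and lies on the same
    side as [l] of every reflection hyperplane that crosses [S]: this is
    [projects S l m]. A hyperplane that does not cross [S] has [S] on one side,
    which forces its sign on [m], so that the facet of [m] is unique. The action
    is multiplicative because a hyperplane crossing a face also crosses every
    larger face ([projects_trans]). It is order preserving because a reflection
    whose hyperplane crosses a face preserves that face ([projects_below]).
    Stabilizers and faithfulness are obtained by comparing the faces spanned by
    points and by their images.

    Existence of [m] ([projects_exists]) reduces, by translation, to a standard
    face [S] of type [Theta] and to a point [l] that is dominant on the indices
    orthogonal to [Theta], because only the coroots of the orthogonal subgroup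
    cross [S]. One takes [m] dominant, vanishing on [Theta] and on the indices
    orthogonal to [Theta] at which [l] vanishes; these form a diagram of finite
    type as [S] is contained in the face of [l], and therefore [m] spans [S].
    For the decomposition [a1 a2 x c1 c2] the intersection of the face of type
    [Theta] with the one of type [J^oo] moved by [x] is the standard face of
    type [Xi] ([face_intersection]); the same construction then gives the
    formula ([fm_act_formula]).

    This rests on four facts about the Weyl group and its Tits cone.
    - A root [w e_i] is positive if and only if [w] is shorter than [w s_i]
      ([len_pos]), from which follow the exchange condition, the fundamental
      domain and the convexity of [X].
    - On a connected diagram of non-finite type some positive combination of the
      coroots is antidominant ([not_finite_type]); therefore the standard sets
      of special type are faces ([std_is_face]).
    - On a diagram of finite type the invariant form is positive definite, so
      that its Weyl group is finite ([len_bounded]); therefore a dominant point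
      with zeros [J] spans the face of type [J^oo] ([span_face_dominant]).
    - Every face is a translate of a standard face ([face_classification]). *)

Set Implicit Arguments.
Unset Strict Implicit.
Unset Printing Implicit Defensive.

Import Order.TTheory GRing.Theory Num.Theory.
Local Open Scope ring_scope.

(** * Length function of the Weyl group *)

Section Length.
Variables (R : realType) (I : finType) (A : gcm I) (D : realization R A).
Implicit Types (v w x : weyl D) (i j : I) (s t : seq I).

Lemma word_nil : word D [::] = 1%g.
Proof. by rewrite /word big_nil. Qed.

Lemma word_cons i s : word D (i :: s) = (srefl D i * word D s)%g.
Proof. by rewrite /word big_cons. Qed.

Lemma word_cat s t : word D (s ++ t) = (word D s * word D t)%g.
Proof. by rewrite /word big_cat. Qed.

Lemma word_rcons s i : word D (rcons s i) = (word D s * srefl D i)%g.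
Proof. by rewrite -cats1 word_cat /word big_seq1. Qed.

Lemma sreflK i : (srefl D i * srefl D i)%g = 1%g.
Proof.
by apply: val_inj; rewrite /= comp_lfun1r; apply: srefl_endK.
Qed.

Lemma sreflV i : ((srefl D i)^-1)%g = srefl D i.
Proof. by apply: (mulgI (srefl D i)); rewrite mulgV sreflK. Qed.

Lemma mulg_sreflK w i : (w * srefl D i * srefl D i)%g = w.
Proof. by rewrite -mulgA sreflK mulg1. Qed.

Lemma mulg_sreflKl w i : (srefl D i * (srefl D i * w))%g = w.
Proof. by rewrite mulgA sreflK mul1g. Qed.

Lemma srefl_act i l :
  weyl_act (srefl D i) l = l - (l (coroot D i) : R) *: sroot D i.
Proof. by rewrite /weyl_act /= comp_lfun1r lfunE. Qed.

Lemma reduced_word w : exists s, w = word D s /\ size s = len w.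
Proof.
by rewrite /len; case: ex_minnP => n /asboolP[s [-> <-]] _; exists s.
Qed.

Lemma word_surj w : exists s, w = word D s.
Proof. by have [s [-> _]] := reduced_word w; exists s. Qed.

Lemma len_word s : (len (word D s) <= size s)%N.
Proof.
by rewrite {1}/len; case: ex_minnP => n _; apply; apply/asboolP; exists s.
Qed.

Lemma len1 : len (1%g : weyl D) = 0%N.
Proof. by apply/eqP; rewrite -leqn0 -word_nil (len_word [::]). Qed.

Lemma lenM v w : (len (v * w)%g <= len v + len w)%N.
Proof.
have [s [-> <-]] := reduced_word v; have [t [-> <-]] := reduced_word w.
by rewrite -word_cat -size_cat len_word.
Qed.

Lemma word_rev s : word D (rev s) = ((word D s)^-1)%g.
Proof.
elim: s => [|i s IHs]; first by rewrite word_nil invg1.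
by rewrite rev_cons word_rcons IHs word_cons invgM sreflV.
Qed.

Lemma lenV w : len (w^-1)%g = len w.
Proof.
have le x : (len (x^-1)%g <= len x)%N.
  have [s [-> <-]] := reduced_word x.
  by rewrite -word_rev -(size_rev s) len_word.
by apply/eqP; rewrite eqn_leq le -{1}(invgK w) le.
Qed.

Lemma len_srefl i : (len (srefl D i) <= 1)%N.
Proof.
by rewrite -(mulg1 (srefl D i)) -word_nil -word_cons (len_word [:: i]).
Qed.

Lemma len_mul_srefl w i : (len (w * srefl D i)%g <= (len w).+1)%N.
Proof. by rewrite -addn1 (leq_trans (lenM _ _)) // leq_add2l len_srefl. Qed.

Lemma len_last w : w <> 1%g ->
  exists v i, w = (v * srefl D i)%g /\ len w = (len v).+1.
Proof.
have [s [-> sz]] := reduced_word w.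
case: (lastP s) sz => [|t i] sz; first by rewrite word_nil.
move=> _; exists (word D t), i; rewrite word_rcons; split=> //.
apply/eqP; rewrite eqn_leq len_mul_srefl -word_rcons -sz size_rcons.
by rewrite ltnS len_word.
Qed.

Lemma weyl_ind (P : weyl D -> Prop) : P 1%g ->
  (forall w i, P w -> P (srefl D i * w)%g) -> forall w, P w.
Proof.
move=> P1 PS w; have [s ->] := word_surj w.
elim: s => [|i s IHs]; first by rewrite word_nil.
by rewrite word_cons; apply: PS.
Qed.

End Length.

(** * Rank two *)

Section Dihedral.
Variables (R : realType) (I : finType) (A : gcm I) (D : realization R A).

(** Letters are added on the left, so that the last letter is always [j] and
    the word acts on the simple root [i] by a recursion on its length. *)
Fixpoint altw (i j : I) (k : nat) : seq I :=
  if k is k'.+1 then (if odd k' then i else j) :: altw i j k' else [::].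

(** The image of the simple root [i] under that word is [m] times the root [i]
    plus [n] times the root [j], with [(m, n)] the value of [altc]; here [a]
    and [b] stand for the negatives of the two off-diagonal Cartan integers. *)
Fixpoint altc (a b : int) (k : nat) : int * int :=
  if k is k'.+1 then
    let: (m, n) := altc a b k' in
    if odd k' then (a * n - m, n) else (m, b * m - n)
  else (1, 0).

(** The order of the product of two distinct simple reflections, as a function
    of [p = a_ij a_ji]; it is meaningful for [p < 4] only. *)
Definition cox_order (p : int) : nat :=
  if p == 0 then 2 else if p == 1 then 3 else if p == 2 then 4 else 6.

Lemma size_altw i j k : size (altw i j k) = k.
Proof. by elim: k => //= k ->. Qed.

Lemma altw_drop i j m k : (m <= k)%N ->
  exists s, altw i j k = s ++ altw i j m /\ size s = (k - m)%N.
Proof.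
elim: k => [|k IHk]; first by rewrite leqn0 => /eqP->; exists [::].
rewrite leq_eqVlt => /predU1P[->|]; first by exists [::]; rewrite subnn.
rewrite ltnS => mk; have [s [/= -> sz]] := IHk mk.
by exists ((if odd k then i else j) :: s); rewrite /= sz subSn.
Qed.

(** When [a * b >= 4] each step leaves the coordinate just changed at least
    half as large as the other one times [a] or [b]; this keeps both
    nonnegative. *)
Lemma altc_ge0_affine (a b : int) k : 0 <= a -> 0 <= b -> 4 <= a * b ->
  0 <= (altc a b k).1 /\ 0 <= (altc a b k).2.
Proof.
move=> a0 b0 ab.
suff: [/\ 0 <= (altc a b k).1, 0 <= (altc a b k).2 &
  if odd k then b * (altc a b k).1 <= 2 * (altc a b k).2
  else a * (altc a b k).2 <= 2 * (altc a b k).1] by case.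
elim: k => [|k] /=; first by split=> //; rewrite ?mulr0.
case: (altc a b k) => m n /=; case: (odd k) => /= -[m0 n0 h]; split=> //; nia.
Qed.

(** The Cartan matrices of rank two and finite type. *)
Lemma small_prod (a b : int) : 0 <= a -> 0 <= b -> (a = 0 <-> b = 0) ->
  a * b < 4 -> [\/ (a = 0 /\ b = 0), (a = 1 /\ b = 1), (a = 1 /\ b = 2) |
   [\/ (a = 2 /\ b = 1), (a = 1 /\ b = 3) | (a = 3 /\ b = 1)]].
Proof.
case: a b => [a|a] // [b|b] // _ _ h.
case: a b h => [|[|[|[|a]]]] [|[|[|[|b]]]] //; try nia; move=> h _.
all: try by [constructor 1|constructor 2|constructor 3].
all: try by constructor 4; constructor 1.
all: try by constructor 4; constructor 2.
by constructor 4; constructor 3.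
Qed.

Lemma altc_ge0_finite (a b : int) k : 0 <= a -> 0 <= b -> (a = 0 <-> b = 0) ->
  a * b < 4 -> (k < cox_order (a * b))%N ->
  0 <= (altc a b k).1 /\ 0 <= (altc a b k).2.
Proof.
move=> a0 b0 z lt4.
case: (small_prod a0 b0 z lt4) => [|||[||]] [-> ->];
  rewrite /cox_order /=; by case: k => [|[|[|[|[|[|k]]]]]].
Qed.

(** The alternating word moves a weight [l] by [p] times the root [i] plus [q]
    times the root [j], with [(p, q)] the value of [altd] at the numbers [u =
    l(h_i)] and [v = l(h_j)]. *)
Fixpoint altd (a b u v : R) (k : nat) : R * R :=
  if k is k'.+1 then
    let: (p, q) := altd a b u v k' in
    if odd k' then (a * q - p - u, q) else (p, b * p - q - v)
  else (0, 0).

Lemma altw_act i j k (l : dual D) :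
  let c := altd (- (A i j)%:~R) (- (A j i)%:~R)
     (l (coroot D i)) (l (coroot D j)) k in
  weyl_act (word D (altw i j k)) l = l + c.1 *: sroot D i + c.2 *: sroot D j.
Proof.
elim: k => [|k] /=; first by rewrite word_nil weyl_act1 !scale0r !addr0.
case: (altd _ _ _ _ k) => p q /= IHk.
rewrite word_cons weyl_actM IHk srefl_act !add_lfunE !scale_lfunE.
rewrite /GRing.scale /= !sroot_coroot.
case: (odd k) => /=; rewrite gcm_diag.
  rewrite addrAC; congr (_ + _); rewrite -addrA; congr (_ + _).
  by rewrite -scalerBl; congr (_ *: _); ring.
by rewrite -addrA -scalerBl; congr (_ + _ *: _); ring.
Qed.

(** The group is defined by its linear action, so the braid relation is not
    given; it is a computation for each of the rank two matrices. *)
Lemma braid i j : i != j -> A i j * A j i < 4 ->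
  word D (altw i j (cox_order (A i j * A j i))) =
  word D (altw j i (cox_order (A i j * A j i))).
Proof.
move=> nij lt4; apply: val_inj; apply/lfunP => l.
have := altw_act i j (cox_order (A i j * A j i)) l.
have := altw_act j i (cox_order (A i j * A j i)) l.
rewrite /weyl_act /= => -> ->; rewrite -!addrA; congr (_ + _).
rewrite [RHS]addrC.
have a0 : 0 <= - A i j by rewrite oppr_ge0 gcm_offdiag.
have b0 : 0 <= - A j i by rewrite oppr_ge0 gcm_offdiag // eq_sym.
have z : - A i j = 0 <-> - A j i = 0.
  by split=> /eqP; rewrite oppr_eq0 => /eqP/gcm_zero->; rewrite oppr0.
have h (p q p' q' : R) : p = p' -> q = q' ->
  p *: sroot D i + q *: sroot D j = p' *: sroot D i + q' *: sroot D j.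
  by move=> -> ->.
have lt4' : - A i j * - A j i < 4 by rewrite mulrNN.
by case: (small_prod a0 b0 z lt4') => [|||[||]] [/eqP + /eqP];
  rewrite !eqr_oppLR => /eqP-> /eqP->; rewrite /cox_order /=; apply: h; ring.
Qed.

End Dihedral.

(** * Positivity of roots *)

Section FreeFamily.
Variables (R : realType) (I : finType) (V : vectType R) (e : I -> V).
Hypothesis eF : free [seq e i | i : I].

Lemma comb_eq0 (c : I -> R) : \sum_i c i *: e i = 0 -> forall i, c i = 0.
Proof.
move=> c0 i.
have sz : size [seq e i | i : I] = #|I| by rewrite size_map -cardE.
have /freeP := eF : free (Tuple (introT eqP sz)).
move=> /(_ (fun k => c (enum_val k))) h.
rewrite -(enum_rankK i); apply: h.
rewrite -[RHS]c0 (reindex _ (onW_bij _ (@enum_val_bij I))) /=.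
apply: eq_bigr => k _; congr (_ *: _).
by rewrite (nth_map i) -?cardE // -enum_val_nth.
Qed.

Lemma comb_inj (c d : I -> R) :
  \sum_i c i *: e i = \sum_i d i *: e i -> forall i, c i = d i.
Proof.
move=> cd i; apply/eqP; rewrite -subr_eq0; apply/eqP.
apply: (@comb_eq0 (fun i => c i - d i)).
under eq_bigr do rewrite scalerBl.
by rewrite sumrB cd subrr.
Qed.

Definition natcomb (x : V) := exists n : I -> nat, x = \sum_i (n i)%:R *: e i.

Lemma natcombD x y : natcomb x -> natcomb y -> natcomb (x + y).
Proof.
move=> [m ->] [n ->]; exists (fun i => m i + n i)%N.
by rewrite -big_split; apply: eq_bigr => i _; rewrite /= natrD scalerDl.
Qed.

Lemma natcombZ (k : nat) x : natcomb x -> natcomb (k%:R *: x).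
Proof.
move=> [m ->]; exists (fun i => k * m i)%N.
by rewrite scaler_sumr; apply: eq_bigr => i _; rewrite /= scalerA natrM.
Qed.

Lemma natcomb0 : natcomb 0.
Proof. by exists (fun=> 0%N); rewrite big1 // => i _; rewrite scale0r. Qed.

Lemma comb_delta i : e i = \sum_j (j == i)%:R *: e j.
Proof.
rewrite (bigD1 i) //= eqxx scale1r big1 ?addr0 // => j /negbTE ->.
by rewrite scale0r.
Qed.

Lemma natcomb_base i : natcomb (e i).
Proof. by exists (fun j => (j == i) : nat); apply: comb_delta. Qed.

Lemma natcomb_anti x : natcomb x -> natcomb (- x) -> x = 0.
Proof.
move=> [m xm] [n xn].
have s0 : \sum_i ((m i)%:R + (n i)%:R) *: e i = 0 :> V.
  under eq_bigr do rewrite scalerDl.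
  by rewrite big_split /= -xm -xn subrr.
rewrite xm big1 // => i _.
have /eqP := comb_eq0 s0 i; rewrite paddr_eq0 ?ler0n // => /andP[/eqP-> _].
by rewrite scale0r.
Qed.

Lemma base_neq0 i : e i != 0.
Proof.
apply/eqP => ei0; have := @comb_eq0 (fun j => (j == i)%:R).
rewrite -comb_delta => /(_ ei0 i) /eqP; rewrite eqxx oner_eq0 //.
Qed.

End FreeFamily.

Section RootRep.
Variables (R : realType) (I : finType) (A : gcm I) (D : realization R A).

(** Weights with the simple roots and coweights with the simple coroots play
    symmetric roles. What is common to both is collected here, so that
    positivity is proved once; the Cartan matrix of the second one is the
    transpose of that of the first. *)
Record rootrep := RootRep {
  rsp : vectType R;
  re : I -> rsp;
  rf : I -> rsp -> R;
  rB : I -> I -> int;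
  ract : weyl D -> rsp -> rsp;
  re_free : free [seq re i | i : I];
  rf_e : forall i j, rf i (re j) = (rB i j)%:~R;
  rB_cases : (forall i j, rB i j = A i j) \/ (forall i j, rB i j = A j i);
  rf_lin : forall i a x y, rf i (a *: x + y) = a * rf i x + rf i y;
  ract_lin : forall w, linear (ract w);
  ract1 : forall x, ract 1%g x = x;
  ractM : forall v w x, ract (v * w)%g x = ract v (ract w x);
  ract_srefl : forall i x, ract (srefl D i) x = x - rf i x *: re i }.

Variable (P : rootrep).
Notation e := (re P).
Notation f := (@rf P).
Notation act := (@ract P).
Notation B := (rB P).
Implicit Types (v w : weyl D) (i j : I).

Lemma ract0 w : act w 0 = 0.
Proof.
by have := @ract_lin P w (-1) 0 0; rewrite scaler0 addr0 scaleN1r addNr.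
Qed.
Lemma ractD w x y : act w (x + y) = act w x + act w y.
Proof. by rewrite -{1}(scale1r x) ract_lin scale1r. Qed.
Lemma ractZ w a x : act w (a *: x) = a *: act w x.
Proof. by rewrite -{1}(addr0 (a *: x)) ract_lin ract0 addr0. Qed.
Lemma ractN w x : act w (- x) = - act w x.
Proof. by rewrite -!scaleN1r ractZ. Qed.
Lemma ract_sum w (J : finType) (F : J -> rsp P) :
  act w (\sum_j F j) = \sum_j act w (F j).
Proof. exact: (big_morph _ (ractD w) (ract0 w)). Qed.

Lemma rf0 i : f i 0 = 0.
Proof. by have := @rf_lin P i (-1) 0 0; rewrite scaler0 addr0; lra. Qed.
Lemma rfD i x y : f i (x + y) = f i x + f i y.
Proof. by rewrite -{1}(scale1r x) rf_lin mul1r. Qed.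
Lemma rfZ i a x : f i (a *: x) = a * f i x.
Proof. by rewrite -{1}(addr0 (a *: x)) rf_lin rf0 addr0. Qed.

Lemma rB_diag i : B i i = 2.
Proof. by case: (rB_cases P) => ->; rewrite gcm_diag. Qed.
Lemma rB_le0 i j : i != j -> B i j <= 0.
Proof. by case: (rB_cases P) => -> nij; rewrite gcm_offdiag // eq_sym. Qed.
Lemma rB_eq0 i j : B i j = 0 -> B j i = 0.
Proof. by case: (rB_cases P) => E; rewrite !E => /gcm_zero. Qed.
Lemma rB_prod i j : B i j * B j i = A i j * A j i.
Proof. by case: (rB_cases P) => E; rewrite !E // mulrC. Qed.

Lemma ractK w : cancel (act w) (act (w^-1)%g).
Proof. by move=> x; rewrite -ractM mulVg ract1. Qed.

Lemma ract_srefl_e i : act (srefl D i) (e i) = - e i.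
Proof.
rewrite ract_srefl rf_e rB_diag -{1}(scale1r (e i)) -scalerBl.
by rewrite -scaleN1r; congr (_ *: _); rewrite /intmul /=; lra.
Qed.

Lemma ract_mul_srefl w i : act (w * srefl D i)%g (e i) = - act w (e i).
Proof. by rewrite ractM ract_srefl_e ractN. Qed.

Lemma altw_ract i j k : i != j ->
  let c := altc (- B i j) (- B j i) k in
  act (word D (altw i j k)) (e i) = c.1%:~R *: e i + c.2%:~R *: e j.
Proof.
move=> nij; elim: k => [|k] /=.
  by rewrite word_nil ract1 scale1r scale0r addr0.
case: (altc _ _ _) => m n /= IHk.
rewrite word_cons ractM IHk ract_srefl.
rewrite rfD !rfZ !rf_e; case: (odd k) => /=; rewrite rB_diag.
  rewrite addrAC -scalerBl; congr (_ *: _ + _).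
  by rewrite rmorphB rmorphM rmorphN /=; ring.
rewrite -addrA -scalerBl; congr (_ + _ *: _).
by rewrite rmorphB rmorphM rmorphN /=; ring.
Qed.

Notation pos w i := (natcomb e (act w (e i))).

(** The argument of Tits. Let [j] be the last letter of a reduced word of [w],
    and strip from [w] its longest alternating suffix in [i] and [j]. The
    remaining factor [v] is shorter than [w] and not longer than its products
    with both reflections, so that it keeps both simple roots positive by
    induction, and it remains to see that the suffix maps the root [i] to a
    nonnegative combination of the roots [i] and [j]. This can fail only in
    finite type and for a suffix at least as long as the longest element; the
    braid relation then shows that multiplication by [s_i] shortens [w]. *)
Lemma len_pos w i : (len w <= len (w * srefl D i)%g)%N -> pos w i.
Proof.
have [n] := ubnP (len w); elim: n w i => // n IHn w i.
rewrite ltnS => lew leni.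
have [->|w1] := pselect (w = 1%g); first by rewrite ract1; exact: natcomb_base.
have [v0 [j [wE lenw]]] := len_last w1.
have nij : i != j.
  apply/eqP => ij; move: leni; rewrite {2}wE ij mulg_sreflK lenw.
  by rewrite ltnn.
(* the length k of the longest alternating suffix *)
pose Q k := `[< exists v, w = (v * word D (altw i j k))%g
                          /\ len w = (len v + k)%N >].
have exQ : exists k, Q k.
  by exists 1%N; apply/asboolP; exists v0; rewrite /word big_seq1 addn1.
have leQ k : Q k -> (k <= len w)%N.
  by move=> /asboolP[v [_ ->]]; rewrite leq_addl.
case: (ex_maxnP exQ leQ) => k /asboolP[v [wv lenv]] kmax.
have k0 : (0 < k)%N.
  by apply: kmax; apply/asboolP; exists v0; rewrite /word big_seq1 addn1.
have ltv : (len v < n)%N by lia.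
have nonext : (len v <= len (v * srefl D (if odd k then i else j))%g)%N.
  rewrite leqNgt; apply/negP => lt.
  have : Q k.+1.
    apply/asboolP; exists (v * srefl D (if odd k then i else j))%g; split.
      by rewrite /= word_cons mulgA mulg_sreflK.
    have := len_mul_srefl (v * srefl D (if odd k then i else j))%g
              (if odd k then i else j).
    by rewrite mulg_sreflK; lia.
  by move=> /kmax; rewrite ltnn.
have nocancel : (len v <= len (v * srefl D (if odd k then j else i))%g)%N.
  rewrite leqNgt; apply/negP => lt.
  have := lenM (v * srefl D (if odd k then j else i))%g
            (word D (altw i j k.-1)).
  have -> : (v * srefl D (if odd k then j else i) * word D (altw i j k.-1))%g
            = w.
    rewrite wv; case: (k) k0 => //= k' _; rewrite word_cons mulgA.
    by case: (odd k').
  have := len_word D (altw i j k.-1); rewrite size_altw; lia.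
have [vi vj] : pos v i /\ pos v j.
  by move: nonext nocancel; case: (odd k) => h1 h2; split; apply: IHn.
suff [c1 c2] : 0 <= (altc (- B i j) (- B j i) k).1 /\
               0 <= (altc (- B i j) (- B j i) k).2.
  rewrite wv ractM altw_ract // ractD ractZ ractZ /=.
  move: c1 c2; case: (altc _ _ _) => /= [[m|m] [p|p]] // _ _.
  by apply: natcombD; apply: natcombZ.
have a0 : 0 <= - B i j by rewrite oppr_ge0 rB_le0.
have b0 : 0 <= - B j i by rewrite oppr_ge0 rB_le0 // eq_sym.
have [ge4|lt4] := leP 4 (- B i j * - B j i); first exact: altc_ge0_affine.
have z : - B i j = 0 <-> - B j i = 0.
  by split=> /eqP; rewrite oppr_eq0 => /eqP/rB_eq0->; rewrite oppr0.
have [ltm|lem] := ltnP k (cox_order (- B i j * - B j i)).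
  exact: altc_ge0_finite.
move: lem lt4; rewrite mulrNN rB_prod => lem lt4; exfalso.
have [s [sE szs]] := altw_drop i j lem.
have m0 : (0 < cox_order (A i j * A j i))%N.
  by rewrite /cox_order; case: ifP => // _; case: ifP => // _; case: ifP.
have [t [tE szt]] := altw_drop j i m0.
have := lenM (v * word D s)%g (word D t).
have -> : (v * word D s * word D t)%g = (w * srefl D i)%g.
  rewrite wv sE word_cat braid // tE word_cat /= word_cons word_nil mulg1.
  by rewrite !mulgA mulg_sreflK.
have := lenM v (word D s); have := len_word D s; have := len_word D t; lia.
Qed.

Lemma act_e_neq0 w i : act w (e i) != 0.
Proof.
apply/eqP => w0; have := ractK w (e i); rewrite w0 ract0 => /esym/eqP.
by rewrite (negbTE (base_neq0 (re_free P) i)).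
Qed.

Lemma neg_len w i : (len (w * srefl D i)%g <= len w)%N ->
  natcomb e (- act w (e i)).
Proof.
move=> le; rewrite -ract_mul_srefl; apply: len_pos.
by rewrite mulg_sreflK.
Qed.

Lemma pos_neg w i : pos w i -> natcomb e (- act w (e i)) -> False.
Proof.
by move=> p n; have /eqP := natcomb_anti (re_free P) p n; apply/negP/act_e_neq0.
Qed.

Lemma posP w i : pos w i <-> (len w < len (w * srefl D i)%g)%N.
Proof.
split=> [p|lt]; last by apply: len_pos; rewrite ltnW.
by rewrite ltnNge; apply/negP => /neg_len; apply: pos_neg.
Qed.

Lemma posN w i : ~ pos w i -> natcomb e (- act w (e i)).
Proof.
move=> n; apply: neg_len; rewrite leqNgt; apply/negP => lt.
by apply: n; apply/posP.
Qed.

Lemma act_intcomb w i :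
  exists c : I -> int, act w (e i) = \sum_j (c j)%:~R *: e j.
Proof.
have [[n ->]|/posN[n nE]] := pselect (pos w i).
  by exists (fun j => n j : int).
exists (fun j => - (n j : int)); rewrite -[LHS]opprK nE -sumrN.
by apply: eq_bigr => j _; rewrite rmorphN scaleNr.
Qed.

(** A simple reflection changes one coordinate only, so a positive root that it
    makes negative is a multiple of the simple root. The factor is 1, because
    the simple root has integral coordinates on any basis of roots [w e_j]. *)
Lemma pos_cross w i k :
  pos w i -> ~ pos (srefl D k * w)%g i -> act w (e i) = e k.
Proof.
move=> [n nE] /posN [m]; rewrite ractM ract_srefl => mE.
set c := f k (act w (e i)) in mE.
have E : \sum_j (m j + n j)%:R *: e j = c *: e k.
  under eq_bigr => j _ do rewrite natrD scalerDl.
  by rewrite big_split /= -mE -nE opprB subrK.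
have n0 j : j != k -> n j = 0%N.
  move=> njk; have : c *: e k = \sum_j (c * (j == k)%:R) *: e j.
    rewrite {1}(comb_delta e k) scaler_sumr.
    by apply: eq_bigr => l _; rewrite scalerA.
  rewrite -E => /(comb_inj (re_free P)) /(_ j)/eqP.
  by rewrite (negbTE njk) mulr0 pnatr_eq0 addn_eq0 => /andP[_ /eqP].
have wE : act w (e i) = (n k)%:R *: e k.
  rewrite nE (bigD1 k) //= big1 ?addr0 // => j njk.
  by rewrite n0 ?scale0r.
have [d dE] := act_intcomb (w^-1)%g k.
have : e i = (n k)%:R *: act (w^-1)%g (e k).
  by rewrite -{1}(ractK w (e i)) wE ractZ.
rewrite dE scaler_sumr {1}(comb_delta e i).
under [RHS]eq_bigr => j _ do rewrite scalerA.
move=> /(comb_inj (re_free P)) /(_ i); rewrite eqxx => h.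
have h' : (n k : int) * d i = 1.
  by apply/eqP; rewrite -(eqr_int R) rmorphM /= -pmulrn -h.
have nk1 : n k = 1%N.
  case: (d i) h' => p.
    by move=> /eqP; rewrite -PoszM eqz_nat muln_eq1 => /andP[/eqP].
  by rewrite NegzE mulrN -PoszM; lia.
by rewrite wE nk1 scale1r.
Qed.

End RootRep.

(** * The action on coroots *)

Section Pairing.
Variables (R : realType) (I : finType) (A : gcm I) (D : realization R A).
Implicit Types (v w : weyl D) (i j : I) (l m : dual D) (h : cartan D).

Definition pair l h : R := l h.

Lemma pairDl l m h : pair (l + m) h = pair l h + pair m h.
Proof. by rewrite /pair add_lfunE. Qed.
Lemma pairZl a l h : pair (a *: l) h = a * pair l h.
Proof. by rewrite /pair scale_lfunE. Qed.
Lemma pair0l h : pair 0 h = 0.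
Proof. by rewrite /pair zero_lfunE. Qed.
Lemma pairNl l h : pair (- l) h = - pair l h.
Proof. by rewrite /pair opp_lfunE. Qed.
Lemma pairDr l h h' : pair l (h + h') = pair l h + pair l h'.
Proof. by rewrite /pair linearD. Qed.
Lemma pairZr a l h : pair l (a *: h) = a * pair l h.
Proof. by rewrite /pair linearZ. Qed.
Lemma pairNr l h : pair l (- h) = - pair l h.
Proof. by rewrite /pair linearN. Qed.
Lemma pair_sumr l (J : finType) (P : pred J) (F : J -> cartan D) :
  pair l (\sum_(j | P j) F j) = \sum_(j | P j) pair l (F j).
Proof. by rewrite /pair linear_sum. Qed.
Lemma pair_suml (J : finType) (P : pred J) (F : J -> dual D) h :
  pair (\sum_(j | P j) F j) h = \sum_(j | P j) pair (F j) h.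
Proof. by rewrite /pair sum_lfunE. Qed.

Lemma pair_root i j : pair (sroot D j) (coroot D i) = (A i j)%:~R.
Proof. exact: sroot_coroot. Qed.

Lemma pair_sep h h' : (forall l, pair l h = pair l h') -> h = h'.
Proof.
move=> E; apply/eqP; rewrite -subr_eq0; apply/negPn/negP => n0.
have [f fE] := linear_of_free [:: h - h'] [:: (1 : R^o)].
have := fE; rewrite seq1_free => /(_ n0 erefl) [] f1.
have := E (linfun f); rewrite -[h](subrK h') pairDr.
rewrite {1}/pair lfunE /= f1 => /eqP.
by rewrite -subr_eq0 addrK oner_eq0.
Qed.

(** This gives the fundamental weights, which read off the coordinates of a
    combination of coroots, and points on every facet of the dominant chamber.
    *)
Lemma weight_exists (c : I -> R) :
  exists l : dual D, forall i, pair l (coroot D i) = c i.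
Proof.
have [f /(_ (@coroot_free R I A D))] :=
  linear_of_free [seq coroot D i | i : I] [seq (c i : R^o) | i : I].
rewrite !size_map => /(_ erefl); rewrite -map_comp => /eq_in_map fE.
exists (linfun f) => i; rewrite /pair lfunE /=.
by apply: fE; rewrite mem_enum.
Qed.

Lemma pair_srefl i l h :
  pair (weyl_act (srefl D i) l) h =
  pair l (h - pair (sroot D i) h *: coroot D i).
Proof.
rewrite srefl_act pairDl pairNl pairZl pairDr pairNr pairZr.
by congr (_ - _); rewrite mulrC.
Qed.

Lemma hact_subproof w h :
  exists h', forall l, pair l h' = pair (weyl_act (w^-1)%g l) h.
Proof.
elim/weyl_ind: w => [|w i [h' IHw]].
  by exists h => l; rewrite invg1 weyl_act1.
exists (h' - pair (sroot D i) h' *: coroot D i) => l.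
by rewrite invgM sreflV weyl_actM -IHw pair_srefl.
Qed.

(** The action on coweights that makes the pairing invariant. *)
Definition hact w h : cartan D := sval (cid (hact_subproof w h)).

Lemma pair_hact w l h : pair l (hact w h) = pair (weyl_act (w^-1)%g l) h.
Proof. by rewrite /hact; case: cid. Qed.

Lemma pair_hactV w l h : pair (weyl_act w l) h = pair l (hact (w^-1)%g h).
Proof. by rewrite pair_hact invgK. Qed.

Lemma hact_lin w : linear (hact w).
Proof.
move=> a x y; apply: pair_sep => l.
by rewrite pair_hact !pairDr !pairZr !pair_hact.
Qed.

Lemma hact1 h : hact 1%g h = h.
Proof. by apply: pair_sep => l; rewrite pair_hact invg1 weyl_act1. Qed.

Lemma hactM v w h : hact (v * w)%g h = hact v (hact w h).
Proof. by apply: pair_sep => l; rewrite !pair_hact invgM weyl_actM. Qed.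

Lemma hact_srefl i h :
  hact (srefl D i) h = h - pair (sroot D i) h *: coroot D i.
Proof. by apply: pair_sep => l; rewrite pair_hact sreflV pair_srefl. Qed.

Lemma root_rf_lin i a l m :
  pair (a *: l + m) (coroot D i) =
  a * pair l (coroot D i) + pair m (coroot D i).
Proof. by rewrite pairDl pairZl. Qed.

Lemma coroot_rf_lin i a h h' :
  pair (sroot D i) (a *: h + h') = a * pair (sroot D i) h + pair (sroot D i) h'.
Proof. by rewrite pairDr pairZr. Qed.

Lemma weyl_act_lin w : linear (weyl_act w).
Proof. by move=> a x y; rewrite weyl_actD weyl_actZ. Qed.

Definition root_rep : rootrep D :=
  @RootRep R I A D (dual D) (@sroot R I A D) (fun i l => pair l (coroot D i))
    A (@weyl_act R I A D) (@sroot_free R I A D)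
    pair_root (or_introl (fun _ _ => erefl)) root_rf_lin weyl_act_lin
    (@weyl_act1 R I A D) (@weyl_actM R I A D) (@srefl_act R I A D).

Definition coroot_rep : rootrep D :=
  @RootRep R I A D (cartan D) (@coroot R I A D) (fun i h => pair (sroot D i) h)
    (fun i j => A j i) hact (@coroot_free R I A D)
    (fun i j => pair_root j i) (or_intror (fun _ _ => erefl)) coroot_rf_lin
    hact_lin hact1 hactM hact_srefl.

End Pairing.

(** * Exchange condition and parabolic subgroups *)

Section Roots.
Variables (R : realType) (I : finType) (A : gcm I) (D : realization R A).
Implicit Types (v w : weyl D) (i j k : I) (l m : dual D) (h : cartan D).
Implicit Types (J K : {set I}).

Notation cor := (coroot D).
Notation s_ := (srefl D).

Definition hpos h := natcomb cor h.

Lemma hact0 w : hact w 0 = 0. Proof. exact: (@ract0 _ _ _ _ (coroot_rep D)).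
  Qed.
Lemma hactD w x y : hact w (x + y) = hact w x + hact w y.
Proof. exact: (@ractD _ _ _ _ (coroot_rep D)). Qed.
Lemma hactZ w a x : hact w (a *: x) = a *: hact w x.
Proof. exact: (@ractZ _ _ _ _ (coroot_rep D)). Qed.
Lemma hactN w x : hact w (- x) = - hact w x.
Proof. exact: (@ractN _ _ _ _ (coroot_rep D)). Qed.
Lemma hact_sum w (S : finType) (F : S -> cartan D) :
  hact w (\sum_j F j) = \sum_j hact w (F j).
Proof. exact: (@ract_sum _ _ _ _ (coroot_rep D)). Qed.
Lemma hactK w : cancel (hact w) (hact (w^-1)%g).
Proof. exact: (@ractK _ _ _ _ (coroot_rep D)). Qed.

Lemma pair_act w l h : pair (weyl_act w l) (hact w h) = pair l h.
Proof. by rewrite pair_hactV hactK. Qed.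

Lemma hact_srefl_cor i : hact (s_ i) (cor i) = - cor i.
Proof. exact: (@ract_srefl_e _ _ _ _ (coroot_rep D)). Qed.

Lemma hact_mul_srefl w i : hact (w * s_ i)%g (cor i) = - hact w (cor i).
Proof. by rewrite hactM hact_srefl_cor hactN. Qed.

Lemma hposP w i : hpos (hact w (cor i)) <-> (len w < len (w * s_ i)%g)%N.
Proof. exact: (@posP _ _ _ _ (coroot_rep D)). Qed.
Lemma hposN w i : ~ hpos (hact w (cor i)) -> hpos (- hact w (cor i)).
Proof. exact: (@posN _ _ _ _ (coroot_rep D)). Qed.
Lemma hpos_anti w i : hpos (hact w (cor i)) -> hpos (- hact w (cor i)) -> False.
Proof. exact: (@pos_neg _ _ _ _ (coroot_rep D)). Qed.
Lemma hlen_pos w i : (len w <= len (w * s_ i)%g)%N -> hpos (hact w (cor i)).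
Proof. exact: (@len_pos _ _ _ _ (coroot_rep D)). Qed.

(** Both sides say that [w] is shorter than [w s_i]. *)
Lemma root_posP w i :
  natcomb (@sroot _ _ _ D) (weyl_act w (sroot D i)) <-> hpos (hact w (cor i)).
Proof. by rewrite hposP; exact: (@posP _ _ _ _ (root_rep D)). Qed.

Lemma hpos_cross w i k : hpos (hact w (cor i)) ->
  ~ hpos (hact (s_ k * w)%g (cor i)) -> hact w (cor i) = cor k.
Proof. exact: (@pos_cross _ _ _ _ (coroot_rep D)). Qed.

Lemma root_cross w i k : hpos (hact w (cor i)) ->
  ~ hpos (hact (s_ k * w)%g (cor i)) -> weyl_act w (sroot D i) = sroot D k.
Proof.
by rewrite -!root_posP; exact: (@pos_cross _ _ _ _ (root_rep D)).
Qed.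

Lemma hpos_cor i : hpos (cor i). Proof. exact: natcomb_base. Qed.

Lemma hpos_corN i : ~ hpos (- cor i).
Proof. by have := @hpos_anti 1%g i; rewrite hact1 => /(_ (hpos_cor i)). Qed.

(** Either equality makes [w] increase and [s_k w] decrease under right
    multiplication by [s_i], and the other one follows since a simple
    reflection makes a single positive root, or coroot, negative. *)
Lemma root_corP w i k :
  weyl_act w (sroot D i) = sroot D k <-> hact w (cor i) = cor k.
Proof.
have N : ~ natcomb (@sroot _ _ _ D) (- sroot D k).
  have := @pos_neg _ _ _ _ (root_rep D) 1%g k; rewrite /= weyl_act1; apply.
  exact: natcomb_base.
split=> E.
  apply: hpos_cross; first by rewrite -root_posP E; exact: natcomb_base.
  rewrite -root_posP weyl_actM E.
  have -> // : weyl_act (s_ k) (sroot D k) = - sroot D k.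
  exact: (@ract_srefl_e _ _ _ _ (root_rep D)).
apply: root_cross; first by rewrite E; exact: hpos_cor.
by rewrite hactM E hact_srefl_cor; apply: hpos_corN.
Qed.

Lemma srefl_conj w i k :
  hact w (cor i) = cor k -> (w * s_ i)%g = (s_ k * w)%g.
Proof.
move=> E; have E' := (root_corP w i k).2 E.
apply: val_inj; apply/lfunP => l.
suff : weyl_act (w * s_ i)%g l = weyl_act (s_ k * w)%g l by [].
have e : l (cor i) = (weyl_act w l) (cor k) by rewrite -E; apply/esym/pair_act.
by rewrite !weyl_actM !srefl_act weyl_actD -!scaleN1r !weyl_actZ E' e.
Qed.

(** Reading the word from the right, the coroot [i] turns negative at some
    letter, where it has become the simple coroot of that letter; this letter
    can be deleted. *)
Lemma exchange s i : ~ hpos (hact (word D s) (cor i)) ->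
  exists t, [/\ (word D s * s_ i)%g = word D t, size s = (size t).+1 &
                {subset t <= s}].
Proof.
elim: s => [|k s IHs]; first by rewrite word_nil hact1 => /(_ (hpos_cor i)).
rewrite word_cons => N.
have [p|/IHs[t [tE tsz ts]]] := pselect (hpos (hact (word D s) (cor i))).
  have E := hpos_cross p N.
  exists s; split=> //; last by move=> j js; rewrite inE js orbT.
  by rewrite -mulgA (srefl_conj E) mulg_sreflKl.
exists (k :: t); split; rewrite /= ?tsz //.
  by rewrite word_cons -tE mulgA.
by move=> j; rewrite !inE => /orP[->//|/ts->]; rewrite orbT.
Qed.

Notation WP := (parabolic D).

Lemma par1 J : WP J 1%g. Proof. by exists [::] => //; rewrite word_nil. Qed.

Lemma parM J v w : WP J v -> WP J w -> WP J (v * w)%g.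
Proof.
move=> [s sJ ->] [t tJ ->]; exists (s ++ t); last by rewrite word_cat.
by rewrite all_cat sJ.
Qed.

Lemma parV J w : WP J w -> WP J (w^-1)%g.
Proof. by move=> [s sJ ->]; exists (rev s); rewrite ?all_rev ?word_rev. Qed.

Lemma par_srefl J i : i \in J -> WP J (s_ i).
Proof.
by move=> iJ; exists [:: i]; rewrite /= ?iJ // word_cons word_nil mulg1.
Qed.

Lemma parS J K w : J \subset K -> WP J w -> WP K w.
Proof.
move=> /subsetP JK [s /allP sJ ->]; exists s => //.
by apply/allP => i /sJ /JK.
Qed.

Lemma par_ind J (Q : weyl D -> Prop) : Q 1%g ->
  (forall w i, WP J w -> i \in J -> Q w -> Q (s_ i * w)%g) ->
  forall w, WP J w -> Q w.
Proof.
move=> Q1 QS w [s sJ ->]; elim: s sJ => [_|i s IHs /= /andP[iJ sJ]].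
  by rewrite word_nil.
by rewrite word_cons; apply: QS; [exists s|exact: iJ|exact: IHs].
Qed.

(** For a shortest word in letters of [J], an ascent at the last letter would
    allow the exchange condition to shorten the word. *)
Lemma par_descent J w : WP J w -> w <> 1%g ->
  exists2 i, i \in J & ~ hpos (hact w (cor i)).
Proof.
move=> [s]; have [n] := ubnP (size s); elim: n s w => // n IHn s w.
case/lastP: s => [|s i]; first by rewrite word_nil => _ _ ->.
rewrite size_rcons ltnS => szs; rewrite all_rcons => /andP[iJ sJ] wE w1.
have [p|] := pselect (hpos (hact w (cor i))); last by exists i.
have : ~ hpos (hact (word D s) (cor i)).
  move=> /hpos_anti; apply; rewrite -hact_mul_srefl -word_rcons -wE //.
move=> /exchange [t [tE tsz ts]].
apply: (IHn t w) => //; first by lia.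
  by apply/allP => j /ts /(allP sJ).
by rewrite wE word_rcons.
Qed.

(** Reduced expressions of elements of a parabolic subgroup may be built inside
    the subgroup, one descent at a time. *)
Lemma par_len_ind J (Q : weyl D -> Prop) : Q 1%g ->
  (forall w i, WP J w -> i \in J -> hpos (hact w (cor i)) ->
     Q w -> Q (w * s_ i)%g) ->
  forall w, WP J w -> Q w.
Proof.
move=> Q1 QS w; have [n] := ubnP (len w); elim: n w => // n IHn w.
rewrite ltnS => lenw wJ; have [->//|w1] := pselect (w = 1%g).
have [i iJ N] := par_descent wJ w1.
rewrite -(mulg_sreflK w i).
have p : hpos (hact (w * s_ i)%g (cor i)).
  by rewrite hact_mul_srefl; apply: hposN.
apply: QS => //; first by apply: parM => //; exact: par_srefl.
apply: IHn; last by apply: parM => //; exact: par_srefl.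
by move/hposP: p; rewrite mulg_sreflK; lia.
Qed.

Definition supp_in J h := exists c : I -> R,
  (forall i, i \notin J -> c i = 0) /\ h = \sum_i c i *: cor i.

Lemma supp_inD J x y : supp_in J x -> supp_in J y -> supp_in J (x + y).
Proof.
move=> [c [c0 ->]] [d [d0 ->]]; exists (fun i => c i + d i); split.
  by move=> i iJ; rewrite c0 ?d0 ?addr0.
by rewrite -big_split; apply: eq_bigr => i _; rewrite /= scalerDl.
Qed.

Lemma supp_inZ J a x : supp_in J x -> supp_in J (a *: x).
Proof.
move=> [c [c0 ->]]; exists (fun i => a * c i); split.
  by move=> i iJ; rewrite c0 ?mulr0.
by rewrite scaler_sumr; apply: eq_bigr => i _; rewrite /= scalerA.
Qed.

Lemma supp_in_cor J i : i \in J -> supp_in J (cor i).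
Proof.
move=> iJ; exists (fun j => (j == i)%:R); split; last exact: comb_delta.
by move=> j jJ; case: eqP => // ji; rewrite ji iJ in jJ.
Qed.

Lemma supp_in_hact J w h : WP J w -> supp_in J h -> supp_in J (hact w h).
Proof.
move=> wJ hJ; elim/(@par_ind J): wJ => [|v i _ iJ IHv]; first by rewrite hact1.
rewrite hactM hact_srefl -scaleNr; apply: supp_inD => //.
by apply: supp_inZ; apply: supp_in_cor.
Qed.

Lemma natcomb_supp J h (n : I -> nat) : supp_in J h ->
  h = \sum_i (n i)%:R *: cor i -> forall i, i \notin J -> n i = 0%N.
Proof.
move=> [c [c0 ->]] /(comb_inj (@coroot_free R I A D)) E i iJ.
by have /eqP := E i; rewrite c0 // eq_sym pnatr_eq0 => /eqP.
Qed.

Lemma hpos_act_supp J w h : supp_in J h -> hpos h ->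
  (forall i, i \in J -> hpos (hact w (cor i))) -> hpos (hact w h).
Proof.
move=> hJ [n nE] wp; have n0 := natcomb_supp hJ nE.
rewrite nE hact_sum; elim/big_ind: _ => [||i _].
- exact: natcomb0.
- by move=> x y; apply: natcombD.
rewrite hactZ; have [iJ|/n0->] := boolP (i \in J); last by rewrite scale0r;
  exact: natcomb0.
by apply: natcombZ; apply: wp.
Qed.

(** An element of minimal length of a coset is unique: a descent [i] of [v] in
    [J] makes [v h_i] a negative combination of coroots in [J], and [x] keeps
    these signs. *)
Lemma par_pos_eq J x v : WP J v ->
  (forall i, i \in J -> hpos (hact x (cor i))) ->
  (forall i, i \in J -> hpos (hact (x * v)%g (cor i))) -> v = 1%g.
Proof.
move=> vJ xp xvp; have [//|v1] := pselect (v = 1%g).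
have [i iJ N] := par_descent vJ v1; exfalso.
apply: (hpos_anti (xvp i iJ)); rewrite hactM -hactN.
apply: hpos_act_supp (xp); last exact: hposN.
by rewrite -scaleN1r; apply: supp_inZ; apply: supp_in_hact => //;
  exact: supp_in_cor.
Qed.

Lemma minreps_rP J x :
  minreps_r D J x <-> forall i, i \in J -> hpos (hact x (cor i)).
Proof.
split=> [xm i iJ|xp v vJ]; first by apply: hlen_pos; apply/xm/par_srefl.
pose Q n := `[< exists u, WP J u /\ len (x * u)%g = n >].
have exQ : exists n, Q n.
  by exists (len (x * v)%g); apply/asboolP; exists v.
case: (ex_minnP exQ) => n /asboolP[u [uJ <-]] nmin.
suff u1 : u = 1%g.
  by move: nmin; rewrite u1 mulg1; apply; apply/asboolP; exists v.
apply: (par_pos_eq uJ xp) => i iJ; apply: hlen_pos; apply: nmin.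
apply/asboolP; exists (u * s_ i)%g; split; last by rewrite mulgA.
by apply: parM => //; exact: par_srefl.
Qed.

Lemma minreps_lV J x : minreps_l D J x <-> minreps_r D J (x^-1)%g.
Proof.
split=> xm v /parV vJ.
  by rewrite lenV -(lenV (_ * v)%g) invgM invgK; apply: xm.
by rewrite -(lenV x) -(lenV (v * x)%g) invgM; apply: xm.
Qed.

Lemma minreps_lP J x :
  minreps_l D J x <-> forall i, i \in J -> hpos (hact (x^-1)%g (cor i)).
Proof. by rewrite minreps_lV minreps_rP. Qed.

Lemma par_minl J w : exists a, WP J a /\ minreps_l D J (a^-1 * w)%g.
Proof.
pose Q n := `[< exists u, WP J u /\ len (u^-1 * w)%g = n >].
have exQ : exists n, Q n.
  by exists (len w); apply/asboolP; exists 1%g; rewrite invg1 mul1g;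
    split=> //; exact: par1.
case: (ex_minnP exQ) => n /asboolP[u [uJ <-]] nmin.
exists u; split=> // v vJ; apply: nmin; apply/asboolP.
exists (u * v^-1)%g; split; first by apply: parM => //; exact: parV.
by rewrite invgM invgK mulgA.
Qed.

(** The sign changes at a letter of a word of [a], where the coroot has become
    the simple coroot of that letter. *)
Lemma par_inversion K a v i : WP K a -> hpos (hact v (cor i)) ->
  ~ hpos (hact (a * v)%g (cor i)) ->
  exists b k, [/\ WP K b, k \in K & hact v (cor i) = hact b (cor k)].
Proof.
move=> aK p; elim/(@par_ind K): aK => [|b k bK kK IHb]; first by rewrite mul1g.
have [q N|/IHb//] := pselect (hpos (hact (b * v)%g (cor i))).
rewrite -mulgA in N; have E := hpos_cross q N.
exists (b^-1)%g, k; split=> //; first exact: parV.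
by rewrite -E hactM hactK.
Qed.

End Roots.

(** * The Tits cone *)

Section Dominance.
Variables (R : realType) (I : finType) (A : gcm I) (D : realization R A).
Implicit Types (v w a : weyl D) (i j k : I) (l m : dual D) (h : cartan D).
Implicit Types (J K : {set I}).

Notation cor := (coroot D).
Notation s_ := (srefl D).
Notation WP := (parabolic D).

Definition Kdom K l := forall i, i \in K -> 0 <= pair l (cor i).
Definition zeros l : {set I} := [set i | pair l (cor i) == 0]%SET.

Lemma zerosP l i : reflect (pair l (cor i) = 0) (i \in zeros l).
Proof. by rewrite inE; apply: eqP. Qed.

Lemma Kdom_pair K l h : Kdom K l -> hpos h -> supp_in K h -> 0 <= pair l h.
Proof.
move=> lK [n nE] hK; have n0 := natcomb_supp hK nE.
rewrite nE pair_sumr sumr_ge0 // => i _; rewrite pairZr.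
have [iK|/n0->] := boolP (i \in K); last by rewrite mul0r.
by rewrite mulr_ge0 ?lK.
Qed.

Lemma dominant_pair l h : dominant l -> hpos h -> 0 <= pair l h.
Proof.
move=> ld [n ->]; rewrite pair_sumr sumr_ge0 // => i _; rewrite pairZr.
by rewrite mulr_ge0 //; apply: ld.
Qed.

Lemma srefl_actE i l :
  weyl_act (s_ i) l = l - pair l (cor i) *: sroot D i.
Proof. exact: srefl_act. Qed.

Lemma srefl_fix i l : pair l (cor i) = 0 -> weyl_act (s_ i) l = l.
Proof. by rewrite srefl_actE => ->; rewrite scale0r subr0. Qed.

Lemma par_fix J w l : (forall i, i \in J -> pair l (cor i) = 0) -> WP J w ->
  weyl_act w l = l.
Proof.
move=> lJ; elim/(@par_ind _ _ _ D J) => [|v i _ iJ IHv]; first exact: weyl_act1.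
by rewrite weyl_actM IHv srefl_fix ?lJ.
Qed.

(** If [i] is a descent of [w], then the pairing of [m] with [h_i] is both
    nonnegative and nonpositive, hence zero; the factor [s_i] fixes [m] and can
    be removed from [w]. *)
Lemma fundamental_domain m w :
  dominant m -> dominant (weyl_act w m) -> WP (zeros m) w.
Proof.
have [n] := ubnP (len w); elim: n w => // n IHn w; rewrite ltnS => lew md wd.
have [->|w1] := pselect (w = 1%g); first exact: par1.
have [v [i [wE lenw]]] := len_last w1.
have N : ~ hpos (hact w (cor i)).
  by rewrite hposP {2}wE mulg_sreflK lenw; lia.
have := dominant_pair wd (hposN N); rewrite pairNr pair_act => le0.
have m0 : pair m (cor i) = 0.
  by apply/eqP; rewrite eq_le -oppr_ge0 le0; apply: md.
rewrite wE; apply: parM; last by apply: par_srefl; apply/zerosP.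
by apply: IHn => //; [lia|rewrite -(srefl_fix m0) -weyl_actM -wE].
Qed.

(** The set of chambers whose closure contains a point of the Tits cone is the
    simplex of the Coxeter complex whose facet contains the point. *)
Definition cell l : set (weyl D) :=
  [set v | dominant (weyl_act (v^-1)%g l)]%classic.

Lemma cellE w m : dominant m -> cell (weyl_act w m) = lcoset w (zeros m).
Proof.
move=> md; apply/seteqP; split=> v.
  rewrite /cell /= -weyl_actM => /(fundamental_domain md) /parV vw.
  by exists (v^-1 * w)^-1%g => //; rewrite invgM invgK mulgA mulgV mul1g.
move=> [u uJ <-]; rewrite /cell /= -weyl_actM invgM -mulgA mulVg mulg1.
by rewrite (@par_fix (zeros m)) // => [i /zerosP//|]; exact: parV.
Qed.

(** Each reflection at a simple coroot with negative value removes this coroot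
    from the finite list of positive coroots of the subgroup with negative
    value, and permutes the others. *)
Lemma Kdom_exists K l (s : seq (cartan D)) :
  (forall b i, WP K b -> i \in K -> hpos (hact b (cor i)) ->
     pair l (hact b (cor i)) < 0 -> hact b (cor i) \in s) ->
  exists2 a, WP K a & Kdom K (weyl_act a l).
Proof.
have [n] := ubnP (size s); elim: n s l => // n IHn s l.
rewrite ltnS => les sP.
have [lK|] := pselect (Kdom K l).
  by exists 1%g; [exact: par1|rewrite weyl_act1].
move=> /existsNP[i] /not_implyP[iK] /negP; rewrite -ltNge => li.
have i_s : cor i \in s.
  have := sP 1%g i (par1 _ _) iK; rewrite hact1; apply=> //.
  exact: hpos_cor.
pose s' := [seq hact (s_ i) h | h <- s & h != cor i].
have lts : (size s' < n)%N.
  apply: leq_trans les; rewrite size_map size_filter.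
  rewrite ltn_neqAle count_size andbT -all_count; apply/negP => /allP/(_ _ i_s).
  by rewrite eqxx.
have [|a aK al] := IHn s' (weyl_act (s_ i) l) lts.
  move=> b j bK jK p; rewrite pair_hactV sreflV -hactM => lt0.
  have q : hpos (hact (s_ i * b)%g (cor j)).
    apply: contrapT => /(hpos_cross p) E.
    by move: lt0; rewrite hactM E hact_srefl_cor pairNr oppr_lt0 ltNge ltW.
  have -> : hact b (cor j) = hact (s_ i) (hact (s_ i * b)%g (cor j)).
    by rewrite -hactM mulg_sreflKl.
  apply: map_f; rewrite mem_filter sP //; last first.
    by apply: parM => //; exact: par_srefl.
  rewrite andbT; apply/eqP => E; apply: (@hpos_corN _ _ _ D i).
  by rewrite -hact_srefl_cor -E -hactM mulg_sreflKl.
exists (a * s_ i)%g; first by apply: parM => //; exact: par_srefl.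
by rewrite weyl_actM.
Qed.

Lemma inversions_finite w : exists s : seq (cartan D), forall v i,
  hpos (hact v (cor i)) -> ~ hpos (hact (w * v)%g (cor i)) ->
  hact v (cor i) \in s.
Proof.
elim/weyl_ind: w => [|w k [s sP]].
  by exists [::] => v i p; rewrite mul1g => /(_ p).
exists (hact (w^-1)%g (cor k) :: s) => v i p N; rewrite inE.
have [q|/(sP _ _ p)->] := pselect (hpos (hact (w * v)%g (cor i)));
  last exact: orbT.
by rewrite -mulgA in N; rewrite -(hpos_cross q N) hactM hactK eqxx.
Qed.

(** The description of the Tits cone by finiteness; convexity follows, since a
    coroot negative at a point of a segment is negative at one of the ends. *)
Lemma tits_coneP l : tits_cone l <-> exists s : seq (cartan D), forall v i,
  hpos (hact v (cor i)) -> pair l (hact v (cor i)) < 0 -> hact v (cor i) \in s.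
Proof.
split=> [[w _ [m md <-]]|[s sP]].
  have [s sP] := inversions_finite (w^-1)%g.
  exists s => v i p lt0; apply: sP => // q.
  by move: lt0; rewrite pair_hactV -hactM ltNge dominant_pair.
have [|a _ al] := @Kdom_exists [set: I]%SET l s.
  by move=> b i _ _; apply: sP.
exists (a^-1)%g => //; exists (weyl_act a l); last exact: weyl_actK.
by move=> i; apply: al; rewrite inE.
Qed.

Lemma tits_cone_convex (x y : dual D) (t : R) : 0 <= t <= 1 ->
  tits_cone x -> tits_cone y -> tits_cone ((1 - t) *: x + t *: y).
Proof.
move=> /andP[t0 t1] /tits_coneP[s sP] /tits_coneP[s' sP'].
apply/tits_coneP; exists (s ++ s') => v i p; rewrite mem_cat => lt0.
have [x0|] := ltP (pair x (hact v (cor i))) 0; first by rewrite sP.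
have [y0|] := ltP (pair y (hact v (cor i))) 0; first by rewrite sP' ?orbT.
move=> y0 x0; move: lt0; rewrite pairDl !pairZl ltNge addr_ge0 ?mulr_ge0 //.
by rewrite subr_ge0.
Qed.

Lemma tits_cone_Kdom K l : tits_cone l ->
  exists2 a, WP K a & Kdom K (weyl_act a l).
Proof.
move=> [w _ [m md <-]]; have [a [aK am]] := par_minl K w.
exists (a^-1)%g; first exact: parV.
move=> i iK; rewrite -weyl_actM pair_hactV; apply: dominant_pair => //.
exact: (minreps_lP K _).1.
Qed.

Lemma dominant_tits m : dominant m -> tits_cone m.
Proof.
by move=> md; exists 1%g => //; exists m => //; rewrite weyl_act1.
Qed.

Lemma facet_exists J : exists2 m, dominant m & zeros m = J.
Proof.
have [m mE] := @weight_exists _ _ _ D (fun i => (i \notin J)%:R).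
exists m; first by move=> i; rewrite -/(pair _ _) mE ler0n.
by apply/setP => i; rewrite inE mE pnatr_eq0 eqb0 negbK.
Qed.

End Dominance.

(** * Diagrams of finite and of non-finite type *)

Section ZMatrix.
Variables (R : realType) (I : finType).

(** Pivoting on a positive diagonal entry keeps the off-diagonal entries
    nonpositive; a nonpositive diagonal entry provides the vector of the second
    alternative. *)
Lemma Zmatrix_alternative (C : {set I}) (M : I -> I -> R) :
  (forall i j, i \in C -> j \in C -> i != j -> M i j <= 0) ->
  (forall v : I -> R, (forall i, i \in C -> 0 <= \sum_(j in C) M i j * v j) ->
     forall i, i \in C -> 0 <= v i) \/
  (exists u : I -> R, [/\ forall i, i \in C -> 0 <= u i,
     exists2 i, i \in C & 0 < u i &
     forall i, i \in C -> \sum_(j in C) M i j * u j <= 0]).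
Proof.
have [n] := ubnP #|C|; elim: n C M => // n IHn C M; rewrite ltnS => leC Mn.
have [->|[p pC]] := set_0Vmem C.
  by left=> v _ i; rewrite inE.
have [le0|gt0] := leP (M p p) 0.
  right; exists (fun j => (j == p)%:R); split=> //.
  - by exists p; rewrite ?eqxx.
  - move=> i iC; rewrite (bigD1 p) //= eqxx mulr1 big1 => [|j /andP[_
    /negbTE->]].
      by rewrite addr0; case: (eqVneq i p) => [->//|nip]; exact: Mn.
    by rewrite mulr0.
pose C' := (C :\ p)%SET.
pose M' i j := M i j - M i p * M p j / M p p.
have sumC F : \sum_(j in C) F j = F p + \sum_(j in C') F j :> R.
  by rewrite (big_setD1 p).
have C'P i : i \in C' -> i \in C /\ i != p.
  by rewrite in_setD1 => /andP[].
have sumM' v i : \sum_(j in C') M' i j * v j =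
    \sum_(j in C') M i j * v j - M i p / M p p * \sum_(j in C') M p j * v j.
  rewrite mulr_sumr -sumrB; apply: eq_bigr => j _; rewrite /M'; ring.
have [||mono|[u [u0 [q qC uq] Mu]]] := IHn C' M'.
- by rewrite (cardsD1 p C) pC in leC.
- move=> i j /C'P[iC nip] /C'P[jC njp] nij; rewrite /M' subr_le0.
  apply: le_trans (Mn i j iC jC nij) _.
  rewrite divr_ge0 ?(ltW gt0) //.
  by rewrite mulr_le0 ?Mn // eq_sym.
- left=> v Mv.
  have v0 i : i \in C' -> 0 <= v i.
    apply: mono => {}i /C'P[iC nip]; rewrite sumM'.
    have := Mv i iC; have := Mv p pC; rewrite !sumC => h1 h2.
    have -> : \sum_(j in C') M i j * v j
        - M i p / M p p * \sum_(j in C') M p j * v j =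
      (M i p * v p + \sum_(j in C') M i j * v j)
        + (- M i p) / M p p * (M p p * v p + \sum_(j in C') M p j * v j).
      by field; rewrite gt_eqF.
    by rewrite addr_ge0 // mulr_ge0 // divr_ge0 ?(ltW gt0) // oppr_ge0 Mn.
  move=> i iC; case: (eqVneq i p) => [->|nip]; last by rewrite v0 // !inE nip.
  have := Mv p pC; rewrite sumC => h.
  rewrite -(pmulr_rge0 _ gt0); apply: le_trans h _; rewrite gerDl.
  apply: sumr_le0 => j jC'; have [jC njp] := C'P j jC'.
  by rewrite mulr_le0_ge0 ?v0 // Mn // eq_sym.
right.
pose t := - (\sum_(j in C') M p j * u j) / M p p.
have t0 : 0 <= t.
  rewrite divr_ge0 ?(ltW gt0) // oppr_ge0 sumr_le0 // => j jC'.
  have [jC njp] := C'P j jC'.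
  by rewrite mulr_le0_ge0 ?u0 // Mn // eq_sym.
pose w j := if j == p then t else u j.
have wC' F : \sum_(j in C') F j * w j = \sum_(j in C') F j * u j.
  by apply: eq_bigr => j /C'P[_ njp]; rewrite /w (negbTE njp).
exists w; split.
- move=> i iC; rewrite /w; case: eqP => // /eqP nip.
  by rewrite u0 // !inE nip.
- by have [qC' nqp] := C'P q qC; exists q; rewrite // /w (negbTE nqp).
- move=> i iC; rewrite sumC wC' {1}/w eqxx.
  case: (eqVneq i p) => [->|nip].
    by rewrite /t mulrC divfK ?gt_eqF // addNr.
  have := Mu i; rewrite sumM' !inE nip iC => /(_ isT); apply: le_trans.
  rewrite le_eqVlt; apply/orP; left; apply/eqP; rewrite /t.
  by field; rewrite gt_eqF.
Qed.

End ZMatrix.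

Section Diagram.
Variables (R : realType) (I : finType) (A : gcm I).
Implicit Types (J K C : {set I}).

(** Indecomposability of the matrix restricted to [C], in the form in which it
    is used: every proper nonempty part of [C] has a neighbour in [C]. *)
Definition connected C := forall S : {set I}, S \subset C -> S != set0%SET ->
  S != C -> exists i k, [/\ i \in C, i \notin S, k \in S & A i k != 0].

Lemma gcm_neq0 i j : A i j != 0 -> A j i != 0.
Proof. by apply: contraNneq => /gcm_zero ->. Qed.

Lemma adj_sym J : symmetric (adj A J).
Proof.
move=> i j; rewrite /adj /=; case: (i \in J); case: (j \in J) => //=.
by apply/idP/idP; exact: gcm_neq0.
Qed.

Lemma adj_connect_sym J : connect_sym (adj A J).
Proof. by apply: sym_connect_sym; apply: adj_sym. Qed.

Lemma mem_component J i : i \in J -> i \in component A J i.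
Proof. by rewrite inE => ->; rewrite connect0. Qed.

Lemma component_sub J i : component A J i \subset J.
Proof. by apply/subsetP => j; rewrite inE => /andP[]. Qed.

Lemma component_eq J i j : j \in component A J i ->
  component A J j = component A J i.
Proof.
rewrite inE => /andP[jJ ij]; apply/setP => k; rewrite !inE.
by rewrite (same_connect (adj_connect_sym J) ij).
Qed.

Lemma component_adj J i j : i \in J -> j \in J -> A i j != 0 ->
  component A J i = component A J j.
Proof.
move=> iJ jJ a; apply/esym/component_eq; rewrite inE jJ /=.
by apply: connect1; rewrite /adj /= iJ jJ.
Qed.

Lemma component_connected J i : connected (component A J i).
Proof.
set C := component A J i => S /subsetP SC S0 SnC.
apply: contrapT => noedge.
have stay a b : a \in S -> adj A J a b -> b \in S.
  move=> aS ab; apply/negPn/negP => bS; apply: noedge; exists b, a.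
  have aC := SC a aS; case/and3P: (ab) => [aJ bJ nz].
  split=> //; last exact: gcm_neq0.
  by rewrite /C -(component_eq aC) inE bJ; exact: connect1.
have [k kS] := set0Pn _ S0.
case/negP: SnC; rewrite eqEsubset; apply/andP; split; first exact/subsetP.
apply/subsetP => j; rewrite /C -(component_eq (SC k kS)) inE => /andP[_].
case/connectP => s; elim: s k kS => [|b s IHs] k kS /=; first by move=> _ ->.
by move=> /andP[kb]; apply: IHs; apply: stay kb.
Qed.

Section OneComponent.
Variable C : {set I}.
Hypothesis Cc : connected C.

(** At an index [i] outside the support of [u] but adjacent to it the row sum
    is strictly negative, so that the value at [i] can be raised a little; a
    vector with the largest support has no such index. *)
Lemma extend_positive (N : I -> I -> R) :
  (forall i j, i \in C -> j \in C -> i != j -> N i j <= 0) ->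
  (forall i j, i \in C -> j \in C -> A i j != 0 -> N i j != 0) ->
  (exists u : I -> R, [/\ forall i, i \in C -> 0 <= u i,
     exists2 i, i \in C & 0 < u i &
     forall i, i \in C -> \sum_(j in C) N i j * u j <= 0]) ->
  (exists u : I -> R, (forall i, i \in C -> 0 < u i) /\
     forall i, i \in C -> \sum_(j in C) N i j * u j <= 0).
Proof.
move=> NZ Nadj [u []].
have [n] := ubnP #|[set i in C | u i == 0]|.
elim: n u => // n IHn u; rewrite ltnS => leu u0 [p pC up] Nu.
pose S := [set i in C | u i != 0]%SET.
have [SC|SnC] := eqVneq S C.
  exists u; split=> // i iC; rewrite lt_def u0 // andbT.
  by move: iC; rewrite -SC inE => /andP[].
have [||i [k [iC iS kS Aik]]] := Cc _ _ SnC.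
- by apply/subsetP => i; rewrite inE => /andP[].
- by apply/set0Pn; exists p; rewrite inE pC gt_eqF.
have ui : u i = 0 by apply/eqP; move: iS; rewrite inE iC /= negbK.
have [kC uk] : k \in C /\ u k != 0 by move: kS; rewrite inE => /andP.
have nik : i != k by apply: contraNneq iS => ->.
have lt0 : \sum_(j in C) N i j * u j < 0.
  rewrite (bigD1 k) //= ltr_wnDr //.
    apply: sumr_le0 => j /andP[jC njk]; case: (eqVneq i j) => [<-|nij].
      by rewrite ui mulr0.
    by rewrite mulr_le0_ge0 ?u0 ?NZ.
  rewrite nmulr_rlt0; first by rewrite lt_def uk u0.
  by rewrite lt_neqAle Nadj ?NZ.
pose d := `|N i i| + 1.
have d0 : 0 < d by rewrite ltr_wpDl.
pose e := - (\sum_(j in C) N i j * u j) / d.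
have e0 : 0 < e by rewrite divr_gt0 // oppr_gt0.
pose w j := u j + (j == i)%:R * e.
have w_ge j : j \in C -> u j <= w j.
  by move=> jC; rewrite lerDl mulr_ge0 // ltW.
apply: (IHn w).
- apply: leq_trans leu; apply: proper_card; apply/properP; split.
    apply/subsetP => j; rewrite !inE => /andP[jC /eqP wj].
    by rewrite jC eq_le u0 // andbT -wj w_ge.
  exists i; first by rewrite inE iC ui eqxx.
  rewrite inE iC /=.
  by rewrite /w eqxx mul1r ui add0r gt_eqF.
- by move=> j jC; apply: le_trans (u0 j jC) (w_ge j jC).
- by exists p => //; apply: lt_le_trans up (w_ge p pC).
move=> j jC.
have -> : \sum_(l in C) N j l * w l = \sum_(l in C) N j l * u l + N j i * e.
  under eq_bigr do rewrite /w mulrDr.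
  rewrite big_split /=; congr (_ + _).
  rewrite (bigD1 i) //= eqxx mul1r big1 ?addr0 // => l /andP[_ /negbTE->].
  by rewrite mul0r mulr0.
case: (eqVneq j i) => [->|nji].
  have -> : \sum_(l in C) N i l * u l = - (e * d).
    by rewrite /e divfK ?gt_eqF // opprK.
  rewrite addrC subr_le0 mulrC ler_wpM2l ?(ltW e0) //.
  by rewrite (le_trans (ler_norm _)) // lerDl.
have le2 : N j i * e <= 0 by rewrite mulr_le0_ge0 ?(ltW e0) // NZ.
by have le1 := Nu j jC; lra.
Qed.

Lemma sum_submx (v : 'cV[R]_#|C|) i0 (h : i0 \in C) (k : 'I_#|C|) :
  (gcm_submx R A C *m v) k 0 =
  \sum_(j in C) (A (enum_val k) j)%:~R * v (enum_rank_in h j) 0.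
Proof.
rewrite mxE [RHS]big_enum_val /=; apply: eq_bigr => l _.
by rewrite mxE enum_valK_in.
Qed.

(** The alternative is applied to the transpose. Its first case means that the
    transpose, hence the matrix itself, has a nonnegative inverse, and that
    makes the matrix of finite type. *)
Lemma not_finite_type : C != set0%SET -> ~ finite_type R A C ->
  exists v : I -> R, (forall i, i \in C -> 0 < v i) /\
    forall j, j \in C -> \sum_(i in C) v i * (A i j)%:~R <= 0.
Proof.
move=> /set0Pn[i0 i0C] nf.
pose N i j : R := (A j i)%:~R.
have NZ i j : i \in C -> j \in C -> i != j -> N i j <= 0.
  by move=> _ _ nij; rewrite lerz0 gcm_offdiag // eq_sym.
have [mono|/extend_positive] := Zmatrix_alternative NZ; last first.
  case=> //; first by move=> i j _ _ /gcm_neq0; rewrite intr_eq0.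
  move=> u [u0 Nu]; exists u; split=> // j jC.
  by under eq_bigr do rewrite mulrC; apply: Nu.
case: nf.
set M := gcm_submx R A C.
have monoT (v : 'cV[R]_#|C|) : (forall k : 'I_#|C|, 0 <= (M^T *m v) k 0) ->
    forall k : 'I_#|C|, 0 <= v k 0.
  move=> Mv k; rewrite -(enum_valK_in i0C k).
  apply: (mono (fun j => v (enum_rank_in i0C j) 0)); last exact: enum_valP.
  move=> i iC; have := Mv (enum_rank_in i0C i);
    rewrite mxE [X in _ -> 0 <= X]big_enum_val /=.
  congr (_ <= _); apply: eq_bigr => l _.
  by rewrite !mxE enum_rankK_in // enum_valK_in.
have dM : \det M != 0.
  apply/negP => /det0P[v v0 vM].
  have Mv0 : M^T *m v^T = 0 by rewrite -trmx_mul vM trmx0.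
  case/negP: v0; apply/eqP/rowP => k; rewrite mxE; apply/eqP.
  rewrite eq_le -oppr_ge0; apply/andP; split.
    have := monoT (- v^T) _ k; rewrite !mxE; apply=> i.
    by rewrite mulmxN Mv0 oppr0 mxE.
  by have := monoT v^T _ k; rewrite !mxE; apply=> i; rewrite Mv0 mxE.
have uM : M \in unitmx by rewrite unitmxE unitfE.
have inv_ge0 (i j : 'I_#|C|) : 0 <= invmx M i j.
  have -> : invmx M i j = ((invmx M)^T *m delta_mx i 0 : 'cV[R]_#|C|) j 0.
    by rewrite -colE !mxE.
  apply: monoT => l; rewrite mulmxA -trmx_mul mulVmx // trmx1 mul1mx mxE.
  exact: ler0n.
have monoM (v : 'cV[R]_#|C|) : (forall k : 'I_#|C|, 0 <= (M *m v) k 0) ->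
    forall k : 'I_#|C|, 0 <= v k 0.
  move=> Mv k; rewrite -(mulKmx uM v) mxE.
  by apply: sumr_ge0 => l _; rewrite mulr_ge0.
have MZ (i j : 'I_#|C|) : i != j -> M i j <= 0.
  by move=> nij; rewrite mxE lerz0 gcm_offdiag // (inj_eq enum_val_inj).
split=> //.
- pose u : 'cV[R]_#|C| := invmx M *m const_mx 1.
  have Mu k : (M *m u) k 0 = 1 by rewrite mulKVmx // mxE.
  have u0 k : 0 <= u k 0 by apply: monoM => l; rewrite Mu.
  exists u; split=> k; last by rewrite Mu.
  rewrite lt_def u0 andbT; apply/negP => /eqP uk.
  have := Mu k; rewrite mxE (bigD1 k) //= uk mulr0 add0r => E.
  have := @ltr01 R; rewrite -E ltNge sumr_le0 // => l nlk.
  by rewrite mulr_le0_ge0 // MZ // eq_sym.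
move=> v Mv; have v0 := monoM v Mv.
have [pos|npos] := pselect (forall i, 0 < v i 0); [by left|right].
have h0 := i0C.
pose g i := v (enum_rank_in h0 i) 0.
pose S := [set i in C | g i == 0].
have gk k : g (enum_val k) = v k 0 by rewrite /g enum_valK_in.
move: npos => /existsNP[k /negP]; rewrite lt_def v0 andbT negbK => vk.
have SC : S = C.
  apply/eqP/negPn/negP => /Cc[]; first by apply/subsetP => i;
    rewrite inE => /andP[].
    by apply/set0Pn; exists (enum_val k); rewrite inE enum_valP gk.
  move=> i [j [iC iS jS Aij]].
  have [jC gj] : j \in C /\ g j = 0 by move: jS; rewrite inE => /andP[-> /eqP].
  have gi : g i != 0 by move: iS; rewrite inE iC.
  have gi0 : 0 < g i by rewrite lt_def gi v0.
  have := Mv (enum_rank_in h0 j); rewrite (sum_submx _ h0) enum_rankK_in //.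
  apply/negP; rewrite -ltNge (bigD1 i) //= ltr_wnDr //; last first.
    rewrite pmulr_llt0 // ltrz0 lt_neqAle gcm_neq0 // gcm_offdiag //.
    by apply: contraNneq gi => <-; rewrite gj.
  apply: sumr_le0 => l /andP[lC _]; case: (eqVneq j l) => [<-|njl].
    by rewrite -/(g j) gj mulr0.
  by rewrite mulr_le0_ge0 ?v0 // lerz0 gcm_offdiag.
apply/colP => l; rewrite mxE -gk; apply/eqP.
have SP i : i \in C -> g i == 0 by rewrite -{1}SC inE => /andP[].
exact/SP/enum_valP.
Qed.

Lemma finite_type_positive : C != set0 -> finite_type R A C ->
  exists u : I -> R, (forall i, i \in C -> 0 < u i) /\
    forall i, i \in C -> 0 < \sum_(j in C) (A i j)%:~R * u j.
Proof.
move=> /set0Pn[i0 i0C] [_ [u [u0 Mu]] _].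
exists (fun j => u (enum_rank_in i0C j) 0); split=> i iC; first exact: u0.
have := Mu (enum_rank_in i0C i); rewrite (sum_submx _ i0C).
by rewrite enum_rankK_in.
Qed.

End OneComponent.

(** Connected components may be computed in any union of components. *)
Lemma component_restrict J K i : J \subset K ->
  (forall j k, j \in J -> k \in K -> A j k != 0 -> k \in J) -> i \in J ->
  component A K i = component A J i.
Proof.
move=> /subsetP JK cl iJ; apply/setP => k; rewrite !inE.
apply/andP/andP => -[]; last first.
  move=> kJ ik; split; first exact: JK.
  apply: connect_sub ik => a b /and3P[aJ bJ ab].
  by apply: connect1; rewrite /adj /= !JK.
move=> _ /connectP[s]; elim: s i iJ => [|b s IHs] i iJ /=.
  by move=> _ ->; rewrite iJ connect0.
move=> /andP[/and3P[_ bK ib] p] E; have bJ := cl _ _ iJ bK ib.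
have [kJ bk] := IHs b bJ p E; split=> //; apply: connect_trans bk.
by apply: connect1; rewrite /adj /= iJ bJ.
Qed.

Notation infp := (infpart R A).
Notation finp := (finpart R A).

Lemma infpart_sub J : infp J \subset J.
Proof. by apply/subsetP => i; rewrite inE => /andP[]. Qed.

Lemma finpart_sub J : finp J \subset J.
Proof. by apply/subsetP => i; rewrite inE => /andP[]. Qed.

Lemma finpart_or_infpart J i : i \in J -> (i \in finp J) || (i \in infp J).
Proof. by rewrite !inE => ->; case: `[< _ >]. Qed.

Lemma infpart_adj J i j : i \in infp J -> j \in J -> A i j != 0 -> j \in infp J.
Proof.
rewrite !inE => /andP[iJ +] jJ a; rewrite jJ /=.
by rewrite (component_adj iJ jJ a).
Qed.

Lemma finpart_adj J i j : i \in finp J -> j \in J -> A i j != 0 -> j \in finp J.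
Proof.
rewrite !inE => /andP[iJ +] jJ a; rewrite jJ /=.
by rewrite (component_adj iJ jJ a).
Qed.

Lemma special_infpart J : special R A (infp J).
Proof.
rewrite /special; apply/setP => i.
rewrite [RHS]inE; have [iJ|//] := boolP (i \in infp J).
rewrite -(@component_restrict (infp J) J i) ?infpart_sub //=.
  by move: iJ; rewrite inE => /andP[_ ->].
exact: infpart_adj.
Qed.

Lemma perpP J i : reflect (forall j, j \in J -> A i j = 0) (i \in perp A J).
Proof.
rewrite inE; apply: (iffP forall_inP) => h j jJ; apply/eqP; exact: h.
Qed.

Lemma perp_sym J i j : i \in perp A J -> j \in J -> A j i = 0.
Proof. by move=> /perpP h /h /gcm_zero. Qed.

Lemma perp_disj J i : i \in perp A J -> i \notin J.
Proof. by move=> /perpP h; apply/negP => /h; rewrite gcm_diag. Qed.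

Lemma perpS J K : J \subset K -> perp A K \subset perp A J.
Proof.
by move=> /subsetP JK; apply/subsetP => i /perpP h; apply/perpP => j /JK/h.
Qed.

Lemma finpart_perp J i : i \in finp J -> i \in perp A (infp J).
Proof.
move=> iF; apply/perpP => j jI; apply/eqP/negPn/negP => a.
have jJ := subsetP (infpart_sub J) j jI.
have := finpart_adj iF jJ a; move: jI; rewrite !inE => /andP[-> /negbTE->].
by [].
Qed.

Lemma infpart_add_perp X K : special R A X -> K \subset perp A X ->
  infp K = set0 -> infp (X :|: K) = X.
Proof.
move=> Xs /subsetP KX Kf; apply/setP => i.
have [iX|iX] := boolP (i \in X).
  rewrite inE in_setU iX /= (@component_restrict X) ?subsetUl //.
    by move: iX; rewrite {1}Xs inE => /andP[_ ->].
  move=> j k jX; rewrite inE => /orP[//|/KX kX].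
  by rewrite (perp_sym kX jX) eqxx.
have [iK|iK] := boolP (i \in K); last by rewrite inE in_setU (negbTE iX)
  (negbTE iK).
rewrite inE in_setU iK orbT /= (@component_restrict K) ?subsetUr //.
  apply/negbTE; rewrite negbK; apply/negPn/negP => nf.
  by have : i \in infp K; [rewrite inE iK|rewrite Kf inE].
move=> j k /KX jX; rewrite inE => /orP[kX|//].
by have /perpP-> := jX; rewrite ?eqxx.
Qed.

(** The vectors of the components are glued; for an index outside [X] all terms
    of the sum are nonpositive. *)
Lemma special_vector X : special R A X ->
  exists v : I -> R, [/\ forall i, i \in X -> 0 < v i,
    forall i, i \notin X -> v i = 0 &
    forall j, \sum_i v i * (A i j)%:~R <= 0].
Proof.
move=> Xs.
have vC C : exists v : I -> R, (exists2 i, i \in X & C = component A X i) ->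
    (forall i, i \in C -> 0 < v i) /\
    forall j, j \in C -> \sum_(i in C) v i * (A i j)%:~R <= 0.
  have [[i iX CE]|] := pselect (exists2 i, i \in X & C = component A X i).
    have [|||v vP] := @not_finite_type C.
    - by rewrite CE; apply: component_connected.
    - by apply/set0Pn; exists i; rewrite CE mem_component.
    - by move: iX; rewrite Xs inE CE => /andP[_ /asboolP].
    by exists v.
  by exists (fun=> 0).
pose f C := sval (cid (vC C)).
have fP C : (exists2 i, i \in X & C = component A X i) ->
    (forall i, i \in C -> 0 < f C i) /\
    forall j, j \in C -> \sum_(i in C) f C i * (A i j)%:~R <= 0.
  by rewrite /f; case: cid.
pose v i := if i \in X then f (component A X i) i else 0.
have v0 i : i \in X -> 0 < v i.
  move=> iX; rewrite /v iX; apply: (fP _ _).1; last exact: mem_component.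
  by exists i.
have v_out i : i \notin X -> v i = 0 by move=> /negbTE iX; rewrite /v iX.
exists v; split=> // j; have [jX|jX] := boolP (j \in X); last first.
  apply: sumr_le0 => i _; have [iX|/v_out->] := boolP (i \in X).
    rewrite mulr_ge0_le0 ?(ltW (v0 i iX)) // lerz0 gcm_offdiag //.
    by apply: contraNneq jX => <-.
  by rewrite mul0r.
pose C := component A X j.
have CX : C \subset X := component_sub X j.
rewrite (bigID (mem C)) /= [X in _ + X]big1 ?addr0 => [|i iC]; last first.
  have [iX|/v_out->] := boolP (i \in X); last by rewrite mul0r.
  have [a|] := eqVneq (A i j) 0; first by rewrite a mulr0.
  move=> a; case/negP: iC.
  by rewrite /C -(component_adj iX jX a) mem_component.
have -> : \sum_(i in C) v i * (A i j)%:~R =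
          \sum_(i in C) f C i * (A i j)%:~R.
  apply: eq_bigr => i iC; rewrite /v (subsetP CX) //.
  by rewrite (component_eq iC).
by apply: (fP _ _).2; [exists j|apply: mem_component].
Qed.

Lemma finpart_vector J :
  exists u : I -> R, [/\ forall i, i \in finp J -> 0 < u i,
    forall i, i \notin finp J -> u i = 0 &
    forall i, i \in finp J -> 0 < \sum_j (A i j)%:~R * u j].
Proof.
have vC C : exists v : I -> R, (exists2 i, i \in finp J & C = component A J i)
  ->
    (forall i, i \in C -> 0 < v i) /\
    forall i, i \in C -> 0 < \sum_(j in C) (A i j)%:~R * v j.
  have [[i iF CE]|] := pselect (exists2 i, i \in finp J & C = component A J i).
    have iJ := subsetP (finpart_sub J) i iF.
    have [||v vP] := @finite_type_positive C.
    - by apply/set0Pn; exists i; rewrite CE mem_component.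
    - by move: iF; rewrite inE CE => /andP[_ /asboolP].
    by exists v.
  by exists (fun=> 0).
pose f C := sval (cid (vC C)).
have fP C : (exists2 i, i \in finp J & C = component A J i) ->
    (forall i, i \in C -> 0 < f C i) /\
    forall i, i \in C -> 0 < \sum_(j in C) (A i j)%:~R * f C j.
  by rewrite /f; case: cid.
pose v i := if i \in finp J then f (component A J i) i else 0.
have FJ i : i \in finp J -> i \in J by apply: (subsetP (finpart_sub J)).
have v_out i : i \notin finp J -> v i = 0 by move=> /negbTE iX; rewrite /v iX.
exists v; split=> // i iF; have iJ := FJ i iF.
  rewrite /v iF; apply: (fP _ _).1; last exact: mem_component.
  by exists i.
pose C := component A J i.
have CF j : j \in C -> j \in finp J.
  move=> jC; have := iF; rewrite !inE -(component_eq jC) => /andP[_ ->].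
  by rewrite (subsetP (component_sub J i)).
rewrite (bigID (mem C)) /= [X in _ + X]big1 ?addr0 => [|j jC]; last first.
  have [jF|/v_out->] := boolP (j \in finp J); last by rewrite mulr0.
  have [a|] := eqVneq (A i j) 0; first by rewrite a mul0r.
  move=> a; case/negP: jC.
  by rewrite /C (component_adj iJ (FJ j jF) a) mem_component ?FJ.
have -> : \sum_(j in C) (A i j)%:~R * v j =
          \sum_(j in C) (A i j)%:~R * f C j.
  apply: eq_bigr => j jC; rewrite /v CF //.
  by rewrite (component_eq jC).
by apply: (fP _ _).2; [exists i|apply: mem_component].
Qed.

End Diagram.

(** * Finite Weyl groups *)

Section FiniteType.
Variables (R : realType) (I : finType) (A : gcm I) (D : realization R A).
Implicit Types (J K : {set I}) (n m : I -> R).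

Notation cor := (coroot D).
Notation s_ := (srefl D).
Notation WP := (parabolic D).

(** Two adjacent indices carry factors of the same sign, since [a_ij] and
    [a_ji] are both negative; signs can therefore be moved to the symmetric
    matrix. *)
Lemma symmetrizable_pos : symmetrizable R A ->
  exists (d : I -> R) (b : I -> I -> R), [/\ forall i, 0 < d i,
    forall i j, b i j = b j i & forall i j, (A i j)%:~R = d i * b i j].
Proof.
move=> [d [B [d0 Bs AE]]].
exists (fun i => `|d i|), (fun i j => (A i j)%:~R / `|d i|); split.
- by move=> i; rewrite normr_gt0.
- move=> i j; have [->//|nij] := eqVneq i j.
  have h1 : (A i j)%:~R <= 0 :> R by rewrite lerz0 gcm_offdiag.
  have h2 : (A j i)%:~R <= 0 :> R by rewrite lerz0 gcm_offdiag // eq_sym.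
  move: h1 h2; rewrite !AE (Bs j i) => h1 h2.
  have := d0 i; have := d0 j.
  have [dj|dj|//] := ltrgt0P (d j); have [di|di|//] := ltrgt0P (d i) => _ _.
  - by rewrite !(mulrC (d _)) !mulfK // gt_eqF.
  - have -> : B i j = 0 by nra.
    by rewrite !mulr0 !mul0r.
  - have -> : B i j = 0 by nra.
    by rewrite !mulr0 !mul0r.
  - by rewrite !invrN !mulrN !(mulrC (d _)) !mulfK // lt_eqF.
- by move=> i j; rewrite mulrC divfK // normr_eq0.
Qed.

Lemma finite_lower_bound (g : I -> R) K : (forall i, i \in K -> 0 < g i) ->
  exists2 e, 0 < e & forall i, i \in K -> e <= g i.
Proof.
move=> gK.
suff [e e0 eP] : exists2 e, 0 < e & forall i, i \in enum K -> e <= g i.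
  by exists e => // i; rewrite -mem_enum; apply: eP.
have : forall i, i \in enum K -> 0 < g i by move=> i; rewrite mem_enum;
  apply: gK.
elim: (enum K) => [_|i s IHs gs]; first by exists 1.
have [|e e0 eP] := IHs; first by move=> j js; apply: gs; rewrite inE js orbT.
exists (Num.min e (g i)); first by rewrite lt_min e0 gs ?mem_head.
move=> j; rewrite inE ge_min => /predU1P[->|/eP->//]; by rewrite lexx orbT.
Qed.

Section Form.
Variables (d : I -> R) (b : I -> I -> R).
Hypotheses (d0 : forall i, 0 < d i) (bs : forall i j, b i j = b j i).
Hypothesis (AE : forall i j, (A i j)%:~R = d i * b i j).

(** The square of the coweight with coordinates [n], for the invariant form
    with [(h_i, h_j) = d_i d_j b_ij]. *)
Let form n := \sum_i \sum_j b i j * (d i * n i) * (d j * n j).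

Lemma form_refl n k c : c = \sum_i n i * (A i k)%:~R ->
  form (fun i => n i - c * (i == k)%:R) = form n.
Proof.
move=> cE.
have delta F : \sum_i F i * (c * (i == k)%:R) = F k * c.
  rewrite (bigD1 k) //= eqxx mulr1 big1 ?addr0 // => i /negbTE->.
  by rewrite !mulr0.
have row : \sum_i b k i * (d i * n i) = c.
  by rewrite cE; apply: eq_bigr => i _; rewrite AE bs; ring.
have bkk : d k * b k k = 2 by rewrite -AE gcm_diag.
have E : form (fun i => n i - c * (i == k)%:R) =
  form n - \sum_i \sum_j b i j * (d i * n i) * d j * (c * (j == k)%:R)
  - \sum_i \sum_j b i j * (d j * n j) * d i * (c * (i == k)%:R)
  + \sum_i (\sum_j b i j * d i * d j * (c * (j == k)%:R)) * (c * (i == k)%:R).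
  rewrite /form -!sumrB -big_split /=; apply: eq_bigr => i _.
  rewrite mulr_suml -!sumrB -big_split /=; apply: eq_bigr => j _; ring.
rewrite E.
have -> : \sum_i \sum_j b i j * (d i * n i) * d j * (c * (j == k)%:R) =
          d k * c * c.
  under eq_bigr => i _ do rewrite delta.
  rewrite -!mulr_suml (mulrC (\sum_i _)) -{2}row; congr (_ * _ * _).
  by apply: eq_bigr => i _; rewrite (bs i k).
have -> : \sum_i \sum_j b i j * (d j * n j) * d i * (c * (i == k)%:R) =
          d k * c * c.
  under eq_bigr => i _ do rewrite -mulr_suml.
  rewrite delta -mulr_suml row; ring.
rewrite delta delta.
have -> : b k k * d k * d k * c * c = 2 * (d k * c * c).
  by rewrite -bkk; ring.
by ring.
Qed.

Variables (K : {set I}) (u : I -> R).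
Hypotheses (u0 : forall i, i \in K -> 0 < u i)
  (uK : forall i, i \notin K -> u i = 0)
  (Au : forall i, i \in K -> 0 < \sum_j (A i j)%:~R * u j).

Let bu i := \sum_(j in K) b i j * u j.

Lemma bu_gt0 i : i \in K -> 0 < bu i.
Proof.
move=> iK; rewrite -(pmulr_rgt0 _ (d0 i)) /bu mulr_sumr.
have := Au iK; rewrite (bigID (mem K)) /= [X in _ + X]big1 ?addr0; last first.
  by move=> j /uK->; rewrite mulr0.
by congr (_ < _); apply: eq_bigr => j _; rewrite AE mulrA.
Qed.

(** On a diagram of finite type the form is positive definite. Each
    off-diagonal term is compared with a sum of squares by the inequality
    between arithmetic and geometric means, with the weights given by [u]; what
    remains is a diagonal form with positive coefficients because [A u] is
    positive. *)
Lemma form_ge n : (forall i, i \notin K -> n i = 0) ->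
  \sum_(i in K) bu i / u i * (d i * n i) ^+ 2 <= form n.
Proof.
move=> nK; pose m i := d i * n i.
have -> : form n = \sum_(i in K) \sum_(j in K) b i j * m i * m j.
  rewrite /form (bigID (mem K)) /= [X in _ + X]big1 ?addr0; last first.
    by move=> i /nK->; rewrite big1 // => j _; rewrite mulr0 mulr0 mul0r.
  apply: eq_bigr => i _.
  rewrite (bigID (mem K)) /= [X in _ + X]big1 ?addr0 //.
  by move=> j /nK->; rewrite !mulr0.
pose t i j := b i j * (m i ^+ 2 * (u j / u i)).
have -> : \sum_(i in K) bu i / u i * (d i * n i) ^+ 2 =
          \sum_(i in K) \sum_(j in K) t i j.
  apply: eq_bigr => i _; rewrite /bu -mulrA mulr_suml.
  by apply: eq_bigr => j _; rewrite /t /m; ring.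
have -> : \sum_(i in K) \sum_(j in K) t i j =
          \sum_(i in K) \sum_(j in K) (t i j + t j i) / 2.
  transitivity ((\sum_(i in K) \sum_(j in K) t i j +
                 \sum_(i in K) \sum_(j in K) t j i) / 2).
    by rewrite [X in _ + X]exchange_big /=; field.
  rewrite -big_split /= mulr_suml; apply: eq_bigr => i _.
  by rewrite -big_split /= mulr_suml.
apply: ler_sum => i iK; apply: ler_sum => j jK.
have ui := u0 iK; have uj := u0 jK.
have [<-|nij] := eqVneq i j.
  by rewrite /t divff ?gt_eqF // mulr1 expr2; lra.
have bij : b i j <= 0.
  by rewrite -(pmulr_rle0 _ (d0 i)) -AE lerz0 gcm_offdiag.
rewrite /t (bs j i) -subr_ge0.
have -> : b i j * m i * m j - (b i j * (m i ^+ 2 * (u j / u i)) +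
            b i j * (m j ^+ 2 * (u i / u j))) / 2
        = - b i j / (2 * (u i * u j)) * (m i * u j - m j * u i) ^+ 2.
  by field; rewrite !gt_eqF.
by rewrite mulr_ge0 ?sqr_ge0 // divr_ge0 ?oppr_ge0 // mulr_ge0 // mulr_ge0 ?ltW.
Qed.

(** Let [h0] be a coweight, supported on the diagram, with positive pairing
    with the simple roots of the diagram. Along a reduced word [w h0] loses
    height at each step by at least a fixed amount, whereas its height is
    bounded below since [w h0] has the same square as [h0]. *)
Lemma len_bounded : exists N : nat, forall w, WP K w -> (len w <= N)%N.
Proof.
pose n0 i := u i / d i.
pose h0 := \sum_i n0 i *: cor i.
have rh0 j : j \in K -> 0 < pair (sroot D j) h0.
  move=> jK; rewrite -(pmulr_rgt0 _ (d0 j)) /h0 pair_sumr mulr_sumr.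
  have := Au jK; congr (_ < _); apply: eq_bigr => i _.
  by rewrite pairZr pair_root !AE /n0 bs; field; rewrite gt_eqF.
have [kap kapE] := @weight_exists _ _ _ D (fun=> 1).
have [e e0 eP] := finite_lower_bound rh0.
have orbit w : WP K w -> exists n, [/\ forall i, i \notin K -> n i = 0,
    hact w h0 = \sum_i n i *: cor i & form n = form n0].
  elim/(@par_ind _ _ _ D K) => [|v k _ kK [n [nK nE fE]]].
    by exists n0; split; rewrite ?hact1 // => i iK; rewrite /n0 uK // mul0r.
  pose c := \sum_i n i * (A i k)%:~R.
  exists (fun i => n i - c * (i == k)%:R); split.
  - move=> i iK; rewrite nK //; case: eqP => [E|]; last by rewrite mulr0 subr0.
    by rewrite E kK in iK.
  - rewrite hactM hact_srefl nE.
    under [RHS]eq_bigr do rewrite scalerBl -scalerA.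
    rewrite sumrB -scaler_sumr -comb_delta; congr (_ - _ *: _).
    by rewrite pair_sumr; apply: eq_bigr => i _; rewrite pairZr pair_root.
  - by rewrite form_refl.
pose S := \sum_(i in K) (form n0 / (bu i / u i) / d i ^+ 2 + 1).
have low w : WP K w -> - S <= pair kap (hact w h0).
  move=> /orbit[n [nK -> fE]]; rewrite pair_sumr.
  under eq_bigr do rewrite pairZr kapE mulr1.
  rewrite (bigID (mem K)) /= [X in _ + X]big1 ?addr0; last by move=> i /nK.
  rewrite /S -sumrN; apply: ler_sum => i iK.
  set q := bu i / u i.
  have q0 : 0 < q by rewrite divr_gt0 ?bu_gt0 ?u0.
  have le : q * (d i * n i) ^+ 2 <= form n0.
    rewrite -fE; apply: le_trans (form_ge nK).
    rewrite (bigD1 i) //= lerDl sumr_ge0 // => j /andP[jK _].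
    by rewrite mulr_ge0 ?sqr_ge0 // divr_ge0 // ltW ?bu_gt0 ?u0.
  have le2 : (n i) ^+ 2 <= form n0 / q / d i ^+ 2.
    rewrite ler_pdivlMr ?exprn_gt0 // ler_pdivlMr //.
    by apply: le_trans le; rewrite exprMn le_eqVlt; apply/orP; left; apply/eqP;
      ring.
  nra.
have up w : WP K w -> pair kap (hact w h0) + e * (len w)%:R <= pair kap h0.
  elim/(@par_len_ind _ _ _ D K) => [|v i vK iK p IHv].
    by rewrite hact1 len1 mulr0 addr0.
  rewrite hactM hact_srefl hactD hactN hactZ pairDr pairNr pairZr.
  have ge1 : 1 <= pair kap (hact v (cor i)).
    have [n nE] := p; rewrite nE pair_sumr.
    under eq_bigr do rewrite pairZr kapE mulr1.
    rewrite -natr_sum ler1n lt0n; apply/negP => /eqP/eqP; rewrite sum_nat_eq0.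
    move=> /forallP n00; have /eqP[] := @act_e_neq0 _ _ _ _ (coroot_rep D) v i.
    rewrite /= nE big1 // => j _.
    by have /eqP-> := implyP (n00 j) isT; rewrite scale0r.
  have le := eP i iK.
  have lelen : (len (v * s_ i)%g)%:R <= (len v)%:R + 1 :> R.
    by rewrite natr1 ler_nat len_mul_srefl.
  have h1 : e <= pair (sroot D i) h0 * pair kap (hact v (cor i)).
    by apply: le_trans le _; rewrite ler_peMr // ltW // rh0.
  have h2 : e * (len (v * s_ i)%g)%:R <= e * ((len v)%:R + 1).
    by rewrite ler_pM2l.
  by move: IHv h1 h2; rewrite mulrDr; lra.
pose x := (pair kap h0 + S) / e.
exists (Num.bound `|x|) => w wK.
rewrite -(ler_nat R); apply: le_trans (ltW (archi_boundP (normr_ge0 x))).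
apply: le_trans (ler_norm x); rewrite /x ler_pdivlMr // mulrC.
by have := up w wK; have := low w wK; lra.
Qed.

End Form.

(** An element of greatest length makes all positive coroots of the diagram
    negative. They are therefore finitely many, and reflecting a weight towards
    the chamber of the diagram terminates. *)
Lemma finpart_Kdom J l : symmetrizable R A ->
  exists2 a, WP (finpart R A J) a & Kdom (finpart R A J) (@weyl_act R I A D a
    l).
Proof.
move=> /symmetrizable_pos[d [b [d0 bs AE]]].
have [u [u0 uK Au]] := finpart_vector R A J.
set K := finpart R A J in u0 uK Au *.
have [N leN] := len_bounded d0 bs AE u0 uK Au.
pose Q (k : nat) := `[< exists2 w, WP K w & len w = k >].
have exQ : exists k, Q k.
  by exists 0%N; apply/asboolP; exists 1%g; [exact: par1|exact: len1].
have leQ (k : nat) : Q k -> (k <= N)%N by move=> /asboolP[w /leN wN <-].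
case: (ex_maxnP exQ leQ) => n /asboolP[w0 w0K lenw0] nmax.
have neg i : i \in K -> hpos (- hact w0 (cor i)).
  move=> iK; apply: hposN => /hposP; rewrite ltnNge => /negP; apply.
  rewrite lenw0; apply: nmax; apply/asboolP; exists (w0 * s_ i)%g => //.
  by apply: parM => //; exact: par_srefl.
have [s sP] := inversions_finite w0.
apply: (@Kdom_exists _ _ _ _ K l s) => v i vK iK p _; apply: sP => // q.
apply: hpos_anti q _; have [c cE] := p.
have c0 := natcomb_supp (supp_in_hact vK (supp_in_cor D iK)) cE.
rewrite hactM cE hact_sum -sumrN; elim/big_ind: _ => [||j _].
- exact: natcomb0.
- by move=> x y; apply: natcombD.
rewrite hactZ -scalerN; have [jK|/c0->] := boolP (j \in K).
  by apply: natcombZ; apply: neg.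
by rewrite scale0r; exact: natcomb0.
Qed.

End FiniteType.

(** * Faces of the Tits cone *)

Section FacesOfTitsCone.
Variables (R : realType) (I : finType) (A : gcm I) (D : realization R A).
Implicit Types (v w a : weyl D) (l m n : dual D) (h : cartan D).
Implicit Types (J K X : {set I}) (F G : set (dual D)).

Notation cor := (coroot D).
Notation s_ := (srefl D).
Notation WP := (parabolic D).
Notation infp := (infpart R A).
Notation finp := (finpart R A).
Notation std := (@std_face_set R I A D).

(** Each letter of a reduced word in [K] adds a nonnegative multiple of a
    positive coroot. *)
Lemma hpos_sub_act K w h : WP K w ->
  (forall j, j \in K -> pair (sroot D j) h <= 0) ->
  exists c : I -> R, [/\ forall i, 0 <= c i, forall i, i \notin K -> c i = 0 &
    hact w h = h + \sum_i c i *: cor i].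
Proof.
move=> wK hK; elim/(@par_len_ind _ _ _ D K): wK => [|v i vK iK [n nE] [c [c0 cK
  cE]]].
  exists (fun=> 0); split=> //; rewrite hact1 big1 ?addr0 // => i _.
  by rewrite scale0r.
have n0 := natcomb_supp (supp_in_hact vK (supp_in_cor D iK)) nE.
exists (fun j => c j + (- pair (sroot D i) h) * (n j)%:R); split.
- by move=> j; rewrite addr_ge0 // mulr_ge0 // oppr_ge0 hK.
- by move=> j jK; rewrite cK // n0 // mulr0 addr0.
rewrite hactM hact_srefl hactD hactN hactZ cE nE -scaleNr -addrA; congr (_ + _).
rewrite scaler_sumr -big_split; apply: eq_bigr => j _ /=.
by rewrite scalerDl scalerA.
Qed.

(** For [X] special there is an antidominant positive combination of the
    coroots in [X]. It is nonnegative on the Tits cone and vanishes there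
    exactly on the face of type [X]; [fcw_lt0] is strict because such an index
    has a neighbour in [X]. *)
Record face_coweight X h : Prop := FaceCoweight {
  fcw_le0 : forall j, pair (sroot D j) h <= 0;
  fcw_lt0 : forall j, j \notin X -> j \notin perp A X -> pair (sroot D j) h < 0;
  fcw_ge0 : forall l, Kdom X l -> 0 <= pair l h;
  fcw_eq0 : forall l, Kdom X l -> pair l h = 0 ->
    forall i, i \in X -> pair l (cor i) = 0;
  fcw_std : forall l, (forall i, i \in X -> pair l (cor i) = 0) -> pair l h = 0
    }.

Lemma face_coweight_exists X : special R A X -> exists h, face_coweight X h.
Proof.
move=> /special_vector[v [v0 vX vA]].
exists (\sum_i v i *: cor i).
have E l : pair l (\sum_i v i *: cor i) = \sum_i v i * pair l (cor i).
  by rewrite pair_sumr; apply: eq_bigr => i _; rewrite pairZr.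
have rE j : pair (sroot D j) (\sum_i v i *: cor i) =
    \sum_i v i * (A i j)%:~R.
  by rewrite E; apply: eq_bigr => i _; rewrite pair_root.
have ge l i : Kdom X l -> 0 <= v i * pair l (cor i).
  move=> lX; have [iX|/vX->] := boolP (i \in X); last by rewrite mul0r.
  by rewrite mulr_ge0 ?lX // ltW // v0.
split=> [j|j jX jp|l lX|l lX|l l0].
- by rewrite rE vA.
- have [i iX Aji] : exists2 i, i \in X & A j i != 0.
    apply: contrapT => h; case/negP: jp; apply/perpP => i iX.
    by apply/eqP/negPn/negP => a; apply: h; exists i.
  have out i' : i' \in X -> A i' j <= 0.
    by move=> iX'; rewrite gcm_offdiag //; apply: contraNneq jX => <-.
  rewrite rE (bigD1 i) //= ltr_wnDr //.
    apply: sumr_le0 => k _; have [kX|/vX->] := boolP (k \in X);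
      last by rewrite mul0r.
    by rewrite mulr_ge0_le0 ?(ltW (v0 _ kX)) // lerz0 out.
  rewrite pmulr_rlt0 ?v0 // ltrz0 lt_neqAle out // andbT.
  exact: gcm_neq0.
- by rewrite E sumr_ge0 // => i _; apply: ge.
- rewrite E => /eqP; rewrite psumr_eq0 => [/allP h i iX|i _]; last exact: ge.
  have := h i (mem_index_enum i); rewrite /= mulf_eq0 gt_eqF ?v0 //=.
  by move/eqP.
- by rewrite E big1 // => i _; have [/l0->|/vX->] := boolP (i \in X);
  rewrite ?mulr0 ?mul0r.
Qed.

Lemma std_tits X l : std X l -> tits_cone l. Proof. by case. Qed.
Lemma stdP X l : std X l -> forall i, i \in X -> pair l (cor i) = 0.
Proof. by case. Qed.

Lemma tits_coneV w l : tits_cone (weyl_act w l) -> tits_cone l.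
Proof. by move=> /(tits_cone_act (w^-1)%g); rewrite weyl_actK. Qed.

(** The point is moved by [W_X] to one that is dominant on [X]; this can only
    decrease the value of the antidominant coweight. If the value is zero, the
    dominant point vanishes on [X], and so it has not been moved. *)
Lemma face_coweight_cone X h l : face_coweight X h -> tits_cone l ->
  0 <= pair l h /\ (pair l h = 0 -> std X l).
Proof.
move=> hX tl; have [a aX al] := tits_cone_Kdom X tl.
have [c [c0 cX cE]] := hpos_sub_act aX (fun j _ => fcw_le0 hX j).
have lE : pair l h = pair (weyl_act a l) h
    + \sum_i c i * pair (weyl_act a l) (cor i).
  rewrite -(pair_act a) cE pairDr pair_sumr.
  by congr (_ + _); apply: eq_bigr => i _; rewrite pairZr.
have s0 : 0 <= \sum_i c i * pair (weyl_act a l) (cor i).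
  apply: sumr_ge0 => i _; have [iX|/cX->] := boolP (i \in X);
    last by rewrite mul0r.
  by rewrite mulr_ge0 // al.
have h0 := fcw_ge0 hX al.
rewrite lE; split; first exact: addr_ge0.
move=> /eqP; rewrite paddr_eq0 // => /andP[/eqP/(fcw_eq0 hX al) a0 _].
split=> //; have := par_fix a0 (parV aX); rewrite weyl_actK => E i iX.
by rewrite -/(pair l _) E a0.
Qed.

Lemma std_is_face X : special R A X -> is_face (std X).
Proof.
move=> /face_coweight_exists[h hX]; split.
- by move=> l [].
- exists 0; split; first exact: tits_cone0.
  by move=> i _; apply: pair0l.
- move=> x y t [_ x0] [_ y0] _ z zX; split=> // i iX.
  have xi : pair x (cor i) = 0 := x0 i iX.
  have yi : pair y (cor i) = 0 := y0 i iX.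
  by rewrite -/(pair _ _) pairDl !pairZl xi yi !mulr0 addr0.
- move=> x y t tx ty /andP[t0 t1] /stdP/(fcw_std hX).
  have [x0 xs] := face_coweight_cone hX tx.
  have [y0 ys] := face_coweight_cone hX ty.
  rewrite pairDl !pairZl => E; have t1' : 0 < 1 - t by rewrite subr_gt0.
  by split; [apply: xs|apply: ys]; nra.
Qed.

Lemma std_faceE X : special R A X -> (std_face D X : set (dual D)) = std X.
Proof.
by move=> Xs; rewrite /std_face insubdK //; apply/asboolP/std_is_face.
Qed.

Lemma std_act J w l : (forall i, i \in J -> hact w (cor i) = cor i) ->
  std J l -> std J (weyl_act w l).
Proof.
move=> wJ [tl l0]; split; first exact: tits_cone_act.
move=> i iJ; rewrite -/(pair _ _) -(wJ i iJ) pair_act; exact: l0.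
Qed.

Lemma perp_act_cor X a i : WP (perp A X) a -> i \in X -> hact a (cor i) = cor i.
Proof.
move=> aX iX; elim/(@par_ind _ _ _ D (perp A X)): aX => [|v k _ kX IHv].
  exact: hact1.
by rewrite hactM IHv hact_srefl pair_root (perp_sym kX iX) scale0r subr0.
Qed.

Lemma par_act_perp_cor X a i : WP X a -> i \in perp A X -> hact a (cor i) = cor
  i.
Proof.
move=> aX iX; elim/(@par_ind _ _ _ D X): aX => [|v k _ kX IHv].
  exact: hact1.
by rewrite hactM IHv hact_srefl pair_root (perpP _ _ _ iX) // scale0r subr0.
Qed.

Lemma std_perp_act X a l : WP (perp A X) a -> std X l -> std X (weyl_act a l).
Proof. by move=> aX; apply: std_act => i; apply: perp_act_cor. Qed.

(** It suffices to be dominant on the indices orthogonal to [X]: at an index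
    that is neither in [X] nor orthogonal to it, the reflection of a point with
    a negative value would be a point of the Tits cone on which the face
    coweight is negative. *)
Lemma std_dominant X l : special R A X -> std X l ->
  exists a, [/\ WP (perp A X) a, dominant (weyl_act a l) & std X (weyl_act a
    l)].
Proof.
move=> Xs lX; have [h hX] := face_coweight_exists Xs.
have [a aX al] := tits_cone_Kdom (perp A X) (std_tits lX).
exists a; split=> //; last exact: std_perp_act.
have [ta a0] := std_perp_act aX lX.
move=> i; rewrite -/(pair _ _).
have [iX|iX] := boolP (i \in X); first by rewrite [pair _ _]a0.
have [ip|ip] := boolP (i \in perp A X); first exact: al.
have [] := face_coweight_cone hX (tits_cone_act (s_ i) ta).
rewrite srefl_actE pairDl pairNl pairZl (fcw_std hX a0) sub0r => + _.
have := fcw_lt0 hX iX ip; nra.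
Qed.

Definition span_face l : set (dual D) :=
  [set n | forall F, is_face F -> F l -> F n]%classic.

Lemma span_face_self l : span_face l l. Proof. by move=> F. Qed.

Lemma span_face_min l F : is_face F -> F l -> (span_face l `<=` F)%classic.
Proof. by move=> fF Fl n; apply. Qed.

Lemma span_face_is_face l : tits_cone l -> is_face (span_face l).
Proof.
move=> tl; split.
- by move=> n; apply=> //; apply: tits_cone_is_face.
- by exists l; apply: span_face_self.
- move=> x y t fx fy t01 z tz F fF Fl; have [_ _ c _] := fF.
  by apply: c => //; [apply: fx|apply: fy].
- move=> x y t tx ty t01 fz; split=> F fF Fl; have [_ _ _ e] := fF.
    by have [] := e x y t tx ty t01 (fz F fF Fl).
  by have [] := e x y t tx ty t01 (fz F fF Fl).
Qed.

Lemma is_face_preimage w F : is_face F -> is_face (weyl_act w @^-1` F)%classic.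
Proof. by move=> /(is_face_act (w^-1)%g); rewrite act_imageE invgK. Qed.

Lemma span_face_act w l n :
  span_face (weyl_act w l) (weyl_act w n) <-> span_face l n.
Proof.
split=> h F fF Fl; last by apply: (h _ (is_face_preimage w fF)).
have := h _ (is_face_preimage (w^-1)%g fF).
by rewrite /preimage /= !weyl_actK; apply.
Qed.

Hypothesis hA : symmetrizable R A.

(** To see that every point [n] of the face of type [J^oo] is in every face
    containing [m], the segment from [n] to [m] is continued beyond [m] inside
    the Tits cone. The values on the coroots outside [J] stay positive for a
    while, those on [J^oo] stay zero, and the finite Weyl group of [J^0] makes
    the remaining ones nonnegative; it fixes [m]. *)
Lemma span_face_dominant m : dominant m ->
  span_face m = std (infp (zeros m)).
Proof.
move=> md; set J := zeros m; apply/seteqP; split.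
  apply: span_face_min; first exact/std_is_face/special_infpart.
  split; first exact: dominant_tits.
  by move=> i /(subsetP (infpart_sub R A J))/zerosP.
move=> n [tn n0] F fF Fm.
have [a aK adom] := finpart_Kdom J (- n) hA.
have JF i : i \in J -> i \notin infp J -> i \in finp J.
  by move=> /(@finpart_or_infpart R _ A) /orP[->//|->].
have m0 i : i \in J -> pair m (cor i) = 0 by move=> /zerosP.
have mF i : i \in finp J -> pair m (cor i) = 0.
  by move=> /(subsetP (finpart_sub R A J)); apply: m0.
have am := par_fix mF aK.
have an0 i : i \in infp J -> pair (weyl_act a n) (cor i) = 0.
  move=> iI; rewrite pair_hactV (@perp_act_cor (infp J)) //; first exact: n0.
  apply: parS (parV aK); apply/subsetP => j; exact: finpart_perp.
(* how far the segment can be continued beyond m *)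
have [|e e0 eP] := @finite_lower_bound R I
   (fun i => pair m (cor i) / (`|pair (weyl_act a n) (cor i)| + 1)) (~: J).
  move=> i; rewrite inE => iJ; rewrite divr_gt0 ?ltr_wpDl //.
  by rewrite lt_def md andbT; apply: contraNneq iJ => E; apply/zerosP.
pose l := (1 + e) *: m - e *: n.
have tl : tits_cone l.
  apply: (@tits_coneV a); apply: dominant_tits => i; rewrite -/(pair _ _).
  rewrite /l weyl_actD -scaleNr !weyl_actZ am pairDl !pairZl.
  have [iJ|iJ] := boolP (i \in J).
    rewrite m0 // mulr0 add0r; have [iI|iI] := boolP (i \in infp J).
      by rewrite an0 // mulr0.
    rewrite mulNr -mulrN -pairNl -scaleN1r -weyl_actZ scaleN1r.
    by rewrite mulr_ge0 ?(ltW e0) // adom // JF.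
  have := eP i; rewrite inE iJ ler_pdivlMr ?ltr_wpDl // => /(_ isT) h.
  have h2 := ler_norm (pair (weyl_act a n) (cor i)).
  have h3 := md i; rewrite -/(pair _ _) in h3.
  nra.
(* m divides the segment from n to l in the ratio 1 : e *)
have t01 : 0 < (1 + e)^-1 < 1 by rewrite invr_gt0 addr_gt0 // invf_lt1
  ?addr_gt0 // ltrDl.
have [_ _ _ ext] := fF.
have [] // := ext n l (1 + e)^-1 tn tl t01.
suff -> : (1 - (1 + e)^-1) *: n + (1 + e)^-1 *: l = m by [].
have e1 : 1 + e != 0 by rewrite gt_eqF // addr_gt0.
rewrite /l scalerBr !scalerA mulVf // scale1r addrCA -scalerBl.
have -> : 1 - (1 + e)^-1 - (1 + e)^-1 * e = 0 by field.
by rewrite scale0r addr0.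
Qed.

End FacesOfTitsCone.

(** * Projection of facets to a smaller face *)

Section Projection.
Variables (R : realType) (I : finType) (A : gcm I) (D : realization R A).
Implicit Types (v w a : weyl D) (l m n : dual D) (h : cartan D).
Implicit Types (J K X Y : {set I}) (F G S : set (dual D)).

Notation cor := (coroot D).
Notation s_ := (srefl D).
Notation WP := (parabolic D).
Notation infp := (infpart R A).
Notation std := (@std_face_set R I A D).

Lemma std_supp X h : hpos h \/ hpos (- h) ->
  (forall l, std X l -> pair l h = 0) -> supp_in X h.
Proof.
move=> hp h0.
have [c cE] : exists c : I -> R, h = \sum_i c i *: cor i.
  case: hp => -[n nE]; first by exists (fun i => (n i)%:R).
  exists (fun i => - (n i)%:R); rewrite -[h]opprK nE -sumrN.
  by apply: eq_bigr => i _; rewrite scaleNr.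
exists c; split=> // j jX.
have [m mE] := @weight_exists _ _ _ D (fun i => (i == j)%:R).
have mX : std X m.
  split; first by apply: dominant_tits => i; rewrite -/(pair _ _) mE.
  by move=> i iX; rewrite -/(pair _ _) mE; case: eqP => // ij;
    rewrite -ij iX in jX.
have := h0 m mX; rewrite cE pair_sumr (bigD1 j) //= pairZr mE eqxx mulr1.
rewrite big1 ?addr0 // => i /negbTE nij.
by rewrite pairZr mE nij mulr0.
Qed.

Lemma free_hact w Y : free [seq hact w (cor i) | i in Y].
Proof.
have sz : size [seq hact w (cor i) | i in Y] == #|Y| by rewrite size_map -cardE.
suff : free (Tuple sz) by [].
apply/freeP => k k0 p; have pY := enum_valP p.
pose c i := if i \in Y then k (enum_rank_in pY i) else 0.
have c0 : \sum_i c i *: cor i = 0.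
  rewrite -(hactK w (\sum_i _)) hact_sum (_ : \sum_i _ = 0) ?hact0 //.
  rewrite -[RHS]k0 (bigID (mem Y)) /= [X in _ + X]big1 ?addr0; last first.
    by move=> i /negbTE iY; rewrite /c iY scale0r hact0.
  rewrite big_enum_val; apply: eq_bigr => q _.
  rewrite /c enum_valP enum_valK_in hactZ; congr (_ *: _).
  rewrite (nth_map (enum_val q)) -?cardE //.
  by rewrite -enum_val_nth.
by have := comb_eq0 (@coroot_free R I A D) c0 (enum_val p);
  rewrite /c enum_valP enum_valK_in.
Qed.

(** Either side is the space of coweights that vanish on one of the faces. *)
Lemma std_span_sub X Y w : (forall l, std X l -> std Y (weyl_act w l)) ->
  (<<[seq hact (w^-1)%g (cor i) | i in Y]>> <= <<[seq cor i | i in X]>>)%VS.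
Proof.
move=> sub; apply/span_subvP => x /mapP[i]; rewrite mem_enum => iY ->.
have [||c [cX cE]] := @std_supp X (hact (w^-1)%g (cor i)).
- have [p|/hposN q] := pselect (hpos (hact (w^-1)%g (cor i)));
  [by left|by right].
- by move=> n /sub nY; rewrite -pair_hactV; apply: stdP nY _ iY.
rewrite cE; apply: memv_suml => j _.
have [jX|/cX->] := boolP (j \in X); last by rewrite scale0r mem0v.
by apply: memvZ; apply: memv_span; apply: map_f; rewrite mem_enum.
Qed.

Lemma std_card X Y w : (forall l, std X l -> std Y (weyl_act w l)) ->
  (#|Y| <= #|X|)%N.
Proof.
move=> /std_span_sub /dimvS; have /eqP -> := free_hact (w^-1)%g Y.
rewrite size_map -cardE => /leq_trans; apply.
by apply: leq_trans (dim_span _) _; rewrite size_map -cardE.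
Qed.

(** Translates of standard faces of the same rank are comparable only if they
    are equal, because they span subspaces of the same dimension. *)
Lemma std_rank X Y w : (#|X| <= #|Y|)%N ->
  (forall l, std X l -> std Y (weyl_act w l)) ->
  forall l, std Y (weyl_act w l) -> std X l.
Proof.
move=> leXY /std_span_sub UV l [tl l0]; split; first exact: tits_coneV tl.
set U := <<_>>%VS in UV; set V := <<_>>%VS in UV.
have VU : (V == U)%VS.
  rewrite eq_sym eqEdim UV /=; apply: leq_trans (dim_span _) _.
  have /eqP -> := free_hact (w^-1)%g Y.
  by rewrite !size_map -!cardE.
have Ul : (U <= lker l)%VS.
  apply/span_subvP => x /mapP[i]; rewrite mem_enum => iY ->.
  by rewrite memv_ker -/(pair _ _) -pair_hactV; apply/eqP; apply: l0.
move=> i iX; suff : cor i \in lker l by rewrite memv_ker => /eqP.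
apply: (subvP Ul).
by rewrite -(eqP VU); apply: memv_span; apply: map_f; rewrite mem_enum.
Qed.

Lemma titsP l : tits_cone l -> exists w m, dominant m /\ l = weyl_act w m.
Proof. by move=> [w _ [m md <-]]; exists w, m. Qed.

Lemma mem_act w S l : (weyl_act w @` S)%classic (weyl_act w l) <-> S l.
Proof. by rewrite act_imageE /preimage /= weyl_actK. Qed.

Lemma mem_actV w S l : (weyl_act w @` S)%classic l <-> S (weyl_act (w^-1)%g l).
Proof. by rewrite act_imageE. Qed.

Hypothesis hA : symmetrizable R A.

Lemma half01 : 0 < (2^-1 : R) < 1.
Proof. by rewrite invr_gt0 ltr0n invf_lt1 ?ltr1n ?ltr0n. Qed.

(** A point of the face on which the fewest independent coroots of infinite
    type vanish lies in the relative interior: the midpoint to any other point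
    of the face spans a face that contains the face of the given point and has
    no larger dimension. *)
Lemma face_classification F : is_face F ->
  exists w X, special R A X /\ F = (weyl_act w @` std X)%classic.
Proof.
move=> fF; have [FX [p Fp] Fc Fe] := fF.
pose Q k := `[< exists w m, [/\ dominant m, F (weyl_act w m) &
                              #|infp (zeros m)| = k] >].
have exQ : exists k, Q k.
  have [w [m [md pE]]] := titsP (FX p Fp).
  exists #|infp (zeros m)|; apply/asboolP; exists w, m.
  by split=> //; rewrite -pE.
case: (ex_minnP exQ) => k /asboolP[w [m [md Fm kE]]] kmin.
set X := infp (zeros m) in kE.
exists w, X; split; first exact: special_infpart.
apply/seteqP; split=> n; last first.
  move=> [l lX <-]; apply: (span_face_min fF Fm).
  by apply: (span_face_act w m l).2; rewrite (span_face_dominant hA md).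
move=> Fn; apply/mem_actV.
pose z := (1 - 2^-1) *: weyl_act w m + 2^-1 *: n.
have t01 := half01; have t01' : 0 <= (2^-1 : R) <= 1.
  by case/andP: t01 => /ltW-> /ltW->.
have tz : tits_cone z by apply: tits_cone_convex => //; apply: FX.
have Fz : F z by apply: Fc.
have [u [m' [md' zE]]] := titsP tz.
have lek : (k <= #|infp (zeros m')|)%N.
  by apply: kmin; apply/asboolP; exists u, m'; split=> //; rewrite -zE.
have fz := span_face_is_face tz; have [_ _ _ ez] := fz.
have [zm zn] := ez _ _ _ (FX _ Fm) (FX _ Fn) t01 (span_face_self (l := z)).
have zE' l : span_face z l <-> std (infp (zeros m')) (weyl_act (u^-1)%g l).
  have := span_face_act u m' (weyl_act (u^-1)%g l).
  by rewrite weyl_actVK -zE (span_face_dominant hA md').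
apply: (@std_rank X (infp (zeros m')) (u^-1 * w)%g); first by rewrite kE.
  move=> l lX; rewrite weyl_actM; apply: (zE' _).1.
  apply: (span_face_min fz zm).
  by apply: (span_face_act w m l).2; rewrite (span_face_dominant hA md).
by rewrite weyl_actM weyl_actVK; apply: (zE' _).1.
Qed.

Definition straddles S h :=
  (exists2 l, S l & pair l h < 0) /\ (exists2 l, S l & 0 < pair l h).

Lemma straddlesN S h : straddles S h -> straddles S (- h).
Proof.
move=> [[l lS l0] [m mS m0]]; split; [exists m|exists l] => //.
  by rewrite pairNr oppr_lt0.
by rewrite pairNr oppr_gt0.
Qed.

Lemma straddlesS S G h : (S `<=` G)%classic -> straddles S h -> straddles G h.
Proof.
by move=> SG [[l lS l0] [m mS m0]]; split; [exists l|exists m] => //; apply: SG.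
Qed.

Lemma straddles_act w S h :
  straddles (weyl_act w @` S)%classic (hact w h) <-> straddles S h.
Proof.
split=> -[[l lS l0] [m mS m0]].
  by split; [exists (weyl_act (w^-1)%g l)|exists (weyl_act (w^-1)%g m)];
    by [apply: (mem_actV _ _ _).1 | rewrite -pair_hact].
by split; [exists (weyl_act w l)|exists (weyl_act w m)];
  by [apply: (mem_act _ _ _).2 | rewrite pair_act].
Qed.

(** If the value is negative at a point of the face that becomes dominant after
    application of an element of the orthogonal subgroup, then this element
    makes the coroot negative. *)
Lemma straddle_std X v i : special R A X -> hpos (hact v (cor i)) ->
  straddles (std X) (hact v (cor i)) ->
  exists b k, [/\ WP (perp A X) b, k \in perp A X &
                  hact v (cor i) = hact b (cor k)].
Proof.
move=> Xs p [[l lX l0] _]; have [a [aX ad _]] := std_dominant Xs lX.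
apply: (par_inversion aX p) => q.
by move: l0; rewrite -(pair_act a) -hactM ltNge dominant_pair.
Qed.

(** For a standard face the coroot belongs to the orthogonal subgroup, whose
    elements preserve the face. *)
Lemma straddle_refl F v i : is_face F -> straddles F (hact v (cor i)) ->
  forall l, F l -> F (weyl_act (v * s_ i * v^-1)%g l).
Proof.
move=> /face_classification[w [X [Xs ->]]] st l /mem_actV lX; apply/mem_actV.
have {}st : straddles (std X) (hact (w^-1 * v)%g (cor i)).
  by apply/(straddles_act w); rewrite -hactM mulgA mulgV mul1g.
suff key u : hpos (hact u (cor i)) -> straddles (std X) (hact u (cor i)) ->
    forall n, std X n -> std X (weyl_act (u * s_ i * u^-1)%g n).
  rewrite -weyl_actM.
  have -> : (w^-1 * (v * s_ i * v^-1) = (w^-1 * v) * s_ i * (w^-1 * v)^-1 *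
    w^-1)%g.
    by rewrite invgM invgK !mulgA -!(mulgA _ w) mulgV mulg1.
  rewrite weyl_actM.
  have [p|/hposN p] := pselect (hpos (hact (w^-1 * v)%g (cor i)));
    first exact: key.
  have := key (w^-1 * v * s_ i)%g; rewrite hact_mul_srefl.
  move=> /(_ p (straddlesN st) _ lX).
  by rewrite invgM sreflV !mulgA mulg_sreflK.
move=> p {}st n nX; have [b [k [bX kX E]]] := straddle_std Xs p st.
have : hact (b^-1 * u)%g (cor i) = cor k by rewrite hactM E hactK.
move=> /srefl_conj E'.
have -> : (u * s_ i * u^-1 = b * s_ k * b^-1)%g.
  have -> : (u * s_ i = b * (b^-1 * u * s_ i))%g by rewrite !mulgA mulgV mul1g.
  by rewrite E' !mulgA -(mulgA _ u) mulgV mulg1.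
apply: std_perp_act nX; apply: parM (parV bX); apply: parM => //.
exact: par_srefl.
Qed.

(** [projects S l m]: [m] lies in the relative interior of the face [S], on the
    same side as [l] of every hyperplane that crosses [S]. *)
Definition projects S l m := span_face m = S /\ forall v i,
  straddles S (hact v (cor i)) ->
  (0 <= pair m (hact v (cor i))) = (0 <= pair l (hact v (cor i))).

Lemma span_face_actE w l :
  span_face (weyl_act w l) = (weyl_act w @` span_face l)%classic.
Proof.
apply/seteqP; split=> n.
  by rewrite -{1}(weyl_actVK w n) => /span_face_act h; apply/mem_actV.
by move=> /mem_actV h; rewrite -(weyl_actVK w n); apply/span_face_act.
Qed.

Lemma projects_act w S l m : projects S l m ->
  projects (weyl_act w @` S)%classic (weyl_act w l) (weyl_act w m).
Proof.
move=> [mS sg]; split; first by rewrite span_face_actE mS.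
move=> v i st; have E : hact v (cor i) = hact w (hact (w^-1 * v)%g (cor i)).
  by rewrite -hactM mulgA mulgV mul1g.
rewrite E !pair_act; apply: sg; apply/(straddles_act w).
by rewrite -E.
Qed.

(** The right hand side depends on the zeros of [l] in [K] only. *)
Lemma pair_eq0_supp K l h (c : I -> nat) : Kdom K l ->
  (forall i, i \notin K -> c i = 0%N) -> h = \sum_i (c i)%:R *: cor i ->
  pair l h = 0 <-> forall i, i \in K -> c i = 0%N \/ pair l (cor i) = 0.
Proof.
move=> lK cK ->; have E : pair l (\sum_i (c i)%:R *: cor i) =
    \sum_i (c i)%:R * pair l (cor i).
  by rewrite pair_sumr; apply: eq_bigr => i _; rewrite pairZr.
rewrite E; split=> [/eqP|h0].
  rewrite psumr_eq0 => [/allP z i iK|i _]; last first.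
    by have [/lK ?|/cK->] := boolP (i \in K); [rewrite mulr_ge0|rewrite mul0r].
  have := z i (mem_index_enum i); rewrite /= mulf_eq0 pnatr_eq0.
  by move=> /orP[/eqP|/eqP]; [left|right].
apply: big1 => i _; have [/h0[->|->]|/cK->] := boolP (i \in K).
all: by rewrite ?mul0r ?mulr0.
Qed.

(** The indices orthogonal to [X] at which [l] vanishes form a diagram of
    finite type. Otherwise [l] lies in a face of type [Y] with [Y] nonempty and
    orthogonal to [X], and so does the face of type [X]; but generic points of
    the latter are positive on [Y]. Hence [m] spans the face of type [X]. The
    coroots that cross this face belong to the orthogonal subgroup, on whose
    simple coroots [l] and [m] have the same signs. *)
Lemma projects_std X l m : special R A X -> tits_cone l ->
  (std X `<=` span_face l)%classic -> Kdom (perp A X) l -> dominant m ->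
  zeros m = X :|: (perp A X :&: zeros l) -> projects (std X) l m.
Proof.
move=> Xs tl Xl lK md mz.
have fin : infp (perp A X :&: zeros l) = set0.
  apply/setP => i; rewrite in_set0; apply/negP => iI.
  set Y := infp _ in iI.
  have Yl : std Y l.
    split=> // j /(subsetP (infpart_sub R A _)); rewrite inE => /andP[_].
    by move/zerosP.
  have [m0 m0d m0z] := @facet_exists _ _ _ D X.
  have m0X : std X m0.
    by split; [exact: dominant_tits|move=> j; rewrite -m0z => /zerosP].
  have [_ /(_ i iI)] : std Y m0.
    by apply: span_face_min (Xl _ m0X) => //; apply/std_is_face/special_infpart.
  move=> /zerosP; rewrite m0z; apply/negP.
  have := subsetP (infpart_sub R A _) i iI; rewrite inE => /andP[+ _].
  exact: perp_disj.
split.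
  by rewrite span_face_dominant // mz infpart_add_perp // subsetIl.
move=> v i st; have [p|/hposN p] := pselect (hpos (hact v (cor i))).
  have [b [k [bX kX E]]] := straddle_std Xs p st.
  rewrite (dominant_pair md p) (Kdom_pair lK p) // E.
  by apply: supp_in_hact => //; exact: supp_in_cor.
have E0 : - hact v (cor i) = hact (v * s_ i)%g (cor i) by rewrite
  hact_mul_srefl.
have [c cE] := p.
have [b [k [bX kX E]]] := straddle_std (v := (v * s_ i)%g) Xs
  (eq_ind _ (@hpos _ _ _ D) p _ E0) (eq_ind _ (straddles (std X)) (straddlesN
    st) _ E0).
have cX := natcomb_supp (supp_in_hact bX (supp_in_cor D kX))
             (etrans (etrans (esym E) (esym E0)) cE).
have mX : Kdom (perp A X) m by move=> j _; apply: md.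
have sg n : Kdom (perp A X) n ->
    (0 <= pair n (hact v (cor i))) = (pair n (- hact v (cor i)) == 0).
  move=> nK; have : 0 <= pair n (- hact v (cor i)).
    apply: Kdom_pair nK p _; rewrite E0 E.
    by apply: supp_in_hact => //; exact: supp_in_cor.
  by rewrite pairNr oppr_eq0 oppr_ge0 eq_le => ->.
rewrite !sg //; apply/eqP/eqP.
  move=> /(pair_eq0_supp mX cX cE) z; apply/(pair_eq0_supp lK cX cE) => j jX.
  case: (z j jX) => [->|/zerosP jz]; [by left|right; apply/zerosP].
  by move: jz; rewrite mz in_setU in_setI (negbTE (perp_disj jX)) jX.
move=> /(pair_eq0_supp lK cX cE) z; apply/(pair_eq0_supp mX cX cE) => j jX.
case: (z j jX) => [->|/zerosP jz]; [by left|right; apply/zerosP].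
by rewrite mz in_setU in_setI jX jz orbT.
Qed.

(** A translation makes the face standard, and a further one by the orthogonal
    subgroup, which preserves the face, makes [l] dominant on this subgroup. *)
Lemma projects_exists F l : is_face F -> tits_cone l ->
  (F `<=` span_face l)%classic -> exists m, projects F l m.
Proof.
move=> /face_classification[w [X [Xs ->]]] tl Xl.
have tl0 := tits_cone_act (w^-1)%g tl.
have [a aX al] := tits_cone_Kdom (perp A X) tl0.
set l1 := weyl_act a _ in al.
have lE : l = weyl_act (w * a^-1)%g l1.
  by rewrite weyl_actM /l1 weyl_actK weyl_actVK.
have aE : (weyl_act (w * a^-1)%g @` std X = weyl_act w @` std X)%classic.
  apply/seteqP; split=> n /mem_actV h; apply/mem_actV; move: h.
    by rewrite invgM invgK weyl_actM => /(std_perp_act (parV aX));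
      rewrite weyl_actK.
  by rewrite invgM invgK weyl_actM; apply: std_perp_act.
have Xl1 : (std X `<=` span_face l1)%classic.
  move=> n nX; apply/(span_face_act (w * a^-1)%g); rewrite -lE; apply: Xl.
  by rewrite -aE; apply/mem_act.
have [m md mz] := @facet_exists _ _ _ D (X :|: (perp A X :&: zeros l1)).
exists (weyl_act (w * a^-1)%g m); rewrite -aE {1}lE; apply: projects_act.
by apply: projects_std => //; apply: tits_cone_act.
Qed.

(** Otherwise the hyperplane cuts out a smaller face through [l]. *)
Lemma span_face_lt0 l h : tits_cone l ->
  (forall n, span_face l n -> pair n h <= 0) ->
  (exists2 n, span_face l n & pair n h < 0) -> pair l h < 0.
Proof.
move=> tl le0 [n nS nlt]; rewrite lt_neqAle le0 ?andbT;
  last exact: span_face_self.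
apply/negP => /eqP l0.
have fS := span_face_is_face tl; have [St _ Sc Se] := fS.
pose G : set (dual D) := [set x | span_face l x /\ pair x h = 0]%classic.
have fG : is_face G.
  split.
  - by move=> x [/St].
  - by exists l; split=> //; apply: span_face_self.
  - move=> x y t [xS x0] [yS y0] t01 z tz; split; first exact: Sc.
    by rewrite /z pairDl !pairZl x0 y0 !mulr0 addr0.
  - move=> x y t tx ty t01 [zS z0]; have [xS yS] := Se x y t tx ty t01 zS.
    case/andP: t01 => t0 t1.
    have x0 := le0 x xS; have y0 := le0 y yS.
    move: z0; rewrite pairDl !pairZl => z0; split; split=> //; nra.
have [_ n0] : G n.
  by apply: (span_face_min fG _ nS); split=> //; apply: span_face_self.
by rewrite n0 ltxx in nlt.
Qed.

(** The facet of [l] lies in the closure of the facet of [l']. *)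
Definition below l l' := forall v i,
  0 <= pair l' (hact v (cor i)) -> 0 <= pair l (hact v (cor i)).

Lemma below_cell l l' : below l l' -> (cell l' `<=` cell l)%classic.
Proof.
move=> b v vl i; rewrite -/(pair _ _) pair_hactV invgK; apply: b.
by have := vl i; rewrite -/(pair _ _) pair_hactV invgK.
Qed.

Lemma cell_common l l' : tits_cone l' -> (cell l' `<=` cell l)%classic ->
  exists w m m', [/\ dominant m, dominant m', l = weyl_act w m,
    l' = weyl_act w m' & zeros m' \subset zeros m].
Proof.
move=> /titsP[w [m' [md' l'E]]] sub.
have wl : dominant (weyl_act (w^-1)%g l).
  by apply: sub; rewrite l'E; move=> i; rewrite weyl_actK; apply: md'.
exists w, (weyl_act (w^-1)%g l), m'; split=> //; first by rewrite weyl_actVK.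
apply/subsetP => i /zerosP m0; apply/zerosP.
have : cell l (w * s_ i)%g.
  apply: sub => j; rewrite invgM sreflV weyl_actM l'E weyl_actK srefl_fix //.
move=> /(_ i); rewrite -/(pair _ _) invgM sreflV weyl_actM pair_hactV sreflV.
rewrite hact_srefl_cor pairNr => le0; have ge0 := wl i;
  rewrite -/(pair _ _) in ge0.
by apply/eqP; rewrite eq_le ge0 andbT -oppr_ge0.
Qed.

Lemma cell_below l l' : tits_cone l' -> (cell l' `<=` cell l)%classic -> below
  l l'.
Proof.
move=> tl' /(cell_common tl')[w [m [m' [md md' -> -> /subsetP mz]]]] v i.
rewrite !pair_hactV -!hactM; set u := (w^-1 * v)%g => ge0.
have [p|/hposN p] := pselect (hpos (hact u (cor i)));
  first exact: dominant_pair.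
have [c cE] := p.
have c0 : forall j, j \notin [set: I] -> c j = 0%N by move=> j; rewrite inE.
have K n : dominant n -> Kdom [set: I] n by move=> nd j _; apply: nd.
have /(pair_eq0_supp (K _ md') c0 cE) z : pair m' (- hact u (cor i)) = 0.
  by apply/eqP; rewrite eq_le {1}pairNr oppr_le0 ge0 dominant_pair.
rewrite -oppr_le0 -pairNr le_eqVlt; apply/orP; left; apply/eqP.
apply/(pair_eq0_supp (K _ md) c0 cE) => j /z[->|m0]; [by left|right].
by apply/zerosP/mz/zerosP.
Qed.

Lemma span_face_cell l l' : tits_cone l' -> (cell l' `<=` cell l)%classic ->
  (span_face l `<=` span_face l')%classic.
Proof.
move=> tl' /(cell_common tl')[w [m [m' [md md' -> -> /subsetP mz]]]].
rewrite !span_face_actE => _ [n mn <-]; apply/mem_act.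
apply: span_face_min mn; first exact/span_face_is_face/dominant_tits.
rewrite span_face_dominant //; split; first exact: dominant_tits.
by move=> i /(subsetP (infpart_sub R A _))/mz/zerosP.
Qed.

Lemma span_face_tits F m : is_face F -> span_face m = F -> tits_cone m.
Proof.
by move=> [Ft _ _ _] mF; apply: Ft; rewrite -mF; apply: span_face_self.
Qed.

(** The sign of a coroot on a projected point is its sign on the target face if
    it has one, and its sign on the original point otherwise. The critical case
    is that of a coroot that is nonnegative on [m'] and on [l], crosses the
    larger target [S'] but is nonpositive and not zero on the smaller one. It
    then crosses [F]. If it also crosses the face of [l], its reflection
    preserves [F] and the face of [l], hence the target, which thus has points
    on both sides; otherwise it has on [l] the sign that it has on the face of
    [l]. *)
Lemma projects_below F l l' m m' : is_face F -> tits_cone l -> tits_cone l' ->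
  below l l' -> (span_face l `<=` span_face l')%classic ->
  projects (F `&` span_face l)%classic l m ->
  projects (F `&` span_face l')%classic l' m' -> below m m'.
Proof.
move=> fF tl tl' ll' sub [mS msg] [mS' msg'] v i.
set h := hact v (cor i) => ge0.
set S := (F `&` span_face l)%classic in mS msg.
set S' := (F `&` span_face l')%classic in mS' msg'.
have fl := span_face_is_face tl.
have SS' : (S `<=` S')%classic by move=> n [nF /sub].
have tm' : tits_cone m' by apply: span_face_tits mS'; apply: is_faceI => //;
  exact: span_face_is_face.
have mm : S m by rewrite -mS; apply: span_face_self.
have [[n nS' n0]|nneg] := pselect (exists2 n, S' n & pair n h < 0); last first.
  by rewrite leNgt; apply/negP => lt0; apply: nneg; exists m => //; apply: SS'.
have st' : straddles S' h.
  split; first by exists n.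
  apply: contrapT => npos; suff : pair m' h < 0 by rewrite ltNge ge0.
  apply: span_face_lt0 => //; rewrite mS'; last by exists n.
  by move=> x xS; rewrite leNgt; apply/negP => x0; apply: npos; exists x.
have lge0 : 0 <= pair l h by apply: ll'; rewrite -msg'.
rewrite leNgt; apply/negP => mlt0.
have [[x xS x0]|npos] := pselect (exists2 x, S x & 0 < pair x h).
  have : straddles S h by split; [exists m|exists x].
  by move=> /msg; rewrite lge0 leNgt mlt0.
(* from here on h is nonpositive on S and negative at m *)
have stF : straddles F h by apply: straddlesS st' => x [].
have [[x xl x0]|npl] := pselect (exists2 x, span_face l x & 0 < pair x h);
  last first.
  suff : pair l h < 0 by rewrite ltNge lge0.
  apply: span_face_lt0 => //; last by exists m => //; case: mm.
  by move=> y yl; rewrite leNgt; apply/negP => y0; apply: npl; exists y.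
have stl : straddles (span_face l) h.
  by split; [exists m => //; case: mm|exists x].
apply: npos; exists (weyl_act (v * s_ i * v^-1)%g m).
  case: mm => mF ml.
  by split; [exact: straddle_refl fF stF _ mF|exact: straddle_refl fl stl _ ml].
rewrite pair_hactV /h -hactM !invgM invgK sreflV !mulgA -!(mulgA _ _ v) mulVg
  mulg1.
by rewrite hact_mul_srefl pairNr oppr_gt0.
Qed.

End Projection.

(** * The action on the Coxeter complex *)

Section Action.
Local Open Scope quotient_scope.
Variables (R : realType) (I : finType) (A : gcm I) (D : realization R A).
Hypothesis hA : symmetrizable R A.
Implicit Types (v w a : weyl D) (l m n : dual D) (h : cartan D).
Implicit Types (J K X Y : {set I}) (F G S : set (dual D)).
Implicit Types (p q : fpair D) (c d : coxeter_complex D) (u : face_monoid D).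

Notation cor := (coroot D).
Notation WP := (parabolic D).
Notation infp := (infpart R A).
Notation std := (@std_face_set R I A D).

Lemma simplex_inj c d : (c : set (weyl D)) = d -> c = d.
Proof.
by case: c d => [c cP] [d dP] /= E; subst d; congr CoxeterSimplex;
  exact: Prop_irrelevance.
Qed.

Lemma simplex_cell c : exists2 l, tits_cone l & (c : set (weyl D)) = cell l.
Proof.
have [w [J cE]] := simplex_setP c; have [m md mz] := @facet_exists _ _ _ D J.
exists (weyl_act w m); first exact/tits_cone_act/dominant_tits.
by rewrite cE cellE // mz.
Qed.

Lemma cell_simplex l : tits_cone l -> exists d, (d : set (weyl D)) = cell l.
Proof.
move=> /titsP[w [m [md ->]]]; exists (simplex w (zeros m)).
by rewrite cellE.
Qed.

Lemma simplex_facet w m J : dominant m -> zeros m = J ->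
  (simplex w J : set (weyl D)) = cell (weyl_act w m).
Proof. by move=> md <-; rewrite cellE. Qed.

Lemma cell_actP v w l : cell (weyl_act v l) w <-> cell l (v^-1 * w)%g.
Proof. by rewrite /cell /= invgM invgK weyl_actM. Qed.

Lemma cell_act v l l' : (cell l `<=` cell l')%classic ->
  (cell (weyl_act v l) `<=` cell (weyl_act v l'))%classic.
Proof. by move=> sub w /cell_actP/sub h; apply/cell_actP. Qed.

Lemma cell_act_eq v l l' : cell l = cell l' ->
  cell (weyl_act v l) = cell (weyl_act v l').
Proof. by move=> E; apply/seteqP; split; apply: cell_act; rewrite E. Qed.

Lemma span_face_cell_eq l l' : tits_cone l -> tits_cone l' -> cell l = cell l'
  ->
  span_face l = span_face l'.
Proof.
by move=> tl tl' E; apply/seteqP; split; apply: span_face_cell => //; rewrite E.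
Qed.

Lemma projects_cell F l l' m m' : is_face F -> tits_cone l -> tits_cone l' ->
  (cell l' `<=` cell l)%classic ->
  projects (F `&` span_face l)%classic l m ->
  projects (F `&` span_face l')%classic l' m' -> (cell m' `<=` cell m)%classic.
Proof.
move=> fF tl tl' sub lm lm'; apply: below_cell.
apply: (projects_below hA fF tl tl') lm lm'; first exact: cell_below.
exact: span_face_cell.
Qed.

Lemma projects_self l : projects (span_face l) l l.
Proof. by []. Qed.

(** A hyperplane that crosses a smaller face crosses the larger one; this makes
    the action multiplicative. *)
Lemma projects_trans S S' l m n : (S' `<=` S)%classic -> projects S l m ->
  projects S' m n -> projects S' l n.
Proof.
move=> SS' [_ sg] [nS' sg']; split=> // v i st.
by rewrite sg' // sg //; apply: straddlesS st.
Qed.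

Lemma projects_mem S l m : projects S l m -> S m.
Proof. by move=> [<- _]; apply: span_face_self. Qed.

Lemma projects_total F l : is_face F -> tits_cone l ->
  exists m, projects (F `&` span_face l)%classic l m.
Proof.
move=> fF tl; apply: (projects_exists hA) => //.
by apply: is_faceI => //; apply: span_face_is_face.
Qed.

Lemma projects_tits F l m : is_face F ->
  projects (F `&` span_face l)%classic l m -> tits_cone m.
Proof. by move=> [Ft _ _ _] /projects_mem[/Ft]. Qed.

(** A facet is given by any of its points [l] and an element of the face monoid
    by any of its representatives; independence of the choices is
    [acts_to_fun]. *)
Definition acts_to u c d := exists p l m,
  [/\ u = \pi_(face_monoid D) p, tits_cone l, (c : set (weyl D)) = cell l,
      projects (p.2 `&` span_face l)%classic l m &
      (d : set (weyl D)) = cell (weyl_act p.1 m)].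

Lemma acts_to_total u c : exists d, acts_to u c d.
Proof.
elim/quotW: u => p; have [l tl cE] := simplex_cell c.
have fF := face_is_face p.2.
have [m lm] := projects_total fF tl.
have [d dE] := cell_simplex (tits_cone_act p.1 (projects_tits fF lm)).
by exists d, p, l, m.
Qed.

Lemma acts_to_fun u c d d' : acts_to u c d -> acts_to u c d' -> d = d'.
Proof.
move=> [p [l [m [-> tl cE lm dE]]]] [q [l' [m' [E tl' cE' lm' dE']]]].
apply: simplex_inj; rewrite dE dE'.
have /fpair_eqP/fpair_equivP[E2 E1] := E.
have cc : cell l = cell l' by rewrite -cE.
rewrite E1; last by case: (projects_mem lm).
apply: cell_act_eq; rewrite -E2 in lm'.
have fF := face_is_face p.2.
by apply/seteqP; split; apply: projects_cell lm lm' || apply: projects_cell lm'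
  lm;
  rewrite ?cc.
Qed.

Definition fm_act u c : coxeter_complex D := sval (cid (acts_to_total u c)).

Lemma fm_actP u c : acts_to u c (fm_act u c).
Proof. exact: svalP (cid (acts_to_total u c)). Qed.

Lemma fm_actE p c l m : tits_cone l -> (c : set (weyl D)) = cell l ->
  projects (p.2 `&` span_face l)%classic l m ->
  (fm_act (\pi_(face_monoid D) p) c : set (weyl D)) = cell (weyl_act p.1 m).
Proof.
move=> tl cE lm.
have [d dE] := cell_simplex (tits_cone_act p.1 (projects_tits (face_is_face
  p.2) lm)).
rewrite -dE; congr simplex_set; apply: (acts_to_fun (fm_actP _ _)).
by exists p, l, m.
Qed.

Lemma span_face_sub_tits l : tits_cone l -> (span_face l `<=` @tits_cone R I A
  D)%classic.
Proof. by move=> /span_face_is_face[]. Qed.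

Lemma fm_act_weyl v w J : fm_act (of_weyl v) (simplex w J) = simplex (v * w)%g
  J.
Proof.
have [m md mz] := @facet_exists _ _ _ D J; apply: simplex_inj.
have tl := tits_cone_act w (dominant_tits md).
rewrite (fm_actE tl (simplex_facet w md mz) (m := weyl_act w m)).
  by rewrite /= -weyl_actM -(simplex_facet _ md mz).
rewrite setIidr; first exact: projects_self.
exact: span_face_sub_tits.
Qed.

Lemma fm_act1 c : fm_act 1%g c = c.
Proof.
case: c => c [w [J E]]; have -> : CoxeterSimplex (ex_intro _ w (ex_intro _ J
  E)) = simplex w J.
  exact: simplex_inj.
by have := fm_act_weyl 1%g w J; rewrite mul1g.
Qed.

Lemma fm_actM u u' c : fm_act (u * u')%g c = fm_act u (fm_act u' c).
Proof.
elim/quotW: u => p; elim/quotW: u' => q; have [l tl cE] := simplex_cell c.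
have fq := face_is_face q.2; have fp := face_is_face p.2.
have [m lm] := projects_total fq tl.
have tm := tits_cone_act q.1 (projects_tits fq lm).
have qE := fm_actE tl cE lm.
have [n mn] := projects_total fp tm.
apply: simplex_inj; rewrite (fm_actE tm qE mn).
have -> : (\pi_(face_monoid D) p * \pi_(face_monoid D) q)%g =
    \pi_(face_monoid D) (fpair_mul p q) by rewrite pi_fmonoid_mul.
rewrite (fm_actE tl cE (m := weyl_act (q.1^-1)%g n)) /=.
  by rewrite weyl_actM weyl_actVK.
have := projects_act (q.1^-1)%g mn; rewrite weyl_actK span_face_actE.
case: (lm) => -> _.
set S' := (_ @` _)%classic; set S := (_ `&` span_face l)%classic.
have -> : S' = S.
  apply/seteqP; split=> x.
    move=> /mem_actV; rewrite invgK => -[xp /mem_act [xq xl]].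
    by split=> //; split=> //; apply/mem_actV; rewrite invgK.
  move=> [[/mem_actV + xq] xl]; rewrite invgK => xp; apply/mem_actV;
    rewrite invgK.
  by split=> //; apply/mem_act.
by apply: projects_trans lm; move=> x [[_ xq] xl].
Qed.

Lemma fm_act_mono u c d :
  simplex_le c d -> simplex_le (fm_act u c) (fm_act u d).
Proof.
rewrite /simplex_le; elim/quotW: u => p.
have [l tl cE] := simplex_cell c; have [l' tl' dE] := simplex_cell d.
have fp := face_is_face p.2.
have [m lm] := projects_total fp tl; have [m' lm'] := projects_total fp tl'.
rewrite (fm_actE tl cE lm) (fm_actE tl' dE lm') cE dE => sub.
by apply: cell_act; apply: projects_cell lm lm'.
Qed.

Lemma pi_weyl_eps v (F : face D) :
  (of_weyl v * eps F)%g = \pi_(face_monoid D) (v, F).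
Proof.
have -> : (of_weyl v * eps F)%g =
    \pi_(face_monoid D) (fpair_mul (v, full_face D) (1%g, F)).
  by rewrite pi_fmonoid_mul.
congr (\pi_(face_monoid D) _); rewrite /fpair_mul /= mulg1.
apply: (congr1 (fun E : face D => (v, E) : fpair D)); apply: face_eq => /=;
  apply: setIidr => x xF; apply/mem_actV; rewrite invgK.
by apply: tits_cone_act; have [+ _ _ _] := face_is_face F; apply.
Qed.

Lemma span_face_facet m J : dominant m -> zeros m = J -> span_face m = std
  (infp J).
Proof. by move=> md <-; apply: span_face_dominant. Qed.

(** If [(p.1, p.2)] fixes the simplex of [l], then [p.1] maps the intersection
    of [p.2] with [span_face l] onto [span_face l]. Both faces have the same
    rank, so that [p.2] contains [l], and [p.1] fixes the cell of [l]. Some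
    element brings [p.2] to a standard face and [l] into the dominant chamber;
    it fixes [l], and thus belongs to [W_J]. *)
Lemma fm_act_stab J :
  [set u | fm_act u (simplex 1%g J) = simplex 1%g J]%classic = fparabolic D J.
Proof.
have [l ld lz] := @facet_exists _ _ _ D J.
have tl := dominant_tits ld.
have cE : (simplex 1%g J : set (weyl D)) = cell l.
  by rewrite (simplex_facet _ ld lz) weyl_act1.
have l0 i : i \in J -> pair l (cor i) = 0 by rewrite -lz => /zerosP.
apply/seteqP; split=> u /=; last first.
  move=> [v [w [T [vJ wJ TJ Ts ->]]]]; apply: simplex_inj.
  rewrite pi_weyl_eps (fm_actE tl cE (m := l)) ?(par_fix l0 vJ) //=.
  rewrite std_faceE // setIidr; first exact: projects_self.
  apply: span_face_min; first by apply: is_face_act; apply: std_is_face.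
  apply/mem_actV; rewrite (par_fix l0 (parV wJ)); split=> // i iT.
  by apply: l0; apply: (subsetP TJ).
elim/quotW: u => p E.
have fp := face_is_face p.2.
have [m lm] := projects_total fp tl; have [mS _] := lm.
have tm := projects_tits fp lm.
have lE := span_face_facet ld lz.
have cc : cell (weyl_act p.1 m) = cell l by rewrite -(fm_actE tl cE lm) E.
have := span_face_cell_eq (tits_cone_act p.1 tm) tl cc.
rewrite span_face_actE mS lE => SE.
have back n : std (infp J) n -> std (infp J) (weyl_act (p.1^-1)%g n).
  by rewrite -{1}SE => /mem_actV[].
have lp : (span_face l `<=` p.2)%classic.
  move=> n; rewrite lE => nJ.
  have : std (infp J) (weyl_act p.1 n).
    by apply: (std_rank (leqnn _) back); rewrite weyl_actK.
  by rewrite -{1}SE => /mem_act[].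
have SS : (p.2 `&` span_face l)%classic = span_face l by apply: setIidr.
have := fm_actE (p := p) (m := l) tl cE; rewrite SS E => /(_ (projects_self _)).
rewrite cE => /esym E1.
have p1J : WP J p.1.
  have : cell (weyl_act p.1 l) p.1 by apply/cell_actP;
    rewrite mulVg /cell /= invg1 weyl_act1.
  by rewrite E1 -cE /= => -[v vJ <-]; rewrite mul1g.
have [w [T [Ts FE]]] := face_classification hA fp.
have : std T (weyl_act (w^-1)%g l).
  by apply/mem_actV; rewrite -FE; apply: lp; apply: span_face_self.
move=> /(std_dominant Ts)[a [aT ad aS]].
have awJ : WP J (a * w^-1)%g.
  by rewrite -lz; apply: fundamental_domain => //; rewrite weyl_actM.
rewrite -weyl_actM (par_fix l0 awJ) in aS.
exists p.1, (w * a^-1)%g, T; split=> //.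
- by have := parV awJ; rewrite invgM invgK.
- by rewrite -lz; apply/subsetP => i iT; apply/zerosP; apply: stdP aS _ iT.
rewrite pi_weyl_eps; case: (p) FE => p1 p2 /= FE;
  congr (\pi_(face_monoid D) (_, _)).
apply: face_eq; rewrite /= std_faceE // FE.
apply/seteqP; split=> n /mem_actV h; apply/mem_actV.
  by rewrite invgM invgK weyl_actM; apply: std_perp_act.
by move: h; rewrite invgM invgK weyl_actM => /(std_perp_act (parV aT));
  rewrite weyl_actK.
Qed.

(** Chambers, and the facets in the relative interior of the face of [p],
    determine that face. On a facet in its relative interior the element acts
    as [p.1], and this determines [p.1] up to the pointwise stabilizer. *)
Lemma fm_act_faithful : faithful_action fm_act.
Proof.
have span_eq p q : (forall c, fm_act (\pi_(face_monoid D) p) c =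
                              fm_act (\pi_(face_monoid D) q) c) ->
    forall l, tits_cone l ->
    (weyl_act p.1 @` (p.2 `&` span_face l))%classic =
    (weyl_act q.1 @` (q.2 `&` span_face l))%classic.
  move=> E l tl; have [c cE] := cell_simplex tl.
  have [m lm] := projects_total (face_is_face p.2) tl.
  have [m' lm'] := projects_total (face_is_face q.2) tl.
  have tm := projects_tits (face_is_face p.2) lm.
  have tm' := projects_tits (face_is_face q.2) lm'.
  have cc : cell (weyl_act p.1 m) = cell (weyl_act q.1 m').
    by rewrite -(fm_actE tl cE lm) -(fm_actE tl cE lm') E.
  have := span_face_cell_eq (tits_cone_act p.1 tm) (tits_cone_act q.1 tm') cc.
  by rewrite !span_face_actE; case: lm => -> _; case: lm' => -> _.
(* every face is spanned by a translate of a dominant point *)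
have generic (F : face D) : exists w X m, [/\ special R A X,
    (F : set (dual D)) = (weyl_act w @` std X)%classic, dominant m,
    zeros m = X & span_face (weyl_act w m) = F].
  have [w [X [Xs FE]]] := face_classification hA (face_is_face F).
  have [m md mz] := @facet_exists _ _ _ D X.
  exists w, X, m; split=> //.
  by rewrite span_face_actE (span_face_facet md mz) FE -Xs.
have sub p q : (forall c, fm_act (\pi_(face_monoid D) p) c =
                          fm_act (\pi_(face_monoid D) q) c) ->
    (q.2 `<=` p.2)%classic.
  move=> /span_eq E n nq.
  have [w [X [m [Xs pE md mz wm]]]] := generic p.2.
  have tm := tits_cone_act w (dominant_tits md).
  have := E _ tm; rewrite wm classical_sets.setIid => E1.
  have [m0 m0d m0z] := @facet_exists _ _ _ D set0.
  have := E _ (dominant_tits m0d).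
  have -> : span_face m0 = @tits_cone R I A D.
    rewrite (span_face_facet m0d m0z); apply/seteqP; split=> [x []//|x xt].
    by split=> // i /(subsetP (infpart_sub R A _)); rewrite inE.
  rewrite !setIidl; last 2 first.
  - by have [] := face_is_face q.2.
  - by have [] := face_is_face p.2.
  rewrite E1 => E2; have : (weyl_act q.1 @` q.2)%classic (weyl_act q.1 n).
    exact/mem_act.
  by rewrite -E2 => /mem_act[].
move=> u v; elim/quotW: u => p; elim/quotW: v => q E.
have pq : p.2 = q.2.
  by apply: face_eq; apply/seteqP; split; apply: sub.
apply/fpair_eqP/fpair_equivP; split=> // n np.
have [w [X [m [Xs pE md mz wm]]]] := generic p.2.
have tm := tits_cone_act w (dominant_tits md).
have [c cE] := cell_simplex tm.
have E1 := fm_actE (p := p) (m := weyl_act w m) tm cE.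
have E2 := fm_actE (p := q) (m := weyl_act w m) tm cE.
have pr : projects p.2 (weyl_act w m) (weyl_act w m).
  by rewrite -wm; apply: projects_self.
move: E1 E2; rewrite -pq -E wm classical_sets.setIid.
move=> /(_ pr) -> /(_ pr) cc.
pose x := (w^-1 * p.1^-1 * q.1 * w)%g.
have xX : WP X x.
  have : cell (weyl_act q.1 (weyl_act w m)) (q.1 * w)%g.
    by rewrite -weyl_actM /cell /= weyl_actK.
  rewrite -cc => /cell_actP/cell_actP; rewrite !mulgA -/x.
  have := simplex_facet 1%g md mz; rewrite weyl_act1 => <- [y yX <-].
  by rewrite mul1g.
move: np; rewrite pE => -[n0 n0X <-].
have xn : weyl_act x n0 = n0 by apply: par_fix xX; apply: stdP n0X.
by rewrite -{1}xn -!weyl_actM /x !mulgA mulgK mulgV mul1g.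
Qed.

End Action.

(** * Decompositions and the explicit formula *)

Section Formula.
Variables (R : realType) (I : finType) (A : gcm I) (D : realization R A).
Implicit Types (v w a x y : weyl D) (m n : dual D) (h : cartan D).
Implicit Types (J K X Y T : {set I}).

Notation cor := (coroot D).
Notation s_ := (srefl D).
Notation WP := (parabolic D).
Notation infp := (infpart R A).
Notation finp := (finpart R A).
Notation std := (@std_face_set R I A D).

Lemma par_perp_split Y l : WP (Y :|: perp A Y) l ->
  exists c d, [/\ WP (perp A Y) c, WP Y d & l = (c * d)%g].
Proof.
elim/(@par_ind _ _ _ D (Y :|: perp A Y)) => [|v k _ kL [c [d [cY dY ->]]]].
  by exists 1%g, 1%g; split; rewrite ?mulg1 //; exact: par1.
have [kY|kY] := boolP (k \in Y).
  exists c, (s_ k * d)%g; split=> //; first by apply: parM dY; exact: par_srefl.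
  by rewrite !mulgA -(srefl_conj (perp_act_cor cY kY)).
exists (s_ k * c)%g, d; split; rewrite ?mulgA //.
by apply: parM => //; apply: par_srefl; move: kL; rewrite in_setU (negbTE kY).
Qed.

Lemma supp_fix Y a h : (forall i, i \in Y -> hact a (cor i) = cor i) ->
  supp_in Y h -> hact a h = h.
Proof.
move=> aY [c [cY ->]]; rewrite hact_sum; apply: eq_bigr => i _.
by rewrite hactZ; have [/aY->|/cY->] := boolP (i \in Y); rewrite ?scale0r.
Qed.

(** Let [y] be of minimal length in the double coset of [w], and let [x] be a
    shortest prefix of [y] whose complement lies in [W_L]. The complement is a
    product of an element of the subgroup orthogonal to [J^oo] and one of the
    subgroup of [J^oo]; the latter is trivial because [y] cannot be shortened
    from the right by [W_J]. *)
Lemma decomposition_exists T J w :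
  exists a1 a2 x c1 c2, decomposition T J w a1 a2 x c1 c2.
Proof.
set K := T :|: perp A T; set Y := infp J; set L := Y :|: perp A Y.
pose Q k := `[< exists a c, [/\ WP K a, WP J c & len (a^-1 * w * c^-1)%g = k]
  >].
have exQ : exists k, Q k.
  by exists (len (1^-1 * w * 1^-1)%g); apply/asboolP; exists 1%g, 1%g;
    split=> //; exact: par1.
case: (ex_minnP exQ) => _ /asboolP[a [c2 [aK c2J <-]]] ymin.
set y := (a^-1 * w * c2^-1)%g in ymin.
have wE : w = (a * y * c2)%g by rewrite /y !mulgA mulgV mul1g mulgVK.
have yK v : WP K v -> (len y <= len (v * y)%g)%N.
  move=> vK; apply: ymin; apply/asboolP; exists (a * v^-1)%g, c2; split=> //.
    exact: parM aK (parV vK).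
  by rewrite invgM invgK /y !mulgA.
have yJ v : WP J v -> (len y <= len (y * v)%g)%N.
  move=> vJ; apply: ymin; apply/asboolP; exists a, (v^-1 * c2)%g; split=> //.
    exact: parM (parV vJ) c2J.
  by rewrite invgM invgK /y !mulgA.
pose Q' k := `[< exists x l, [/\ WP L l, y = (x * l)%g,
                   (len y = len x + len l)%N & len x = k] >].
have exQ' : exists k, Q' k.
  exists (len y); apply/asboolP; exists y, 1%g; split=> //; first exact: par1.
    by rewrite mulg1.
  by rewrite len1 addn0.
case: (ex_minnP exQ') => _ /asboolP[x [l [lL yE lenE <-]]] xmin.
have xr : minreps_r D L x.
  apply/minreps_rP => i iL; apply: hlen_pos; rewrite leqNgt; apply/negP => lt.
  suff /xmin : Q' (len (x * s_ i)%g) by rewrite leqNgt lt.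
  have yE' : y = (x * s_ i * (s_ i * l))%g by rewrite !mulgA mulg_sreflK.
  apply/asboolP; exists (x * s_ i)%g, (s_ i * l)%g; split=> //.
    by apply: parM lL; exact: par_srefl.
  have := lenM (x * s_ i)%g (s_ i * l)%g; have := lenM (s_ i) l.
  by have := len_srefl D i; rewrite -yE'; lia.
have [c1 [d [c1Y dY lE]]] := par_perp_split lL.
have d1 : d = 1%g.
  have [//|dn] := pselect (d = 1%g); have [i iY N] := par_descent dY dn;
    exfalso.
  have sd : supp_in Y (hact d (cor i)) by apply: supp_in_hact => //;
    apply: supp_in_cor.
  have yi : hpos (hact y (cor i)).
    by apply: ((minreps_rP J y).1 yJ); apply: (subsetP (infpart_sub R A J)).
  apply: hpos_anti yi _; rewrite yE lE !hactM (supp_fix (Y := Y) _ sd) => [|j];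
    last exact: perp_act_cor.
  rewrite -hactN; apply: (@hpos_act_supp _ _ _ _ L).
  - rewrite -scaleN1r; apply: supp_inZ; have [c [cY cE]] := sd; exists c;
    split=> //.
    by move=> j; rewrite in_setU negb_or => /andP[/cY].
  - exact: hposN.
  - by apply/minreps_rP.
have lc1 : l = c1 by rewrite lE d1 mulg1.
rewrite lc1 in yE lenE.
have [a1 [a2 [a1T a2T aE]]] := par_perp_split aK.
exists a1, a2, x, c1, c2; split=> //.
- by rewrite -aE wE yE !mulgA.
- move=> v vK; have := yK v vK; have := lenM (v * x)%g c1.
  have -> : (v * y = v * x * c1)%g by rewrite yE mulgA.
  by rewrite lenE; lia.
- move=> v vJ; have := yJ v (parS (finpart_sub R A J) vJ).
  have := lenM x (c1 * v)%g.
  have -> : (y * v = x * (c1 * v))%g by rewrite yE mulgA.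
  by rewrite lenE; lia.
- by rewrite -yE.
- by rewrite -yE.
Qed.

Lemma weyl_act_sum w (F : I -> dual D) :
  weyl_act w (\sum_j F j) = \sum_j weyl_act w (F j).
Proof. exact: (@ract_sum _ _ _ _ (root_rep D)). Qed.

(** The letter [j] contributes [- g(h)] times its coroot, where [g] is the
    positive root made negative by the word from that letter on. If [g(h)] were
    zero, [g] would be a combination of roots in [Y] and orthogonal to [Y],
    which the word keeps positive because it is minimal. *)
Lemma minrep_coweight Y h s : face_coweight Y h -> len (word D s) = size s ->
  minreps_r D (Y :|: perp A Y) (word D s) ->
  exists c : I -> R, [/\ forall i, 0 <= c i, forall i, i \in s -> 0 < c i &
    hact (word D s) h = h + \sum_i c i *: cor i].
Proof.
move=> hY; elim: s => [|j s IHs] lens xr.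
  exists (fun=> 0); split=> //; rewrite word_nil hact1 big1 ?addr0 // => i _.
  by rewrite scale0r.
have lens1 : len (word D s) = size s.
  apply/eqP; rewrite eqn_leq len_word /=.
  by have := lenM (s_ j) (word D s); rewrite -word_cons lens;
    have := len_srefl D j => /=; lia.
have [||c [c0 cs cE]] := IHs => //.
  move=> v vL; have h1 := xr v vL; have h2 := lenM (s_ j) (word D s * v)%g.
  rewrite lens word_cons -mulgA in h1; rewrite lens1.
  have h3 := len_srefl D j; rewrite /= in h1.
  by rewrite -ltnS (leq_trans h1) // (leq_trans h2) // -[X in (_ <= X)%N]add1n
    leq_add2r.
pose g := weyl_act ((word D s)^-1)%g (sroot D j).
have gpos : natcomb (sroot D) g.
  apply/(@root_posP _ _ _ D)/hposP.
  have := lenV (s_ j * word D s)%g; rewrite invgM sreflV => ->.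
  by rewrite lenV -word_cons lens lens1.
have gE : pair (sroot D j) (hact (word D s) h) = pair g h by rewrite pair_hact.
have glt : pair g h < 0.
  have [n nE] := gpos; rewrite ltNge; apply/negP => ge0.
  have E : pair g h = \sum_i (n i)%:R * pair (sroot D i) h.
    by rewrite nE pair_suml; apply: eq_bigr => i _; rewrite pairZl.
  have z i : (n i)%:R * pair (sroot D i) h = 0.
    apply/eqP; rewrite -oppr_eq0; apply/eqP; move: i (mem_index_enum i).
    have : \sum_i - ((n i)%:R * pair (sroot D i) h) == 0.
      rewrite sumrN oppr_eq0 -E eq_le ge0 andbT E; apply: sumr_le0 => i _.
      by rewrite mulr_ge0_le0 // (fcw_le0 hY).
    rewrite psumr_eq0 => [/allP z i /z/eqP //|i _].
    by rewrite oppr_ge0 mulr_ge0_le0 // (fcw_le0 hY).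
  have xg : natcomb (sroot D) (weyl_act (word D (j :: s)) g).
    rewrite nE weyl_act_sum; elim/big_ind: _ => [||i _].
    - exact: natcomb0.
    - by move=> x1 x2; apply: natcombD.
    rewrite /= weyl_actZ; have [->|ni] := eqVneq (n i) 0%N.
      by rewrite scale0r; apply: natcomb0.
    apply: natcombZ; apply/root_posP; apply: ((minreps_rP _ _).1 xr).
    rewrite in_setU; have [//|iY] := boolP (i \in Y) => /=.
    apply/negPn/negP => ip; have := fcw_lt0 hY iY ip.
    have /eqP := z i; rewrite mulf_eq0 pnatr_eq0 (negbTE ni) /= => /eqP->.
    by rewrite ltxx.
  have : weyl_act (word D (j :: s)) g = - sroot D j.
    rewrite word_cons weyl_actM /g weyl_actVK.
    exact: (@ract_srefl_e _ _ _ _ (root_rep D)).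
  move: xg => /[swap] -> xg.
  have := natcomb_anti (@sroot_free R I A D) (natcomb_base _ j) xg.
  by apply/eqP; apply: (base_neq0 (@sroot_free R I A D)).
exists (fun i => c i + - pair g h * (i == j)%:R); split.
- by move=> i; rewrite addr_ge0 // mulr_ge0 // oppr_ge0 ltW.
- move=> i; rewrite inE; have [->|_] /= := eqVneq i j.
    by rewrite mulr1 ltr_wpDl // oppr_gt0.
  by move=> /cs; rewrite mulr0 addr0.
rewrite word_cons hactM hact_srefl gE cE -addrA; congr (_ + _).
under [RHS]eq_bigr do rewrite scalerDl -scalerA.
by rewrite big_split /= -scaler_sumr -comb_delta scaleNr.
Qed.

Lemma red_word x : exists s, [/\ x = word D s, size s = len x & {subset s <=
  red x}].
Proof.
have [s [xE sz]] := reduced_word x; exists s; split=> // i si.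
by rewrite inE; apply/asboolP; exists s.
Qed.

Lemma par_red x : WP (red x) x.
Proof.
by have [s [xE _ sr]] := red_word x; exists s => //; apply/allP => i /sr.
Qed.

Hypothesis hA : symmetrizable R A.

(** The intersection [F] contains the standard face of type [X]. Let a dominant
    point of type [P] become a generic point of [F] after application of [w].
    Moving [x h] by the orthogonal subgroup of [T] adds nonnegative multiples
    of coroots to it, and [x h] itself is [h] plus positive multiples of the
    coroots in [red x]; hence the dominant point vanishes on all of [X]. Thus
    [X] is a subset of [P], and the inclusion of faces forces equality. *)
Lemma face_intersection T Y x : special R A T -> special R A Y ->
  minreps_l D (T :|: perp A T) x -> minreps_r D (Y :|: perp A Y) x ->
  let X := T :|: Y :|: red x in
  special R A X /\ (std T `&` (weyl_act x @` std Y))%classic = std X.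
Proof.
move=> Ts Ys xl xr X.
set F := (_ `&` _)%classic.
have fF : is_face F by apply: is_faceI; [|apply: is_face_act];
  apply: std_is_face.
have XF n : std X n -> F n.
  move=> [tn n0]; split; first by split=> // i iT; apply: n0;
    rewrite !in_setU iT.
  apply/mem_actV; have n0r i : i \in red x -> pair n (cor i) = 0.
    by move=> ir; apply: n0; rewrite in_setU ir orbT.
  rewrite (par_fix n0r (parV (par_red x))); split=> // i iY.
  by apply: n0; rewrite !in_setU iY orbT.
have [w [P [Ps FE]]] := face_classification hA fF.
have [m0 m0d m0z] := @facet_exists _ _ _ D P.
have : F (weyl_act w m0).
  rewrite FE; apply/mem_act; split; first exact: dominant_tits.
  by move=> i; rewrite -m0z => /zerosP.
move=> [mT /mem_actV mY].
have [a [aT ad aS]] := std_dominant Ts mT.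
have aw : WP P (a * w)%g.
  by rewrite -m0z; apply: fundamental_domain => //; rewrite weyl_actM.
have m0P i : i \in P -> pair m0 (cor i) = 0 by rewrite -m0z => /zerosP.
have am : weyl_act a (weyl_act w m0) = m0 by rewrite -weyl_actM (par_fix m0P
  aw).
rewrite am in aS.
have [h hY] := face_coweight_exists D Ys.
have h_le j : j \in perp A T -> pair (sroot D j) (hact x h) <= 0.
  move=> jT; rewrite pair_hact.
  have /root_posP[n ->] : hpos (hact (x^-1)%g (cor j)).
    by apply: ((minreps_lP _ _).1 xl); rewrite in_setU jT orbT.
  rewrite pair_suml; apply: sumr_le0 => i _.
  by rewrite pairZl mulr_ge0_le0 // (fcw_le0 hY).
have [c' [c'0 _ c'E]] := hpos_sub_act aT h_le.
have vanish s : x = word D s -> size s = len x ->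
    (forall i, i \in Y -> pair m0 (cor i) = 0) /\
    (forall i, i \in s -> pair m0 (cor i) = 0).
  move=> xE sz; have [||c [c0 cs cE]] := minrep_coweight hY (s := s).
  - by rewrite -xE sz.
  - by rewrite -xE.
  have z : pair (weyl_act (x^-1)%g (weyl_act w m0)) h = 0.
    by apply: (fcw_std hY (stdP mY)).
  have : pair m0 (hact a (hact x h)) = 0.
    by rewrite -[in m0]am pair_act -z pair_hact.
  rewrite c'E xE cE !pairDr !pair_sumr => E.
  have g0 : 0 <= pair m0 h by apply: (fcw_ge0 hY) => i _; apply: m0d.
  have g1 i : 0 <= pair m0 (c i *: cor i) by rewrite pairZr mulr_ge0 // m0d.
  have g2 i : 0 <= pair m0 (c' i *: cor i) by rewrite pairZr mulr_ge0 // m0d.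
  have /eqP : pair m0 h + \sum_i pair m0 (c i *: cor i) = 0.
    have s2 : 0 <= \sum_i pair m0 (c' i *: cor i) by apply: sumr_ge0.
    have s1 : 0 <= \sum_i pair m0 (c i *: cor i) by apply: sumr_ge0.
    lra.
  rewrite paddr_eq0 ?sumr_ge0 // => /andP[/eqP h0].
  rewrite psumr_eq0 // => /allP z1; split=> [i iY|i si].
    by apply: (fcw_eq0 hY _ h0 iY) => j _; apply: m0d.
  have := z1 i (mem_index_enum i); rewrite /= pairZr mulf_eq0.
  by rewrite gt_eqF ?cs //= => /eqP.
have XP : X \subset P.
  apply/subsetP => i; rewrite -m0z => iX; apply/zerosP.
  have [s [xE sz _]] := red_word x.
  move: iX; rewrite !in_setU => /orP[/orP[iT|iY]|].
  - exact: stdP aS _ iT.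
  - exact: ((vanish s xE sz).1 i).
  rewrite inE => /asboolP[s' [xE' sz' si]].
  exact: ((vanish s' xE' sz').2 i).
have sub n : std X n -> std P (weyl_act (w^-1)%g n).
  by move=> /XF; rewrite FE => /mem_actV.
have PX : P = X by apply/esym/eqP; rewrite eqEcard XP (std_card sub).
split; first by rewrite -PX.
apply/seteqP; split=> n; last exact: XF.
rewrite FE => /mem_actV; apply: std_rank sub _.
by rewrite subset_leq_card.
Qed.

(** The projection is [projects_std] for the point [a2 x c1 m0], with [m0] on
    the dominant facet of type [J]. Since [a2] and [x] fix the coroots
    orthogonal to [X], the values of this point there are those of [m0] on the
    coroots [c1^-1 h_i]. These coroots are positive by minimality of [x c1] on
    the left, and by its minimality on the right [m0] vanishes on one of them
    only if it is a simple coroot of [J]. *)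
Lemma fm_act_formula s1 s2 t T J a1 a2 x c1 c2 : special R A T ->
  decomposition T J (s2 * t)%g a1 a2 x c1 c2 ->
  fm_act hA (of_weyl s1 * eps (std_face D T) * of_weyl s2)%g (simplex t J) =
  simplex (s1 * a1)%g
    (Xi T J x :|: (perp A (Xi T J x) :&: simple_image c1 (finp J))).
Proof.
move=> Ts [wE a1T a2T xl xr c1Y c1r c2J xc1l xc1r].
set Y := infp J in xr c1Y *.
set X := Xi T J x; set K := perp A X :&: simple_image c1 (finp J).
have [Xs XE] := face_intersection Ts (special_infpart R A J) xl xr.
rewrite -/Y -/(Xi T J x) -/X in Xs XE.
rewrite fm_actM fm_act_weyl pi_weyl_eps.
have [m0 m0d m0z] := @facet_exists _ _ _ D J.
have [n0 n0d n0z] := @facet_exists _ _ _ D (X :|: K).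
have m0J i : i \in J -> pair m0 (cor i) = 0 by rewrite -m0z => /zerosP.
pose q := weyl_act (x * c1)%g m0.
have tq : tits_cone q by apply/tits_cone_act/dominant_tits.
have pE : weyl_act (s2 * t)%g m0 = weyl_act a1 (weyl_act a2 q).
  by rewrite wE /q -!weyl_actM !mulgA weyl_actM (par_fix m0J c2J).
have TX : T \subset X by rewrite /X /Xi -setUA subsetUl.
have YX : Y \subset X by rewrite /X /Xi setUAC subsetUr.
have rX : red x \subset X by rewrite /X /Xi subsetUr.
have stdXT n : std X n -> std T n.
  by move=> [tn nz]; split=> // i /(subsetP TX)/nz.
have fixX v n : WP X v -> std X n -> weyl_act v n = n.
  by move=> vX /stdP nX; apply: par_fix vX.
have a2X := parS TX a2T.
have qface : span_face q = (weyl_act x @` std Y)%classic.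
  rewrite /q weyl_actM !span_face_actE (span_face_facet hA m0d m0z).
  congr (_ @` _)%classic; apply/seteqP; split=> n.
    by move=> [n' n'Y <-]; apply: std_perp_act.
  by move=> nY; apply/mem_actV; apply: std_perp_act => //; apply: parV.
have Xq : (std X `<=` span_face (weyl_act a2 q))%classic.
  move=> n nX; rewrite span_face_actE; apply/mem_actV.
  rewrite (fixX _ _ (parV a2X) nX) qface.
  by move: nX; rewrite -XE => -[].
have act_perp i : i \in perp A X ->
    pair (weyl_act a2 q) (cor i) = pair m0 (hact (c1^-1)%g (cor i)).
  move=> iX; rewrite /q -weyl_actM pair_hactV mulgA invgM hactM.
  by rewrite (par_act_perp_cor _ iX) //; apply: parV; apply: parM => //;
    apply: parS rX (par_red x).
have xfix i : i \in perp A X -> hact x (cor i) = cor i.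
  by move=> iX; apply: par_act_perp_cor iX; apply: parS rX (par_red x).
have perpXT : perp A X \subset perp A T := perpS _ TX.
have c1pos i : i \in perp A X -> hpos (hact (c1^-1)%g (cor i)).
  move=> iX.
  have -> : hact (c1^-1)%g (cor i) = hact ((x * c1)^-1)%g (cor i).
    by rewrite invgM hactM -{2}(xfix i iX) hactK.
  apply: ((minreps_lP _ _).1 xc1l).
  by rewrite in_setU (subsetP perpXT) ?orbT.
have KE : K = perp A X :&: zeros (weyl_act a2 q).
  apply/setP => i; rewrite !in_setI; have [iX|//] := boolP (i \in perp A X).
  apply/idP/idP => /=.
    rewrite inE => /exists_inP[j jF /eqP/esym/root_corP E].
    apply/zerosP; rewrite act_perp // -E hactK; apply: m0J.
    exact: (subsetP (finpart_sub R A J)).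
  move=> /zerosP; rewrite act_perp // => z.
  have [c cE] := c1pos i iX.
  have cJ j : c j != 0%N -> j \in J.
    move=> cj; rewrite -m0z; apply/zerosP.
    have cT : forall k, k \notin [set: I] -> c k = 0%N by move=> k; rewrite inE.
    have m0K : Kdom [set: I] m0 by move=> k _; apply: m0d.
    have := (pair_eq0_supp m0K cT cE).1 z j; rewrite inE.
    by move=> /(_ isT)[/eqP|//]; rewrite (negbTE cj).
  have bJ : supp_in J (hact (c1^-1)%g (cor i)).
    exists (fun j => (c j)%:R); split=> // j jJ;
      case: (eqVneq (c j) 0%N) => [->//|].
    by move=> /cJ; rewrite (negbTE jJ).
  have yb : hact (x * c1)%g (hact (c1^-1)%g (cor i)) = cor i.
    by rewrite -hactM mulgK xfix.
  have [j jJ N] : exists2 j, j \in J & ~ hpos (hact (s_ i * (x * c1))%g (cor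
    j)).
    apply: contrapT => N; apply: (@hpos_corN _ _ _ D i).
    rewrite -hact_srefl_cor -yb -hactM; apply: hpos_act_supp bJ (c1pos i iX) _.
    by move=> j jJ; apply: contrapT => Nj; apply: N; exists j.
  have yj := hpos_cross ((minreps_rP _ _).1 xc1r j jJ) N.
  have c1j : hact c1 (cor j) = cor i.
    by rewrite -[LHS](hactK x) -(hactM x) yj -{1}(xfix i iX) hactK.
  rewrite inE; apply/exists_inP; exists j; last by apply/eqP/esym/root_corP.
  have /orP[//|jY] := finpart_or_infpart R A jJ.
  have ij : cor j = cor i by rewrite -c1j (perp_act_cor c1Y jY).
  have [k kE] := @weight_exists _ _ _ D (fun k => (k == i)%:R).
  have /eqP := kE j; rewrite ij kE eqxx eq_sym pnatr_eq1 eqb1 => /eqP ji.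
  by case/negP: (perp_disj iX); rewrite -ji; apply: (subsetP YX).
have Kq : Kdom (perp A X) (weyl_act a2 q).
  by move=> i iX; rewrite act_perp // dominant_pair //; apply: c1pos.
have pr : projects (std X) (weyl_act a2 q) n0.
  by apply: projects_std => //; [exact: tits_cone_act|rewrite n0z KE].
have Sface : (std T `&` span_face (weyl_act (s2 * t)%g m0))%classic =
             (weyl_act a1 @` std X)%classic.
  rewrite pE span_face_actE; apply/seteqP; split=> n.
    move=> [nT /mem_actV nq]; apply/mem_actV.
    have {}nT : std T (weyl_act (a1^-1)%g n) by apply: std_perp_act => //;
      apply: parV.
    move: nq nT; set n' := weyl_act _ n => + nT.
    rewrite span_face_actE => /mem_actV.
    have -> : weyl_act (a2^-1)%g n' = n' by apply: par_fix (parV a2T);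
      apply: stdP nT.
    by rewrite qface -XE.
  move=> /mem_actV nX; split; last by apply/mem_actV; apply: Xq.
  by rewrite -(weyl_actVK a1 n); apply: std_perp_act => //; apply: stdXT.
apply: simplex_inj.
have tp := tits_cone_act (s2 * t)%g (dominant_tits m0d).
rewrite (fm_actE hA tp (simplex_facet _ m0d m0z) (m := weyl_act a1 n0)) /=.
  by rewrite -weyl_actM; apply/esym/(simplex_facet _ n0d n0z).
by rewrite std_faceE // Sface pE; apply: projects_act.
Qed.

End Formula.

Theorem theorem4p12 (R : realType) (I : finType) (A : gcm I)
    (D : realization R A) (hA : symmetrizable R A) :
  (forall (Theta J : {set I}) (w : weyl D), special R A Theta ->
     exists a1 a2 x c1 c2, decomposition Theta J w a1 a2 x c1 c2) /\
  exists act : face_monoid D -> coxeter_complex D -> coxeter_complex D,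
    [/\ good_action act, faithful_action act
      & forall (s1 s2 t : weyl D) (Theta J : {set I})
               (a1 a2 x c1 c2 : weyl D),
          special R A Theta ->
          decomposition Theta J (s2 * t)%g a1 a2 x c1 c2 ->
          act (of_weyl s1 * eps (std_face D Theta) * of_weyl s2)%g
              (simplex t J)
          = simplex (s1 * a1)%g
              (Xi Theta J x :|: (perp A (Xi Theta J x)
                 :&: simple_image c1 (finpart R A J)))%SET].
Proof.
split; first by move=> Theta J w _; apply: decomposition_exists.
exists (fm_act hA); split.
- split.
  + by split; [apply: fm_act1|apply: fm_actM].
  + by move=> v w J; apply: fm_act_weyl.
  + by move=> J; apply: fm_act_stab.
  + by move=> u c d; apply: fm_act_mono.
- exact: fm_act_faithful.
- by move=> s1 s2 t Theta J a1 a2 x c1 c2; apply: fm_act_formula.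
Qed.
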